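(* Let $1<p<\infty$, $\delta\ge1$, and let $I\subset\mathbb{R}^n$ be a bounded open rectangle. Let $q^*=q^*(p,\delta)$ and $t^*=t^*(p,\delta)$ be as defined in the context. All suprema below are over bounded open rectangles $J\subset I$. (i) If $w\in s\text{-}RH_p^{\delta}(I)$, then for every $q\in(1,\infty)$ $$\sup_{J\subset I}\langle w\rangle_J\langle w^{1-q'}\rangle_J^{\,q-1}\le C_q(p,\delta):=\begin{cases}+\infty,&1<q\le q^*,\\ \frac1{q^*}\left(\frac{q-1}{q-q^*}\right)^{q-1},&q>q^*,\end{cases}$$ and $$\sup_{J\subset I}\langle w\rangle_J\exp(-\langle\log w\rangle_J)\le C_\infty(p,\delta):=\frac1{q^*}\exp(q^*-1).$$ (ii) If $w\in s\text{-}RH_\infty^{\delta}(I)$, then for every $q\in(1,\infty)$ $$\sup_{J\subset I}\langle w\rangle_J\langle w^{1-q'}\rangle_J^{\,q-1}\le C_q(\infty,\delta):=\begin{cases}+\infty,&1<q\le\delta,\\ \frac1{\delta}\left(\frac{q-1}{q-\delta}\right)^{q-1},&q>\delta,\end{cases}$$ and $$\sup_{J\subset I}\langle w\rangle_J\exp(-\langle\log w\rangle_J)\le C_\infty(\infty,\delta):=\frac1{\delta}\exp(\delta-1).$$ (iii) If $w\in s\text{-}RH_p^{\delta}(I)$, then for every $t\in[p,\infty)$ $$\sup_{J\subset I}\frac{\langle w^t\rangle_J^{1/t}}{\langle w\rangle_J}\le C_t(p,\delta):=\begin{cases}\frac{t^*-1}{t^*}\left(\frac{t^*}{t^*-t}\right)^{1/t},&p\le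 t<t^*,\\ +\infty,&t\ge t^*.\end{cases}$$ In all cases the constants (which do not depend on $n$) are sharp: for fixed $I,p,\delta$ (and $q$ or $t$), no smaller constant makes the corresponding inequality hold for all weights in the respective class.
   Context: Rectangles in $\mathbb{R}^n$ have sides parallel to the coordinate axes. A weight is a non-negative measurable function. $|J|$ denotes Lebesgue measure and $\langle f\rangle_J=\frac1{|J|}\int_J f$. The conjugate exponent of $q\in(1,\infty)$ is $q'=\frac{q}{q-1}$; negative powers of $0$ are $+\infty$. For $1<p<\infty$ and $\delta\ge1$, strong $RH_p^\delta$, written $s\text{-}RH_p^{\delta}(I)$, is the class of weights $w$ on $I$ with $0<\langle w\rangle_J<\infty$ and $\langle w^p\rangle_J^{1/p}\le\delta\langle w\rangle_J$ for every bounded open rectangle $J\subset I$. Similarly $s\text{-}RH_\infty^{\delta}(I)$ is the class of weights $w$ on $I$ with $0<\langle w\rangle_J<\infty$ and $\operatorname{ess\,sup}_J w\le\delta\langle w\rangle_J$ for every bounded open rectangle $J\subset I$. For $\delta>1$, $q^*(p,\delta)$ is the unique solution $x>1$ of $\frac{(x/\delta)^p-1}{x-1}=p$, and $t^*(p,\delta)$ is the unique solution $x>p$ of $\left(\frac{\delta x}{x-1}\right)^p\frac{x-p}{x}=1$. For $\delta=1$: $q^*(p,1)=1$, $t^*(p,1)=+\infty$, and $C_t(p,1)$ is read as its limiting value $1$. *)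

(* Defs.v *)
From HB Require Import structures.
From mathcomp Require Import all_boot all_order all_algebra.
From mathcomp Require Import all_classical all_reals all_analysis.

Set Implicit Arguments.
Unset Strict Implicit.
Unset Printing Implicit Defensive.

Import Order.TTheory GRing.Theory Num.Def Num.Theory.
Import numFieldNormedType.Exports.

Local Open Scope classical_set_scope.
Local Open Scope ring_scope.

Section lebesgue_outer_measure.
Context {R : realType} {n : nat}.
Implicit Types (a b : 'rV[R]_n.+1) (A : set 'rV[R]_n.+1).

Definition box a b : set 'rV[R]_n.+1 :=
  [set x | forall i, a 0 i < x 0 i < b 0 i].

(* Correct also when [box a b] is empty, since then some factor is 0; in
   dimension 0 there would be no such factor. *)
Definition box_volume a b : R := \prod_i Num.max 0 (b 0 i - a 0 i).

Local Open Scope ereal_scope.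

Definition lebesgue_outer A : \bar R :=
  ereal_inf [set \sum_(k <oo) (box_volume (c k).1 (c k).2)%:E |
             c in [set c : nat -> 'rV[R]_n.+1 * 'rV[R]_n.+1 |
                   A `<=` \bigcup_k box (c k).1 (c k).2]].

Lemma box_volume_ge0 a b : (0 <= box_volume a b)%R.
Proof. by apply: prodr_ge0 => i _; rewrite le_max lexx. Qed.

Lemma box_volume_diag a : box_volume a a = 0%R.
Proof. by rewrite /box_volume big_ord_recl subrr maxxx mul0r. Qed.

Lemma lebesgue_outer_ge0 A : 0 <= lebesgue_outer A.
Proof.
apply: le_ereal_inf_tmp => _ [c _ <-].
by apply: nneseries_ge0 => k _ _; rewrite lee_fin box_volume_ge0.
Qed.

Lemma lebesgue_outer0 : lebesgue_outer set0 = 0.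
Proof.
apply/eqP; rewrite eq_le lebesgue_outer_ge0 andbT.
apply: ereal_inf_lbound; exists (fun=> (0%R, 0%R)) => //=.
by rewrite eseries0// => k _ _; rewrite box_volume_diag.
Qed.

Lemma le_lebesgue_outer :
  {homo lebesgue_outer : A B / A `<=` B >-> A <= B}.
Proof.
move=> A B AB; apply/ereal_inf_le_tmp => _ [c Bc <-].
by exists c => //; exact: subset_trans AB Bc.
Qed.

Lemma lebesgue_outer_sigma_subadditive : sigma_subadditive lebesgue_outer.
Proof.
move=> A; have [[i ioo]|] := pselect (exists i, lebesgue_outer (A i) = +oo).
  rewrite (eseries_pinfty _ _ ioo) ?leey// => k _.
  by rewrite -ltNye (lt_le_trans _ (lebesgue_outer_ge0 _)).
rewrite -forallNE => Aoo.
suff add2e (e : {posnum R}) : lebesgue_outer (\bigcup_k A k) <=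
    \sum_(i <oo) lebesgue_outer (A i) + e%:num%:E.
  by apply/lee_addgt0Pr => _/posnumP[].
rewrite (le_trans _ (epsilon_trick _ _ _))//; last first.
  by move=> k; exact: lebesgue_outer_ge0.
pose vol (c : 'rV[R]_n.+1 * 'rV[R]_n.+1) := (box_volume c.1 c.2)%:E.
have vol0 c : 0 <= vol c by rewrite lee_fin box_volume_ge0.
pose P k (c : nat -> 'rV[R]_n.+1 * 'rV[R]_n.+1) :=
  A k `<=` \bigcup_j box (c j).1 (c j).2 /\
  \sum_(j <oo) vol (c j) <=
    lebesgue_outer (A k) + (e%:num / (2 ^ k.+1)%:R)%:E.
have [G PG] : {G & forall k, P k (G k)}.
  apply: (@choice _ _ P) => k; rewrite /P /lebesgue_outer.
  set S := (X in ereal_inf X); move infS : (ereal_inf S) => iS.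
  case: iS infS => [r Sr|Soo|Soo].
  - have en1 : (0 < e%:num / (2 ^ k.+1)%:R)%R by rewrite divr_gt0// ltr0n expn_gt0.
    have /(lb_ereal_inf_adherent en1) : ereal_inf S \is a fin_num by rewrite Sr.
    move=> [x [c Akc volx] xS].
    by exists c; split => //; rewrite volx -Sr; exact/ltW.
  - by have := Aoo k; rewrite /lebesgue_outer Soo.
  - suff : lbound S 0 by move/le_ereal_inf_tmp; rewrite Soo.
    by move=> /= _ [c _ <-]; apply: nneseries_ge0 => k0 _ _; exact: vol0.
have volG0 x : 0 <= (vol \o uncurry G) x by exact: vol0.
apply: (@le_trans _ _ (\esum_(i in setT) (vol \o uncurry G) i)).
  apply: ereal_inf_lbound => /=.
  have /card_esym/ppcard_eqP[f] := card_nat2.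
  exists (uncurry G \o f).
    move=> t [i _] /(PG i).1[j _ Gij].
    by exists (f^-1%FUN (i, j)) => //=; rewrite invK ?inE.
  rewrite -(esum_pred_image (vol \o uncurry G) _ xpredT) ?[fun=> _]set_true//.
  by rewrite image_eq.
rewrite (_ : esum _ _ = \sum_(i <oo) \sum_(j <oo) vol (G i j)); last first.
  pose J : nat -> set (nat * nat) := fun i => [set (i, j) | j in setT].
  rewrite (_ : setT = \bigcup_k J k); last first.
    by rewrite predeqE => -[a b]; split => // _; exists a => //; exists b.
  rewrite esum_bigcupT /=; last 2 first.
    - apply/trivIsetP => i j _ _ ij.
      rewrite predeqE => -[k m] /=; split => //= -[] [_] _ [<-{k} _].
      by move=> [m' _] [] /esym/eqP; rewrite (negbTE ij).
    - by move=> /= [k m]; exact: vol0.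
  rewrite -(image_id [set: nat]) -fun_true esum_pred_image//; last first.
    by move=> k _; exact: esum_ge0.
  apply: eq_eseriesr => /= j _.
  rewrite -(esum_pred_image (vol \o uncurry G) (pair j) predT)//=; last first.
    by move=> ? ? _ _; exact: (@can_inj _ _ _ snd).
  by congr esum; rewrite predeqE => -[a b]; split; move=> [i _ <-]; exists i.
apply: lee_lim.
- apply: is_cvg_nneseries => k *.
  by apply: nneseries_ge0 => m *; exact: (volG0 (k, m)).
- apply: is_cvg_nneseries => k *.
  by apply: adde_ge0 => //; exact: lebesgue_outer_ge0.
- by near=> k; apply: lee_sum => i _; exact: (PG i).2.
Unshelve. all: by end_near. Qed.

HB.instance Definition _ := isOuterMeasure.Build R 'rV[R]_n.+1 lebesgue_outer
  lebesgue_outer0 lebesgue_outer_ge0 le_lebesgue_outer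
  lebesgue_outer_sigma_subadditive.

End lebesgue_outer_measure.

(* The space R^(n+1) with its sigma-algebra of Lebesgue measurable sets; the
   dimension is a successor so that it is at least 1. *)
Definition Rn (R : realType) (n : nat) : Type :=
  caratheodory_type (@lebesgue_outer R n).
HB.instance Definition _ (R : realType) (n : nat) :=
  Measurable.on (Rn R n).

Definition lebesgue (R : realType) (n : nat) : set (Rn R n) -> \bar R :=
  @lebesgue_outer R n.
HB.instance Definition _ (R : realType) (n : nat) :=
  isMeasure.Build _ (Rn R n) R (@lebesgue R n)
    (@caratheodory_measure0 R 'rV[R]_n.+1 (@lebesgue_outer R n))
    (@caratheodory_measure_ge0 R 'rV[R]_n.+1 (@lebesgue_outer R n))
    (@caratheodory_measure_sigma_additive R 'rV[R]_n.+1 (@lebesgue_outer R n)).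

Section averages.
Context {R : realType} {n : nat}.
Implicit Types (I J : set (Rn R n)) (w : Rn R n -> R).

Definition open_rectangle J : Prop :=
  exists a b : 'rV[R]_n.+1, (forall i, a 0 i < b 0 i) /\ J = box a b.

Definition rectangles_in I : set (set (Rn R n)) :=
  [set J | open_rectangle J /\ J `<=` I].

Local Open Scope ereal_scope.

Definition avg J (f : Rn R n -> \bar R) : \bar R :=
  (\int[@lebesgue R n]_(x in J) f x) / lebesgue J.

(* The library's [ess_sup] is over the whole space. *)
Definition ess_sup_on J (f : Rn R n -> \bar R) : \bar R :=
  ereal_inf [set y | \forall x \ae @lebesgue R n, J x -> f x <= y].

(* Unlike [powR], negative powers of 0 are +oo. *)
Definition powRe (x s : R) : \bar R :=
  if (x == 0%R) && (s < 0)%R then +oo else (x `^ s)%:E.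

Definition weight_on I w : Prop :=
  measurable_fun I w /\ forall x, I x -> (0 <= w x)%R.

Definition strong_RH (p delta : R) I : set (Rn R n -> R) :=
  [set w | weight_on I w /\ forall J, rectangles_in I J ->
     0 < avg J (EFin \o w) < +oo /\
     avg J (fun x => (w x `^ p)%:E) `^ p^-1%R <= delta%:E * avg J (EFin \o w)].

Definition strong_RH_infty (delta : R) I : set (Rn R n -> R) :=
  [set w | weight_on I w /\ forall J, rectangles_in I J ->
     0 < avg J (EFin \o w) < +oo /\
     ess_sup_on J (EFin \o w) <= delta%:E * avg J (EFin \o w)].

Definition conj_exponent (q : R) : R := (q / (q - 1))%R.

Definition Aq_characteristic (q : R) I w : \bar R :=
  ereal_sup [set avg J (EFin \o w) *
      avg J (fun x => powRe (w x) (1 - conj_exponent q)%R) `^ (q - 1)%R |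
    J in rectangles_in I].

Definition Ainfty_characteristic I w : \bar R :=
  ereal_sup [set avg J (EFin \o w) *
      expeR (- avg J (fun x => lne (w x)%:E)) |
    J in rectangles_in I].

Definition RH_characteristic (t : R) I w : \bar R :=
  ereal_sup [set avg J (fun x => (w x `^ t)%:E) `^ t^-1%R / avg J (EFin \o w) |
    J in rectangles_in I].

Definition sharp_bound (W : set (Rn R n -> R)) (F : (Rn R n -> R) -> \bar R)
    (C : \bar R) : Prop :=
  (forall w, W w -> F w <= C) /\
  (forall c, (forall w, W w -> F w <= c) -> C <= c).

End averages.

Section constants.
Context {R : realType}.
Implicit Types p q t delta s : R.

(* For [delta > 1] the equations below have exactly one solution in the given
   range, so [get] selects it. *)
Definition qstar p delta : R :=
  if delta == 1 then 1
  else get [set x : R | 1 < x /\ ((x / delta) `^ p - 1) / (x - 1) = p].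

Definition tstar p delta : \bar R :=
  if delta == 1 then +oo%E
  else (get [set x : R | p < x /\
     (delta * x / (x - 1)) `^ p * ((x - p) / x) = 1])%:E.

Definition Aq_constant s q : \bar R :=
  if q <= s then +oo%E else (s^-1 * ((q - 1) / (q - s)) `^ (q - 1))%:E.

Definition Ainfty_constant s : \bar R := (s^-1 * expR (s - 1))%:E.

(* The value at [tstar = +oo] is the limit of the finite case. *)
Definition RH_constant p delta t : \bar R :=
  if tstar p delta is ts%:E then
    if t < ts then ((ts - 1) / ts * (ts / (ts - t)) `^ t^-1)%:E else +oo%E
  else 1%E.

End constants.

(* Main.v *)
Require Import Defs.
From mathcomp Require Import all_boot all_order all_algebra.
From mathcomp Require Import all_classical all_reals all_analysis.
From mathcomp Require Import measurable_realfun.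
From mathcomp Require Import ring lra zify.

(* Let [Delta = delta `^ p], and let [a] be the root of [(1 + a) `^ p / (1 + a * p) =
   Delta] which is positive ([a = qstar - 1]) when negative moments are bounded, with
   [r = - (q - 1)^-1 < 0], and negative ([a = - tstar^-1]) when positive moments are
   bounded, with [r = t > p]. Everything reduces to
     <w^r> <= (1 + a)^r / (1 + a r) <w>^r.
   Let F t and P t be the integrals of w and w^p over the part of measure t of the
   rectangle where w is smallest (r < 0) or largest (r > p). A multidimensional rising
   sun lemma, whose stopping family consists of rectangles and not of cubes, turns the
   hypothesis on all subrectangles into P t <= Delta t (F t / t)^p, without loss in the
   constant. This is a differential inequality in one variable: as F' and P' are m and
   m^p, with m the value of w at the boundary of the part, a suitable combination of
   t (F / t)^r and (F / t)^(r - p) P grows at least as fast as the integral of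
   w^r. Part (ii) is the limit p -> oo, and the exponential bounds are the limit
   q -> oo. The extremal weights are (x_1 - a_1)^a, where a_1 is the left end of the
   first side of the rectangle. *)

Set Implicit Arguments.
Unset Strict Implicit.
Unset Printing Implicit Defensive.

Import Order.TTheory GRing.Theory Num.Theory.
Import numFieldNormedType.Exports.
Local Open Scope classical_set_scope.
Local Open Scope ring_scope.

(** * Boxes and their measure *)

(** For the rearranged weight x^a the hypothesis on the parts of measure [t] is an equality for
    every [t], and so is the claim. The comparison function in the differential inequality must
    respect both equalities, which leaves a single coefficient, [gap_coef]; it is found by requiring
    contact of first order at the extremal ratio [m / (F / t) = 1 + a]. As [P] enters linearly, the
    worst case is equality in the hypothesis.

    The rising sun step loses no constant because the position of a cut varies continuously: a
    rectangle is selected when its mean equals the prescribed value exactly. The price is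
    uncontrolled eccentricity, so averages over shrinking rectangles need not converge for general
    reasons; disjointness of the rectangles of one stage replaces this.

    Weights may vanish and higher moments may be infinite. Therefore a constant is added, which
    preserves [delta] by Minkowski's inequality, and powers are truncated, until limits remove both.
    The degenerate root [a = 0] for [delta = 1] is also reached by a limit. *)

Lemma cover_volume (R : realType) (m : nat) (K : pred nat) (a b : nat -> R)
    (c d : nat -> nat -> R) :
  (forall x : nat -> R, (forall i, (i < m)%N -> a i < x i < b i) ->
     exists2 k, K k & forall i, (i < m)%N -> c k i < x i < d k i) ->
  ((\prod_(i < m) Num.max 0 (b i - a i))%:E <=
   \sum_(k <oo | K k) (\prod_(i < m) Num.max 0 (d k i - c k i))%:E)%E.
Proof.
elim: m K => [|m IH] K cov.
  have [//|k Kk _] := cov (fun=> 0).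
  rewrite big_ord0; apply: le_trans (nneseries_lim_ge k.+1 _); last first.
    by move=> n _ _; rewrite lee_fin big_ord0.
  rewrite big_mkord (bigD1 ord_max)//= big_ord0 leeDl// sume_ge0// => i _.
  by rewrite lee_fin big_ord0.
pose V (u v : nat -> R) := \prod_(i < m) Num.max 0 (v i - u i).
have V0 u v : 0 <= V u v by apply: prodr_ge0 => i _; rewrite le_max lexx.
pose S (u v : R) : set R := `]u, v[%classic.
have mS u v : measurable (S u v) by exact: measurable_itv.
have muS u v : lebesgue_measure (S u v) = (Num.max 0 (v - u))%:E.
  rewrite /S lebesgue_measure_itv/= lte_fin; case: ltP => uv.
    by rewrite max_r ?subr_ge0 ?ltW// EFinB.
  by rewrite max_l// subr_le0.
(* Fixing the last coordinate [y] reduces the dimension: the boxes whose last interval contains [y]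
   cover the section. Hence the predicate [K] on indices in the statement. Integrating over [y]
   restores the last factor. *)
have slice y : ((V a b)%:E * (\1_(S (a m) (b m)) y)%:E <=
    \sum_(k <oo | K k) ((V (c k) (d k))%:E * (\1_(S (c k m) (d k m)) y)%:E))%E.
  rewrite indicE; case: (boolP (y \in _)) => yab; last first.
    by rewrite mule0 nneseries_ge0// => k _ _; rewrite -EFinM lee_fin mulr_ge0.
  rewrite mule1; pose K' k := K k && (y \in S (c k m) (d k m)).
  have /le_trans : ((V a b)%:E <= \sum_(k <oo | K' k) (V (c k) (d k))%:E)%E.
    apply: IH => x xab; have [i|k Kk xk] := cov (fun i => if i == m then y else x i).
      rewrite ltnS leq_eqVlt; case: eqP => [-> _|_ /= im]; last exact: xab.
      by move: yab; rewrite inE /S/= in_itv.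
    exists k.
      by rewrite /K' Kk inE /S/= in_itv/=; have := xk m (ltnSn m); rewrite eqxx.
    move=> i im; have := xk i (ltnW im).
    by rewrite (ltn_eqF im).
  apply; rewrite /K' eseries_mkcondr lee_nneseries//.
    by move=> k _ _; case: ifP; rewrite ?lee_fin.
  by move=> k _; rewrite indicE; case: ifP => _; rewrite ?mule1 ?mule0.
(* A zero volume off [K] turns the restricted sum into one over all indices, where sum and integral
   are exchanged. *)
pose v k := if K k then V (c k) (d k) else 0.
have v0 k : 0 <= v k by rewrite /v; case: ifP.
have mS1 u w (k : R) : measurable_fun [set: R] (fun y : R => (k%:E * (\1_(S u w) y)%:E : \bar R)%E).
  by apply: emeasurable_funM => //; apply/measurable_EFinP.
have intS u w (k : R) : 0 <= k ->
    (\int[lebesgue_measure]_y (k%:E * (\1_(S u w) y)%:E) =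
     (k * Num.max 0 (w - u))%:E)%E.
  move=> k0; rewrite ge0_integralZl//. 2:{ by apply/measurable_EFinP; apply: measurable_indic; exact: mS. }
  rewrite integral_indic//; last exact: mS.
  by rewrite setIT [X in (_ * X)%E]muS EFinM.
have : (\int[lebesgue_measure]_y ((V a b)%:E * (\1_(S (a m) (b m)) y)%:E) <=
    \int[lebesgue_measure]_y
      \sum_(k <oo) ((v k)%:E * (\1_(S (c k m) (d k m)) y)%:E))%E.
  apply: ge0_le_integral => //.
  - by move=> y _; rewrite -EFinM lee_fin mulr_ge0.
  - exact: mS1.
  - apply: (@ge0_emeasurable_sum _ _ R _ _ xpredT) => [k y _ _|k _]; last exact: mS1.
    by rewrite -EFinM lee_fin mulr_ge0.
  - move=> y _; apply: (le_trans (slice y)); rewrite eseries_mkcond lee_nneseries//.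
      by move=> k _ _; case: ifP => // _; rewrite -EFinM lee_fin mulr_ge0.
    by move=> k _; rewrite /v; case: ifP => _ //; rewrite mul0e.
rewrite intS// integral_nneseries//; last 2 first.
- by move=> k; exact: mS1.
- by move=> k y _; rewrite -EFinM lee_fin mulr_ge0.
move=> h; rewrite big_ord_recr/=; apply: (le_trans h).
rewrite [leRHS]eseries_mkcond; apply: lee_nneseries => k _.
  by rewrite integral_ge0// => y _; rewrite -EFinM lee_fin mulr_ge0.
by rewrite intS// /v; case: ifP => _; rewrite ?mul0r// big_ord_recr.
Qed.

Lemma lebesgue_outer_box (R : realType) (n : nat) (a b : 'rV[R]_n.+1) :
  lebesgue_outer (box a b) = (box_volume a b)%:E.
Proof.
apply/eqP; rewrite eq_le; apply/andP; split.
  apply: ereal_inf_lbound => /=.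
  (* A cover is an infinite sequence, so the box is followed by degenerate boxes of volume 0. *)
  exists (fun k : nat => if k == 0%N then (a, b) else (0%R, 0%R)).
    by move=> x xab; exists 0%N.
  rewrite (@nneseriesD1 _ _ 0%N)//=; last first.
    by move=> k _; rewrite lee_fin box_volume_ge0.
  rewrite eseries0 ?adde0// => -[|k]// _ _.
  by rewrite /= box_volume_diag.
apply: le_ereal_inf_tmp => _ [c abc <-].
have E (u v : 'rV[R]_n.+1) : box_volume u v =
    \prod_(i < n.+1) Num.max 0 ((fun j => v 0 (inord j)) i - (fun j => u 0 (inord j)) i).
  by apply: eq_bigr => i _; rewrite !inord_val.
rewrite E; under eq_eseriesr do rewrite E.
apply: (@cover_volume R n.+1 xpredT (fun j => a 0 (inord j)) (fun j => b 0 (inord j))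
  (fun k j => (c k).1 0 (inord j)) (fun k j => (c k).2 0 (inord j))) => x xab.
have [i|k _ xk] := abc (\row_i x i).
  by rewrite mxE; have := xab i (ltn_ord i); rewrite inord_val.
by exists k => // i im; have := xk (inord i); rewrite mxE inordK.
Qed.

Definition row_set (R : realType) (n : nat) (u : 'rV[R]_n.+1) (i : 'I_n.+1) (t : R) :
  'rV[R]_n.+1 := \row_j (if j == i then t else u 0 j).

Lemma row_setE (R : realType) (n : nat) (u : 'rV[R]_n.+1) i t j :
  row_set u i t 0 j = if j == i then t else u 0 j.
Proof. by rewrite mxE. Qed.

Definition cross_section (R : realType) (n : nat) (i : 'I_n.+1) (a b : 'rV[R]_n.+1) : R :=
  \prod_(j < n.+1 | j != i) Num.max 0 (b 0 j - a 0 j).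

Lemma cross_section_ge0 (R : realType) (n : nat) (i : 'I_n.+1) (a b : 'rV[R]_n.+1) :
  0 <= cross_section i a b.
Proof. by apply: prodr_ge0 => j _; rewrite le_max lexx. Qed.

Lemma box_volumeD1 (R : realType) (n : nat) (i : 'I_n.+1) (a b : 'rV[R]_n.+1) :
  box_volume a b = Num.max 0 (b 0 i - a 0 i) * cross_section i a b.
Proof. by rewrite /box_volume (bigD1 i). Qed.

Lemma cross_section_setl (R : realType) (n : nat) (i : 'I_n.+1) (a b : 'rV[R]_n.+1) t :
  cross_section i (row_set a i t) b = cross_section i a b.
Proof. by apply: eq_bigr => j /negbTE ji; rewrite row_setE ji. Qed.

Lemma cross_section_setr (R : realType) (n : nat) (i : 'I_n.+1) (a b : 'rV[R]_n.+1) t :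
  cross_section i a (row_set b i t) = cross_section i a b.
Proof. by apply: eq_bigr => j /negbTE ji; rewrite row_setE ji. Qed.

(** The piece on the closed side must still fit into an open box, so its upper face is pushed beyond
    [t] by [h], at a cost of at most [h * C <= e]. Dividing by [C + 1] allows for a cross-section
    [C = 0]. *)
Lemma box_cut (R : realType) (n : nat) (i : 'I_n.+1) (t e : R) (a b : 'rV[R]_n.+1) :
  0 < e -> exists c d : 'rV[R]_n.+1 * 'rV[R]_n.+1,
  [/\ box a b `&` [set x | t < x 0 i] `<=` box c.1 c.2,
      box a b `&` ~` [set x | t < x 0 i] `<=` box d.1 d.2 &
      box_volume c.1 c.2 + box_volume d.1 d.2 <= box_volume a b + e].
Proof.
move=> e0; have C0 := cross_section_ge0 i a b.
set C := cross_section i a b in C0.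
pose h := e / (C + 1); have C10 : 0 < C + 1 by lra.
have h0 : 0 < h by rewrite divr_gt0.
exists (row_set a i (Num.max (a 0 i) t), b), (a, row_set b i (Num.min (b 0 i) (t + h))).
split=> /=.
- move=> x [xab tx] j; rewrite row_setE; case: eqP => [->|_]; last exact: xab.
  by move: (xab i) => /andP[? ->]; rewrite gt_max tx andbT; apply/andP; split.
- move=> x [xab /= /negP]; rewrite -leNgt => tx j; rewrite row_setE.
  case: eqP => [->|_]; last exact: xab.
  by move: (xab i) => /andP[-> ?] /=; rewrite lt_min; apply/andP; split=> //; lra.
rewrite !(box_volumeD1 i) !row_setE eqxx cross_section_setl cross_section_setr -/C.
have hC : h * C <= e.
  by rewrite /h mulrAC ler_pdivrMr//; nra.
apply: (@le_trans _ _ ((Num.max 0 (b 0 i - a 0 i) + h) * C)); last first.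
  by rewrite mulrDl lerD2l.
rewrite -mulrDl ler_wpM2r//.
move: (a 0 i) (b 0 i) => u v; rewrite /Num.max /Num.min.
by repeat case: ifP => ?; lra.
Qed.

(** Caratheodory's criterion is checked on covers: each covering box is cut in two by [box_cut],
    with errors [e / 2 ^ k.+1] that sum to [e], and the pieces cover the two parts of [X]. *)
Lemma measurable_open_halfspace (R : realType) (n : nat) (i : 'I_n.+1) (t : R) :
  measurable ([set x : 'rV[R]_n.+1 | t < x 0 i] : set (Rn R n)).
Proof.
apply: (@le_caratheodory_measurable R _ (@lebesgue_outer R n)) => X.
apply: le_ereal_inf_tmp => _ [c Xc <-].
apply/lee_addgt0Pr => e e0.
have e2 (k : nat) : 0 < e / (2 ^ k.+1)%:R by rewrite divr_gt0// ltr0n expn_gt0.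
have /choice[f Pf] : forall k, exists cd : ('rV[R]_n.+1 * 'rV[R]_n.+1) * ('rV[R]_n.+1 * 'rV[R]_n.+1),
  [/\ box (c k).1 (c k).2 `&` [set x | t < x 0 i] `<=` box cd.1.1 cd.1.2,
      box (c k).1 (c k).2 `&` ~` [set x | t < x 0 i] `<=` box cd.2.1 cd.2.2 &
      box_volume cd.1.1 cd.1.2 + box_volume cd.2.1 cd.2.2 <= box_volume (c k).1 (c k).2 + e / (2 ^ k.+1)%:R].
  move=> k; have [u [v uv]] := box_cut i t (c k).1 (c k).2 (e2 k).
  by exists (u, v).
apply: (@le_trans _ _ (\sum_(k <oo) (box_volume (f k).1.1 (f k).1.2)%:E +
    \sum_(k <oo) (box_volume (f k).2.1 (f k).2.2)%:E)%E).
  apply: leeD; apply: ereal_inf_lbound => /=.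
    exists (fun k => (f k).1) => // x [/Xc[k _ xk] tx]; exists k => //.
    by have [+ _ _] := Pf k; apply.
  exists (fun k => (f k).2) => // x [/Xc[k _ xk] tx]; exists k => //.
  by have [_ + _] := Pf k; apply.
rewrite -nneseriesD => [|k _ _|k _ _]; try by rewrite lee_fin box_volume_ge0.
apply: (le_trans _ (@epsilon_trick _ _ _ xpredT _ _)); last 2 first.
- by move=> k; rewrite lee_fin box_volume_ge0.
- exact: ltW.
apply: lee_nneseries => k _; first by rewrite -EFinD lee_fin addr_ge0 ?box_volume_ge0.
by rewrite -!EFinD lee_fin; have [] := Pf k.
Qed.

Lemma measurable_coord (R : realType) (n : nat) (i : 'I_n.+1) :
  measurable_fun setT (fun x : Rn R n => (x : 'rV[R]_n.+1) 0 i).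
Proof.
apply: (measurability _ (RGenOInfty.measurableE R)) => _ [_ [t ->] <-].
rewrite setTI (_ : _ @^-1` _ = [set x : 'rV[R]_n.+1 | t < x 0 i]).
  exact: measurable_open_halfspace.
by apply/seteqP; split => x /=; rewrite in_itv/= andbT.
Qed.

Lemma measurable_box (R : realType) (n : nat) (a b : 'rV[R]_n.+1) :
  measurable (box a b : set (Rn R n)).
Proof.
rewrite (_ : box a b = \bigcap_(i in [set: 'I_n.+1])
   ((fun x : Rn R n => (x : 'rV[R]_n.+1) 0 i) @^-1` `]a 0 i, b 0 i[%classic)).
  apply: fin_bigcap_measurable => // i _; rewrite -[X in measurable X]setTI.
  exact: measurable_coord.
by apply/seteqP; split => [x xab i _ /=|x xab i]; rewrite ?in_itv/=;
  [exact: xab|have := xab i Logic.I; rewrite /= in_itv].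
Qed.

(** Half-open, so that a cut by a hyperplane leaves two disjoint boxes of the same kind and loses no
    point. The difference from the open box is a null set. *)
Definition cbox (R : realType) (n : nat) (a b : 'rV[R]_n.+1) : set (Rn R n) :=
  [set x : 'rV[R]_n.+1 | forall i, a 0 i < x 0 i <= b 0 i].

Lemma measurable_cbox (R : realType) (n : nat) (a b : 'rV[R]_n.+1) :
  measurable (cbox a b).
Proof.
rewrite (_ : cbox a b = \bigcap_(i in [set: 'I_n.+1])
   ((fun x : Rn R n => (x : 'rV[R]_n.+1) 0 i) @^-1` `]a 0 i, b 0 i]%classic)).
  apply: fin_bigcap_measurable => // i _; rewrite -[X in measurable X]setTI.
  exact: measurable_coord.
by apply/seteqP; split => [x xab i _ /=|x xab i]; rewrite ?in_itv/=;
  [exact: xab|have := xab i Logic.I; rewrite /= in_itv].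
Qed.

Lemma lebesgue_box (R : realType) (n : nat) (a b : 'rV[R]_n.+1) :
  lebesgue (box a b : set (Rn R n)) = (box_volume a b)%:E.
Proof. exact: lebesgue_outer_box. Qed.

Section hyperplanes.
Context {R : realType} {n : nat}.
Implicit Types a b : 'rV[R]_n.+1.
Local Notation mu := (@lebesgue R n).

Lemma measurable_hyperplane (i : 'I_n.+1) (t : R) :
  measurable ([set x : 'rV[R]_n.+1 | x 0 i = t] : set (Rn R n)).
Proof.
rewrite -[X in measurable X]setTI.
by apply: (@measurable_coord R n i measurableT [set t]).
Qed.

(** Within each bounded box [B N] the hyperplane lies in a slab of thickness [2 * h], whose volume
    is at most [e]. *)
Lemma lebesgue_hyperplane (i : 'I_n.+1) (t : R) :
  mu ([set x : 'rV[R]_n.+1 | x 0 i = t] : set (Rn R n)) = 0.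
Proof.
pose H : set (Rn R n) := [set x : 'rV[R]_n.+1 | x 0 i = t].
pose B (N : nat) : set (Rn R n) := box (const_mx (- N%:R)) (const_mx N%:R : 'rV[R]_n.+1).
have mH : measurable H by exact: measurable_hyperplane.
have HB N : mu (H `&` B N) = 0.
  apply/eqP; rewrite eq_le measure_ge0 andbT; apply/lee_addgt0Pr => e e0; rewrite add0e.
  pose C := cross_section i (const_mx (- N%:R)) (const_mx N%:R : 'rV[R]_n.+1).
  have C0 : 0 <= C by exact: cross_section_ge0.
  pose h := e / (2 * (C + 1)).
  have h0 : 0 < h by rewrite divr_gt0// mulr_gt0//; lra.
  pose u := row_set (const_mx (- N%:R)) i (t - h).
  pose v := row_set (const_mx N%:R : 'rV[R]_n.+1) i (t + h).
  apply: (@le_trans _ _ (mu (box u v : set (Rn R n)))).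
    apply: le_measure; rewrite ?inE.
    - by apply: measurableI => //; exact: measurable_box.
    - exact: measurable_box.
    - move=> x [xt xB] j; rewrite !row_setE; case: eqP => [->|_].
        by rewrite xt; apply/andP; split; lra.
      exact: xB.
  rewrite lebesgue_box (box_volumeD1 i) !row_setE eqxx cross_section_setl cross_section_setr -/C.
  rewrite lee_fin max_r; last lra.
  rewrite (_ : t + h - (t - h) = 2 * h); last ring.
  have C1 : C + 1 != 0 by rewrite gt_eqF//; lra.
  have -> : 2 * h = e / (C + 1) by rewrite /h; field.
  rewrite mulrAC ler_pdivrMr//; last lra.
  nra.
have -> : [set x : 'rV[R]_n.+1 | x 0 i = t] = \bigcup_N (H `&` B N).
  apply/seteqP; split => [x xt|x [N _ []]//].
  have x1 : 0 <= \sum_j `|x 0 j| by exact: sumr_ge0.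
  exists (Num.bound (\sum_j `|x 0 j|)) => //; split => // j; rewrite !mxE.
  have : `|x 0 j| < (Num.bound (\sum_j `|x 0 j|))%:R.
    apply: (le_lt_trans _ (archi_boundP x1)).
    by rewrite (bigD1 j)//= lerDl sumr_ge0.
  by rewrite ltr_norml.
apply/negligibleP; first by apply: bigcupT_measurable => N; apply: measurableI => //; exact: measurable_box.
apply: negligible_bigcup => N; apply/negligibleP; last exact: HB.
by apply: measurableI => //; exact: measurable_box.
Qed.

Lemma cboxD_box a b : mu (cbox a b `\` box a b) = 0.
Proof.
have mD : measurable (cbox a b `\` box a b).
  by apply: measurableD; [exact: measurable_cbox|exact: measurable_box].
apply/negligibleP => //.
(* Countable unions are indexed by [nat]; beyond [n] the function [inord] merely repeats a
   hyperplane. *)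
pose H (k : nat) : set (Rn R n) := [set x : 'rV[R]_n.+1 | x 0 (inord k) = b 0 (inord k)].
apply: (@negligibleS _ _ _ _ (\bigcup_k H k)).
  move=> x [xc xb]; apply: contrapT => Hx; apply: xb => i.
  have /andP[-> xi] := xc i; rewrite /= lt_neqAle xi andbT; apply/eqP => xbi.
  by apply: Hx; exists i => //; rewrite /H /= inord_val.
apply: negligible_bigcup => k; exists (H k); split => //.
- exact: measurable_hyperplane.
- exact: lebesgue_hyperplane.
Qed.

Lemma subset_box_cbox a b : (box a b : set (Rn R n)) `<=` cbox a b.
Proof. by move=> x xab i; have /andP[-> /ltW] := xab i. Qed.

Lemma lebesgue_cbox a b : mu (cbox a b) = (box_volume a b)%:E.
Proof.
rewrite -lebesgue_box (measureDI _ (measurable_cbox a b) (measurable_box a b)).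
rewrite [X in (X + _)%E]cboxD_box add0e setIidr//; exact: subset_box_cbox.
Qed.

Lemma Rintegral_cbox a b (f : Rn R n -> R) : mu.-integrable setT (EFin \o f) ->
  \int[mu]_(x in cbox a b) f x = \int[mu]_(x in box a b) f x.
Proof.
move=> fi; rewrite /Rintegral (@negligible_integral _ _ _ _ _ (cbox a b `\` box a b))//.
- by rewrite setDD setIidr//; exact: subset_box_cbox.
- by apply: measurableD; [exact: measurable_cbox|exact: measurable_box].
- exact: measurable_cbox.
- by apply: integrableS fi => //; exact: measurable_cbox.
- exact: cboxD_box.
Qed.

End hyperplanes.

(** * A rising sun lemma for rectangles *)

Section integrable_small_sets.
Context d (T : measurableType d) (R : realType) (mu : {measure set T -> \bar R}).
Variable h : T -> R.
Hypothesis hi : mu.-integrable setT (EFin \o h).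

Let hS (A : set T) : measurable A -> mu.-integrable A (EFin \o h).
Proof. by move=> mA; apply: integrableS hi. Qed.

Lemma RintegralID (A B : set T) : measurable A -> measurable B ->
  \int[mu]_(x in A) h x = \int[mu]_(x in A `&` B) h x + \int[mu]_(x in A `\` B) h x.
Proof.
move=> mA mB; rewrite -{1}(setUIDK A B) Rintegral_setU//.
- exact: measurableI.
- exact: measurableD.
- by apply: hS; rewrite setUIDK.
- by apply/disj_setPS => x [[_ ?] [_]].
Qed.

Lemma Rintegral_small (e : R) : 0 < e -> exists2 r : R, 0 < r &
  forall A, measurable A -> (mu A < r%:E)%E -> \int[mu]_(x in A) `|h x| < e.
Proof.
move=> e0; have [r [r0 H]] := integral_normr_continuous hi e0.
by exists r.
Qed.

(** Continuity of the measure from above, combined with absolute continuity of the integral. *)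
Lemma Rintegral_vanish (A : nat -> set T) (e : R) : 0 < e ->
  (forall N, measurable (A N)) -> (mu (A 0%N) < +oo)%E ->
  (forall M N, (M <= N)%N -> A N `<=` A M) -> \bigcap_N A N = set0 ->
  exists N, \int[mu]_(x in A N) `|h x| < e.
Proof.
move=> e0 mA A0 nA capA; have [r r0 H] := Rintegral_small e0.
have : mu \o A @ \oo --> mu (\bigcap_N A N).
  apply: nonincreasing_cvg_mu => //; first by rewrite capA.
  by move=> M N MN; apply/subsetPset/nA.
rewrite capA measure0 => /fine_cvgP[_ /cvgrPdist_lt/(_ _ r0)].
have fA N : mu (A N) \is a fin_num.
  by rewrite ge0_fin_numE//; apply: le_lt_trans A0; apply: le_measure; rewrite ?inE//; exact: nA.
move=> [N _ /(_ N (leqnn N))] /=; rewrite sub0r normrN ger0_norm ?fine_ge0// => AN.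
by exists N; apply: H => //; rewrite -(fineK (fA N)) lte_fin.
Qed.

End integrable_small_sets.

(** * Tilings by half-open cells and the stopping construction *)

Section cells.
Context {R : realType} {n : nat}.
Local Notation mu := (@lebesgue R n).
Local Notation cell_t := ('rV[R]_n.+1 * 'rV[R]_n.+1)%type.
Implicit Types (c d : cell_t) (s : seq cell_t) (i j : 'I_n.+1).

Definition cell c : set (Rn R n) := cbox c.1 c.2.
Definition proper_cell c := forall j, c.1 0 j < c.2 0 j.
Definition subcell d c := forall j, c.1 0 j <= d.1 0 j /\ d.2 0 j <= c.2 0 j.
Definition side c j : R := c.2 0 j - c.1 0 j.
(** Counting lets [tiling] express covering and disjointness by a single equation, which is additive
    when cells are subdivided. *)
Definition multiplicity s (x : Rn R n) : nat := (\sum_(c <- s) (x \in cell c))%N.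
Definition cells s : set (Rn R n) := [set x | (0 < multiplicity s x)%N].
Definition tiling s (A : set (Rn R n)) := forall x, multiplicity s x = (x \in A).

Lemma box_volume_gt0 c : proper_cell c -> 0 < box_volume c.1 c.2.
Proof. by move=> nc; apply: prodr_gt0 => i _; rewrite lt_max subr_gt0 nc orbT. Qed.

Lemma measurable_cell c : measurable (cell c).
Proof. exact: measurable_cbox. Qed.

Lemma cells_cons c s : cells (c :: s) = cell c `|` cells s.
Proof.
apply/seteqP; split => x /=; rewrite /cells/= /multiplicity big_cons addn_gt0.
  by case/orP => [|]; [rewrite lt0b inE; left|right].
by case=> [xc|->]; rewrite ?orbT// lt0b mem_set.
Qed.

Lemma measurable_cells s : measurable (cells s).
Proof.
elim: s => [|c s IH].
  rewrite (_ : cells _ = set0)//; apply/seteqP; split => x //=.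
  by rewrite /cells/= /multiplicity big_nil.
by rewrite cells_cons; apply: measurableU => //; exact: measurable_cell.
Qed.

Lemma cellsP s x : cells s x <-> exists2 c, c \in s & cell c x.
Proof.
elim: s => [|c s IH].
  by split=> [|[]//]; rewrite /cells/= /multiplicity big_nil.
rewrite cells_cons; split => [[xc|/IH[d ds xd]]|[d]].
- by exists c => //; rewrite mem_head.
- by exists d => //; rewrite in_cons ds orbT.
- by rewrite in_cons => /predU1P[->|ds] xd; [left|right; apply/IH; exists d].
Qed.

Lemma Rintegral_cells s (h : Rn R n -> R) : mu.-integrable setT (EFin \o h) ->
  (forall x, (multiplicity s x <= 1)%N) ->
  \int[mu]_(x in cells s) h x = \sum_(c <- s) \int[mu]_(x in cell c) h x.
Proof.
move=> hi; elim: s => [_|c s IH s1].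
  rewrite big_nil (_ : cells _ = set0) ?Rintegral_set0//.
  by apply/seteqP; split => x //=; rewrite /cells/= /multiplicity big_nil.
rewrite big_cons cells_cons Rintegral_setU.
- rewrite IH// => x; apply: leq_trans (s1 x).
  by rewrite {2}/multiplicity big_cons leq_addl.
- exact: measurable_cell.
- exact: measurable_cells.
- apply: integrableS hi => //; apply: measurableU; [exact: measurable_cell|exact: measurable_cells].
- apply/disj_setPS => x [xc xs]; have := s1 x.
  rewrite /multiplicity big_cons mem_set//= -/(multiplicity s x).
  by move: xs; rewrite /cells /=; case: multiplicity.
Qed.

Lemma tiling_cells s A : tiling s A -> cells s = A.
Proof.
by move=> sA; apply/seteqP; split => x; rewrite /cells/= sA ?lt0b ?inE// => ?; rewrite mem_set.
Qed.

(** [s] holds the cells already selected and [r] those still to be divided; [H c] splits [c] into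
    newly selected and remaining pieces. *)
Lemma tiling_refine (H : cell_t -> seq cell_t * seq cell_t) (s r : seq cell_t) A :
  tiling (s ++ r) A ->
  (forall c, c \in r -> tiling ((H c).1 ++ (H c).2) (cell c)) ->
  tiling ((s ++ flatten (map (fun c => (H c).1) r)) ++ flatten (map (fun c => (H c).2) r)) A.
Proof.
move=> srA Hr x; rewrite -srA /multiplicity !big_cat/= -addnA; congr addn.
rewrite !big_flatten !big_map /= -big_split/= big_seq [RHS]big_seq.
apply: eq_bigr => c cr; have := Hr c cr x.
by rewrite /multiplicity big_cat/=.
Qed.

Lemma tiling_cut c i t : c.1 0 i <= t <= c.2 0 i ->
  tiling [:: (c.1, row_set c.2 i t); (row_set c.1 i t, c.2)] (cell c).
Proof.
move=> /andP[ct tc] x; rewrite /multiplicity !big_cons big_nil addn0.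
have E1 : (x \in cell (c.1, row_set c.2 i t)) = (x \in cell c) && ((x : 'rV[R]_n.+1) 0 i <= t).
  apply/idP/andP => [/set_mem xc|[/set_mem xc xt]]; last first.
    apply/mem_set => j; have := xc j; rewrite /= row_setE.
    by case: eqP => // ->; rewrite xt andbT => /andP[-> _].
  split; last by have := xc i; rewrite /= row_setE eqxx => /andP[].
  apply/mem_set => j; have := xc j; rewrite /= row_setE; case: eqP => // -> /andP[-> xt].
  exact: le_trans tc.
have E2 : (x \in cell (row_set c.1 i t, c.2)) = (x \in cell c) && (t < (x : 'rV[R]_n.+1) 0 i).
  apply/idP/andP => [/set_mem xc|[/set_mem xc xt]]; last first.
    apply/mem_set => j; have := xc j; rewrite /= row_setE.
    by case: eqP => // ->; rewrite xt => /andP[_ ->].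
  split; last by have := xc i; rewrite /= row_setE eqxx => /andP[].
  apply/mem_set => j; have := xc j; rewrite /= row_setE; case: eqP => // -> /andP[xt ->].
  by rewrite (le_lt_trans ct).
rewrite E1 E2; case: (x \in cell c) => //=.
by rewrite ltNge; case: (_ <= t).
Qed.

Lemma row_set_id (u : 'rV[R]_n.+1) i : row_set u i (u 0 i) = u.
Proof. by apply/rowP => j; rewrite row_setE; case: eqP => [->|_]. Qed.

Lemma subcell_refl c : subcell c c. Proof. by move=> j. Qed.

Lemma subcell_trans c d e : subcell e d -> subcell d c -> subcell e c.
Proof.
move=> ed dc j; have [? ?] := ed j; have [? ?] := dc j.
by split; [apply: le_trans; eauto|apply: le_trans; eauto].
Qed.

Lemma side_subcell c d j : subcell d c -> side d j <= side c j.
Proof. by move=> /(_ j)[? ?]; rewrite /side; lra. Qed.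

Lemma subcell_cutl c i t : t <= c.2 0 i -> subcell (c.1, row_set c.2 i t) c.
Proof. by move=> tc j; rewrite /= row_setE; case: eqP => [->|]. Qed.

Lemma subcell_cutr c i t : c.1 0 i <= t -> subcell (row_set c.1 i t, c.2) c.
Proof. by move=> tc j; rewrite /= row_setE; case: eqP => [->|]. Qed.

Lemma proper_cell_cutl c i t : proper_cell c -> c.1 0 i < t ->
  proper_cell (c.1, row_set c.2 i t).
Proof. by move=> nc tc j; rewrite /= row_setE; case: eqP => [->|]. Qed.

Lemma proper_cell_cutr c i t : proper_cell c -> t < c.2 0 i ->
  proper_cell (row_set c.1 i t, c.2).
Proof. by move=> nc tc j; rewrite /= row_setE; case: eqP => [->|]. Qed.

Section rising_sun.
Variable f : Rn R n -> R.
Hypothesis fi : mu.-integrable setT (EFin \o f).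
Local Notation I c := (\int[mu]_(x in cell c) f x).

Lemma Rintegral_cut (h : Rn R n -> R) c i (t : R) : mu.-integrable setT (EFin \o h) ->
  c.1 0 i <= t <= c.2 0 i ->
  \int[mu]_(x in cell c) h x = \int[mu]_(x in cell (c.1, row_set c.2 i t)) h x +
     \int[mu]_(x in cell (row_set c.1 i t, c.2)) h x.
Proof.
move=> hi ct; have tc := tiling_cut ct.
rewrite -(tiling_cells tc) Rintegral_cells// => [|x]; last by rewrite tc; case: (_ \in _).
by rewrite !big_cons big_nil addr0.
Qed.

Lemma Rintegral_cutB c i (s t : R) : c.1 0 i <= s -> s <= t -> t <= c.2 0 i ->
  I (c.1, row_set c.2 i t) - I (c.1, row_set c.2 i s) =
  I (row_set c.1 i s, row_set c.2 i t).
Proof.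
move=> cs st tc; rewrite (@Rintegral_cut f (c.1, row_set c.2 i t) i s)//=; last first.
  by rewrite cs row_setE eqxx st.
rewrite [X in I (_, X)](_ : row_set _ _ _ = row_set c.2 i s).
  by rewrite addrC addKr.
by apply/rowP => j; rewrite !row_setE; case: eqP.
Qed.

(** Between two cuts lies a slab whose volume is proportional to their distance, and absolute
    continuity makes its integral small. This provides the intermediate value theorem in [halve]. *)
Lemma continuous_cut c i : proper_cell c ->
  {within `[c.1 0 i, c.2 0 i], continuous (fun t => I (c.1, row_set c.2 i t))}.
Proof.
move=> nc; apply/subspace_continuousP => t /=; rewrite in_itv/= => tc.
apply/cvgrPdist_lt => e e0.
have [r r0 H] := Rintegral_small fi e0.
pose C := cross_section i c.1 c.2.
have C0 : 0 <= C by exact: cross_section_ge0.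
have key u v : c.1 0 i <= u -> u <= v -> v <= c.2 0 i -> (v - u) * C < r ->
    `|I (c.1, row_set c.2 i v) - I (c.1, row_set c.2 i u)| < e.
  move=> cu uv vc uvr; rewrite Rintegral_cutB//.
  apply: le_lt_trans (le_normr_Rintegral _ _) _; first exact: measurable_cell.
    by apply: integrableS fi => //; exact: measurable_cell.
  apply: H; first exact: measurable_cell.
  rewrite [X in (X < _)%E]lebesgue_cbox (box_volumeD1 i) !row_setE eqxx.
  by rewrite cross_section_setl cross_section_setr max_r ?subr_ge0.
have rC : 0 < r / (C + 1) by rewrite divr_gt0//; lra.
have rCC : r / (C + 1) * C < r.
  by rewrite mulrAC ltr_pdivrMr; [nra|lra].
rewrite near_withinE; near=> u => /=.
have ut : `|t - u| < r / (C + 1) by near: u; exact: nbhsx_ballx.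
move: tc => + uc; move: uc; rewrite in_itv/= => /andP[cu uc] /andP[ct tc].
have {}utC x : `|t - u| = x -> x * C < r.
  by move=> <-; apply: le_lt_trans rCC; rewrite ler_wpM2r// ltW.
have [tu|tu] := leP t u.
  by rewrite distrC; apply: key => //; apply: utC; rewrite distrC ger0_norm// subr_ge0.
by apply: key => //; [exact: ltW|apply: utC; rewrite gtr0_norm// subr_gt0].
Unshelve. all: by end_near. Qed.

(* Moving the cut from the midpoint towards the face of the half with too small
   an integral, the integral over the other half runs through 0. *)
Lemma halve c i : proper_cell c -> I c <= 0 ->
  exists H : seq cell_t * seq cell_t,
  [/\ tiling (H.1 ++ H.2) (cell c),
      forall d, d \in H.1 -> [/\ proper_cell d, subcell d c & I d = 0] &
      forall d, d \in H.2 -> [/\ proper_cell d, subcell d c, I d <= 0 &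
        side d i <= side c i / 2]].
Proof.
move=> nc; rewrite le_eqVlt => /predU1P[Ic|Ic].
  exists ([:: c], [::]); split=> // [x|d].
    by rewrite /multiplicity big_cons big_nil addn0.
  by rewrite inE => /eqP ->; split => //; exact: subcell_refl.
have ci := nc i; set a := c.1 0 i in ci; set b := c.2 0 i in ci.
pose m := (a + b) / 2; have am : a < m by rewrite /m; lra.
have mb : m < b by rewrite /m; lra.
pose L t := (c.1, row_set c.2 i t); pose U t : cell_t := (row_set c.1 i t, c.2).
have LU t : a <= t <= b -> I c = I (L t) + I (U t) by exact: Rintegral_cut.
have cutL t : a < t -> t <= b -> [/\ proper_cell (L t), subcell (L t) c & side (L t) i = t - a].
  move=> ta tb; split; [exact: proper_cell_cutl|exact: subcell_cutl|].
  by rewrite /side/= row_setE eqxx.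
have cutU t : a <= t -> t < b -> [/\ proper_cell (U t), subcell (U t) c & side (U t) i = b - t].
  move=> ta tb; split; [exact: proper_cell_cutr|exact: subcell_cutr|].
  by rewrite /side/= row_setE eqxx.
have sc : side c i = b - a by [].
have Lb : L b = c by rewrite /L /b row_set_id -surjective_pairing.
have La : I (L a) = 0.
  have ab : a <= a <= b by rewrite lexx ltW.
  have Ua : U a = c by rewrite /U /a row_set_id -surjective_pairing.
  by have := LU _ ab; rewrite Ua; lra.
have cL := continuous_cut (i := i) nc.
have sub u v : a <= u -> v <= b -> {within `[u, v], continuous (fun t => I (L t))}.
  move=> au vb; apply: continuous_subspaceW cL; apply: subset_itv; by rewrite bnd_simp.
have tLU t : a <= t <= b -> tiling [:: L t; U t] (cell c) by exact: tiling_cut.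
clearbody L U; clear cL.
have [L0|L0] := leP (I (L m)) 0; have [U0|U0] := leP (I (U m)) 0.
- exists ([::], [:: L m; U m]); split=> //.
    by apply: tLU; rewrite !ltW.
  have [l1 l2 l3] := cutL m am (ltW mb); have [u1 u2 u3] := cutU m (ltW am) mb.
  move=> d; rewrite !inE => /orP[] /eqP ->; split=> //;
    by rewrite ?l3 ?u3 sc /m; clear; lra.
- have [|t] := @IVT R (fun t => I (L t)) a m (I c) (ltW am) (sub _ _ (lexx a) (ltW mb)).
    rewrite La ge_min le_max; apply/andP; split; apply/orP; [right|left]; last exact: ltW.
    rewrite (LU m) ?(ltW am) ?(ltW mb)//.
    by move: U0; clear; lra.
  rewrite in_itv/= => /andP[ta tm] Lt.
  have {}ta : a < t.
    by rewrite lt_neqAle ta andbT; apply/eqP => E; move: Lt Ic; rewrite -E La => <-; rewrite ltxx.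
  have tb : t < b by exact: le_lt_trans mb.
  have [l1 l2 l3] := cutL t ta (ltW tb); have [u1 u2 u3] := cutU t (ltW ta) tb.
  have Ut : I (U t) = 0.
    have tt : a <= t <= b by rewrite !ltW.
    by have := LU _ tt; rewrite Lt; clear; lra.
  exists ([:: U t], [:: L t]); split.
  + have ttab : a <= t <= b by rewrite !ltW.
    move=> x; rewrite -(tLU _ ttab).
    by rewrite /multiplicity !big_cons big_nil addnCA.
  + by move=> d; rewrite inE => /eqP ->.
  + move=> d; rewrite inE => /eqP ->; split => //; first by rewrite Lt ltW.
    by rewrite l3 sc; move: tm; rewrite /m; clear; lra.
- have [|t] := @IVT R (fun t => I (L t)) m b 0 (ltW mb) (sub _ _ (ltW am) (lexx b)).
    by rewrite Lb ge_min le_max (ltW Ic) (ltW L0) orbT.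
  rewrite in_itv/= => /andP[mt tb] Lt.
  have {}tb : t < b.
    by rewrite lt_neqAle tb andbT; apply/eqP => E; move: Lt Ic; rewrite E Lb => ->; rewrite ltxx.
  have ta : a < t by exact: lt_le_trans mt.
  have [l1 l2 l3] := cutL t ta (ltW tb); have [u1 u2 u3] := cutU t (ltW ta) tb.
  have Ut : I (U t) <= 0.
    have tt : a <= t <= b by rewrite !ltW.
    by have := LU _ tt; rewrite Lt; move: Ic; clear; lra.
  exists ([:: L t], [:: U t]); split.
  + by apply: tLU; rewrite !ltW.
  + by move=> d; rewrite inE => /eqP ->.
  + move=> d; rewrite inE => /eqP ->; split => //.
    by rewrite u3 sc; move: mt; rewrite /m; clear; lra.
- have mm : a <= m <= b by rewrite !ltW.
  have := LU _ mm => E; exfalso; move: L0 U0 Ic; rewrite E; clear; lra.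
Qed.

Lemma tiling_refine_choice (s r : seq cell_t) A (S1 S2 : cell_t -> cell_t -> Prop) :
  tiling (s ++ r) A ->
  (forall c, c \in r -> exists H : seq cell_t * seq cell_t,
    [/\ tiling (H.1 ++ H.2) (cell c), forall d, d \in H.1 -> S1 c d & forall d, d \in H.2 -> S2 c d]) ->
  exists K : seq cell_t * seq cell_t,
    [/\ tiling ((s ++ K.1) ++ K.2) A, forall d, d \in K.1 -> exists2 c, c \in r & S1 c d &
     forall d, d \in K.2 -> exists2 c, c \in r & S2 c d].
Proof.
move=> srA Hr.
have /choice[H PH] : forall c, exists H : seq cell_t * seq cell_t, c \in r ->
    [/\ tiling (H.1 ++ H.2) (cell c), forall d, d \in H.1 -> S1 c d & forall d, d \in H.2 -> S2 c d].
  move=> c; have [cr|cr] := boolP (c \in r); last by exists ([::], [::]).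
  by have [H PH] := Hr c cr; exists H.
exists (flatten (map (fun c => (H c).1) r), flatten (map (fun c => (H c).2) r)); split => /=.
- by apply: tiling_refine => // c /PH[].
- by move=> d /flatten_mapP[c cr dc]; exists c => //; have [_ + _] := PH c cr; apply.
- by move=> d /flatten_mapP[c cr dc]; exists c => //; have [_ _ +] := PH c cr; apply.
Qed.

(** With [f = sg * (W - A)], the condition [I d = 0] says that [W] has mean exactly [A] on [d]; this
    is where the reverse Hoelder hypothesis is applied without loss. *)
Definition selected c d := [/\ proper_cell d, subcell d c & I d = 0].
Definition remaining c d := [/\ proper_cell d, subcell d c, I d <= 0 &
  forall j, side d j <= side c j / 2].

(** One application of [halve] per coordinate direction, with [k] counting the directions treated;
    later cuts can only shrink the sides already halved. Repeated passes thus shrink every side of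
    the remaining cells to 0. *)
Lemma halve_all c : proper_cell c -> I c <= 0 ->
  exists H : seq cell_t * seq cell_t,
  [/\ tiling (H.1 ++ H.2) (cell c), forall d, d \in H.1 -> selected c d &
      forall d, d \in H.2 -> remaining c d].
Proof.
move=> nc Ic.
suff /(_ n.+1)[H [H1 H2 H3]] : forall k, exists H : seq cell_t * seq cell_t,
    [/\ tiling (H.1 ++ H.2) (cell c), forall d, d \in H.1 -> selected c d &
      forall d, d \in H.2 -> [/\ proper_cell d, subcell d c, I d <= 0 &
         forall j, (j < k)%N -> side d j <= side c j / 2]].
  by exists H; split => // d /H3[? ? ? s]; split => // j; apply: s.
elim=> [|k [H [H1 H2 H3]]].
  exists ([::], [:: c]); split => //.
    by move=> x; rewrite /multiplicity big_cons big_nil addn0.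
  by move=> d; rewrite inE => /eqP ->; split => //; exact: subcell_refl.
have [kn|kn] := ltnP k n.+1; last first.
  by exists H; split => // d /H3[? ? ? s]; split => // j _; apply: s; exact: leq_trans (ltn_ord j) kn.
pose i := Ordinal kn.
have [d dH|K [K1 K2 K3]] := @tiling_refine_choice H.1 H.2 (cell c) selected
   (fun d e => [/\ proper_cell e, subcell e d, I e <= 0 & side e i <= side d i / 2]) H1.
  by have [nd _ Id _] := H3 d dH; exact: halve.
exists (H.1 ++ K.1, K.2); split => //= d.
  rewrite mem_cat => /orP[/H2//|/K2[e eH [? ? ?]]].
  by split => //; have [_ ec _ _] := H3 e eH; exact: subcell_trans ec.
move=> /K3[e eH [nd de Id sd]]; have [ne ec Ie se] := H3 e eH.
split => //; first exact: subcell_trans ec.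
move=> j; rewrite ltnS leq_eqVlt => /predU1P[jk|jk]; last first.
  by apply: le_trans (se j jk); exact: side_subcell.
have -> : j = i by exact: val_inj.
by apply: le_trans sd _; rewrite ler_pM2r// side_subcell.
Qed.

Definition stage c (N : nat) (S : seq cell_t * seq cell_t) :=
  [/\ tiling (S.1 ++ S.2) (cell c), forall d, d \in S.1 -> selected c d &
    forall d, d \in S.2 -> [/\ proper_cell d, subcell d c, I d <= 0 &
      forall j, side d j <= side c j / 2 ^+ N]].

Lemma stages c : proper_cell c -> I c <= 0 ->
  exists S : nat -> seq cell_t * seq cell_t,
    (forall N, stage c N (S N)) /\ (forall N x, cells (S N).1 x -> cells (S N.+1).1 x).
Proof.
move=> nc Ic.
have /choice[next Pnext] : forall NS : nat * (seq cell_t * seq cell_t), exists S',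
    stage c NS.1 NS.2 -> stage c NS.1.+1 S' /\ forall x, cells NS.2.1 x -> cells S'.1 x.
  move=> [N S]; have [[S1 S2 S3]|] := pselect (stage c N S); last by exists S.
  have [d dS|K [K1 K2 K3]] := @tiling_refine_choice S.1 S.2 (cell c) selected remaining S1.
    by have [nd _ Id _] := S3 d dS; exact: halve_all.
  exists (S.1 ++ K.1, K.2) => _; split; last first.
    move=> x; rewrite /cells/= /multiplicity big_cat/= => h.
    by rewrite (leq_trans h)// leq_addr.
  split => //= d.
    rewrite mem_cat => /orP[/S2//|/K2[e eH [? ? ?]]].
    by split => //; have [_ ec _ _] := S3 e eH; exact: subcell_trans ec.
  move=> /K3[e eH [nd de Id sd]]; have [ne ec Ie se] := S3 e eH.
  split => //; first exact: subcell_trans ec.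
  move=> j; apply: le_trans (sd j) _; rewrite exprS invfM mulrA mulrAC.
  by rewrite ler_pM2r.
pose S := fix S N := if N is M.+1 then next (M, S M) else ([::], [:: c]).
have SN N : stage c N (S N).
  elim: N => [|N IH]; last by have [] := Pnext (N, S N) IH.
  split => //= [x|d]; first by rewrite /multiplicity big_cons big_nil addn0.
  rewrite inE => /eqP ->; split => // j.
  by rewrite expr0 divr1.
exists S; split => // N x; have [_] := Pnext (N, S N) (SN N); exact.
Qed.

Lemma stage_multiplicity c N S x : stage c N S ->
  (multiplicity S.1 x <= 1)%N /\ (multiplicity S.2 x <= 1)%N.
Proof.
case=> /(_ x) + _ _; rewrite /multiplicity big_cat/= => E.
have : (\sum_(c0 <- S.1) (x \in cell c0) + \sum_(c0 <- S.2) (x \in cell c0) <= 1)%N.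
  by rewrite E leq_b1.
by move=> h; split; apply: leq_trans h; rewrite ?leq_addl ?leq_addr.
Qed.

Lemma small_cells c a b (x : 'rV[R]_n.+1) : proper_cell c -> box a b x ->
  \forall N \near \oo, forall d, cell d x ->
    (forall j, side d j <= side c j / 2 ^+ N) -> cell d `<=` box a b.
Proof.
move=> nc abx.
have small j : \forall N \near \oo,
    side c j / 2 ^+ N < Num.min (x 0 j - a 0 j) (b 0 j - x 0 j).
  have h0 : 0 < Num.min (x 0 j - a 0 j) (b 0 j - x 0 j).
    by have /andP[? ?] := abx j; rewrite lt_min !subr_gt0; apply/andP.
  have h1 : `|2^-1 : R| < 1 by rewrite ger0_norm// invf_lt1// ltr1n.
  have := cvg_geometric (side c j) h1; move=> /cvgrPdist_lt/(_ _ h0).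
  apply: filterS => N; rewrite sub0r normrN /geometric/= exprVn ger0_norm//.
  by rewrite mulr_ge0// /side subr_ge0 ltW.
have : \forall N \near \oo, forall j, side c j / 2 ^+ N < Num.min (x 0 j - a 0 j) (b 0 j - x 0 j).
  exact: filter_forall.
apply: filterS => N H d xd sd y yd j.
have := H j; have := sd j; move: (xd j) (yd j); rewrite lt_min /side.
by move=> /andP[? ?] /andP[? ?] ? /andP[? ?]; apply/andP; split; lra.
Qed.

(** [E] is the union of all selected cells. A point off [E] stays in remaining cells that shrink to
    it and on which [f] has nonpositive integral; but their eccentricity is unbounded, and averages
    over such rectangles need not converge for general integrable functions. That [f <= 0] almost
    everywhere off [E] follows instead from outer regularity, because the remaining cells of one
    stage are disjoint. *)
Lemma rising_sun c : proper_cell c -> I c <= 0 -> exists E : set (Rn R n),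
  [/\ measurable E, E `<=` cell c,
     forall r, 0 < r -> mu ((cell c `\` E) `&` [set x | r < f x]) = 0 &
     forall h, mu.-integrable setT (EFin \o h) ->
       (forall d, proper_cell d -> subcell d c -> I d = 0 ->
          \int[mu]_(x in cell d) h x <= 0) ->
       \int[mu]_(x in E) h x <= 0].
Proof.
move=> nc Ic; have [S [stS incS]] := stages nc Ic.
pose E := \bigcup_N cells (S N).1.
have mS N : measurable (cells (S N).1) by exact: measurable_cells.
have mE : measurable E by exact: bigcupT_measurable.
have cc : (mu (cell c) < +oo)%E by rewrite [X in (X < _)%E]lebesgue_cbox ltry.
have Ec : E `<=` cell c.
  move=> x [N _]; have [tS _ _] := stS N; rewrite /cells/= => h.
  have := tS x; rewrite /multiplicity big_cat/=.
  by move: h; rewrite /multiplicity; case: (boolP (x \in cell c)) => [/set_mem//|_]; lia.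
have incS' M N : (M <= N)%N -> cells (S M).1 `<=` cells (S N).1.
  move=> /subnKC <-; elim: (N - M)%N => [|k IH]; first by rewrite addn0.
  by rewrite addnS; apply: subset_trans IH _ => x; exact: incS.
exists E; split => //; last first.
  move=> h hi hd; apply/ler_addgt0Pr => e e0; rewrite add0r.
  (* What the selected cells of stage [N] miss of [E] decreases to the empty set, so for some [N]
     the integral of [|h|] over it is below [e]. *)
  have [||||N] := @Rintegral_vanish _ _ _ mu h hi (fun N => E `\` cells (S N).1) e e0.
  - by move=> N; exact: measurableD.
  - apply: le_lt_trans cc; apply: le_measure; rewrite ?inE//.
    + exact: measurableD.
    + exact: measurable_cell.
    + by move=> x [/Ec].
  - by move=> M N MN x [Ex Mx]; split => //; apply: contra_not Mx; exact: incS'.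
  - by apply/seteqP; split => // x H; have [[N _ xN] _] := H 0%N Logic.I; have [_] := H N Logic.I.
  move=> EN; rewrite (RintegralID hi mE (mS N)).
  have [tS selS remS] := stS N.
  have -> : E `&` cells (S N).1 = cells (S N).1 by rewrite setIidr// => x xN; exists N.
  rewrite -[leRHS]add0r; apply: lerD.
    rewrite Rintegral_cells//; last by move=> x; have [] := stage_multiplicity x (stS N).
    rewrite big_seq; apply: sumr_le0 => d dS; have [nd dc Id] := selS d dS.
    exact: hd.
  apply: le_trans (ltW EN); apply: le_trans (ler_norm _) _.
  apply: le_normr_Rintegral; first exact: measurableD.
  by apply: integrableS hi => //; exact: measurableD.
move=> r r0; set G := (X in mu X).
have mf : measurable_fun setT f by apply/measurable_EFinP; exact: measurable_int fi.
have mG : measurable G.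
  apply: measurableI; first by apply: measurableD => //; exact: measurable_cell.
  rewrite (_ : [set x | _] = f @^-1` `]r, +oo[%classic).
    by rewrite -[X in measurable X]setTI; exact: mf.
  by apply/seteqP; split => x /=; rewrite in_itv/= andbT.
have Gfin : mu G \is a fin_num.
  rewrite ge0_fin_numE//; apply: le_lt_trans cc; apply: le_measure; rewrite ?inE//.
    exact: measurable_cell.
  by move=> x [[]].
apply/eqP; rewrite eq_le measure_ge0 andbT; apply/lee_addgt0Pr => e0 e00; rewrite add0e.
(* Chosen so that the final bound [e + e / r] equals [e0]. *)
pose e := e0 / (1 + r^-1); have ri : 0 < r^-1 by rewrite invr_gt0.
have e_gt0 : 0 < e by rewrite divr_gt0//; lra.
have [dl dl0 small] := Rintegral_small fi e_gt0.
(* An almost optimal cover exists by the definition of the outer measure. Its union [U] contains [G]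
   in its interior and exceeds it by measure less than [dl]. *)
have [cov Gcov covlt] : exists2 cov : nat -> cell_t, G `<=` \bigcup_k box (cov k).1 (cov k).2 &
    (\sum_(k <oo) (box_volume (cov k).1 (cov k).2)%:E < mu G + dl%:E)%E.
  have [_ [cov covG <-] H] := @lb_ereal_inf_adherent R _ dl dl0 Gfin.
  by exists cov.
pose U : set (Rn R n) := \bigcup_k box (cov k).1 (cov k).2.
have mU : measurable U by apply: bigcupT_measurable => k; exact: measurable_box.
have UG : (mu (U `\` G) < dl%:E)%E.
  have : (mu U < mu G + dl%:E)%E.
    apply: le_lt_trans covlt; apply: le_trans.
      apply: (@measure_sigma_subadditive _ _ _ mu _ (fun k => box (cov k).1 (cov k).2)) => //.
      by move=> k; exact: measurable_box.
    by apply: lee_nneseries => // k _; rewrite [X in (X <= _)%E]lebesgue_box.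
  rewrite (measureDI _ mU mG) setIidr// addeC.
  by rewrite lteD2lE.
(* The remaining cells of stage [N] inside [U]: they are disjoint and [f] has nonpositive integral
   on each. The values [f > r] on [G] must then be compensated on [C N] minus [G], which lies in [U]
   minus [G] and is too small for that unless little of [G] meets [C N]. *)
pose C N := cells [seq d <- (S N).2 | `[< cell d `<=` U >]].
have mC N : measurable (C N) by exact: measurable_cells.
have CU N : C N `<=` U.
  by move=> x /cellsP[d]; rewrite mem_filter => /andP[/asboolP dU _] /dU.
(* [G] minus [C N] need not decrease with [N]. The set [B M] of points missed by some stage from [M]
   on does decrease, to the empty set, since the cells around a point of [G] end up inside [U]. *)
pose B M := G `\` \bigcap_(N in [set N | (M <= N)%N]) C N.
have mB M : measurable (B M).
  apply: measurableD => //; apply: bigcap_measurableType => N _; exact: mC.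
have [M GM] : exists M, (mu (G `\` C M) < e%:E)%E.
  have mu1 : mu.-integrable setT (EFin \o \1_G).
    apply/integrableP; split; first by apply/measurable_EFinP; exact: measurable_indic.
    under eq_integral do rewrite gee0_abs ?lee_fin//.
    by rewrite integral_indic// setIT -ge0_fin_numE.
  have [||||M BM] := @Rintegral_vanish _ _ _ mu _ mu1 B e e_gt0 => //.
  - apply: le_lt_trans cc; apply: le_measure; rewrite ?inE//; first exact: measurable_cell.
    by move=> x [[[]]].
  - by move=> N N' NN x [Gx xC]; split => //; apply: contra_not xC => xC k /(leq_trans NN); exact: xC.
  - apply/seteqP; split => // x xB; have [Gx _] := xB 0%N Logic.I.
    have [k _ xk] := Gcov x Gx.
    have [[xc xE] _] := Gx.
    have [M _ HM] := small_cells nc xk.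
    have [_] := xB M Logic.I; apply => N MN.
    have [tS _ remS] := stS N.
    have : cells (S N).2 x.
      have : ~ cells (S N).1 x by move=> xS; apply: xE; exists N.
      have := tS x; rewrite (mem_set xc) /cells/= /multiplicity big_cat/=.
      by case: (\sum_(_ <- (S N).1) _)%N => // /[swap] _; rewrite add0n => ->.
    move=> /cellsP[d dS xd]; apply/cellsP; exists d => //.
    rewrite mem_filter dS andbT; apply/asboolP.
    have [_ _ _ sd] := remS d dS.
    by apply: subset_trans (HM N MN d xd sd) _ => y yk; exists k.
  exists M; apply: le_lt_trans (_ : mu (B M) < _)%E.
    apply: le_measure; rewrite ?inE//; first exact: measurableD.
    by move=> x [Gx xC]; split => // /(_ M (leqnn M)).
  have BMfin : mu (B M) \is a fin_num.
    rewrite ge0_fin_numE//; apply: (@le_lt_trans _ _ (mu G)); last by rewrite -ge0_fin_numE.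
    by apply: le_measure; rewrite ?inE// => x [].
  rewrite -(fineK BMfin) lte_fin; apply: le_lt_trans BM.
  rewrite /Rintegral; under eq_integral do rewrite ger0_norm//.
  by rewrite integral_indic// (_ : G `&` B M = B M)// setIidr// => x [].
have CM0 : \int[mu]_(x in C M) f x <= 0.
  have [tS _ remS] := stS M.
  rewrite Rintegral_cells//.
    rewrite big_seq; apply: sumr_le0 => d; rewrite mem_filter => /andP[_ dS].
    by have [_ _] := remS d dS.
  move=> x; have [_] := stage_multiplicity x (stS M); apply: leq_trans.
  rewrite /multiplicity big_filter big_mkcond/=; apply: leq_sum => d _.
  by case: ifP.
have CG : r * fine (mu (C M `&` G)) <= e.
  have ICG : r * fine (mu (C M `&` G)) <= \int[mu]_(x in C M `&` G) f x.
    have mCG : measurable (C M `&` G) by exact: measurableI.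
    rewrite -Rintegral_cst//; apply: le_Rintegral => //.
    - apply/integrableP; split; first exact/measurable_EFinP.
      under eq_integral do rewrite gee0_abs ?lee_fin ?ltW//=.
      rewrite integral_cst// lte_mul_pinfty// ?lee_fin ?ltW//.
      apply: (@le_lt_trans _ _ (mu G)); last by rewrite -ge0_fin_numE.
      by apply: le_measure; rewrite ?inE// => x [].
    - by apply: integrableS fi.
    - by move=> x [_ [_ /ltW]].
  have ICD : - (\int[mu]_(x in C M `\` G) f x) <= e.
    have mCD : measurable (C M `\` G) by exact: measurableD.
    have sm : \int[mu]_(x in C M `\` G) `|f x| < e.
      apply: small => //; apply: le_lt_trans UG; apply: le_measure; rewrite ?inE//; first exact: measurableD.
      by move=> x [/CU].
    apply: le_trans (ltW sm).
    have := @le_normr_Rintegral _ _ _ mu _ f mCD.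
    rewrite ler_norml lerNl => /(_ (integrableS measurableT mCD (@subsetT _ _) fi)).
    by case/andP.
  move: CM0; rewrite (RintegralID fi (mC M) mG).
  by move=> CM0'; apply: le_trans ICG _; apply: le_trans ICD; rewrite -subr_le0 opprK.
have fC : mu (C M `&` G) \is a fin_num.
  rewrite ge0_fin_numE//; apply: (@le_lt_trans _ _ (mu G)); last by rewrite -ge0_fin_numE.
  by apply: le_measure; rewrite ?inE//; try exact: measurableI; move=> x [].
rewrite (measureDI _ mG (mC M)).
apply: (@le_trans _ _ (e%:E + (e / r)%:E)%E).
  apply: leeD; first exact: ltW.
  rewrite [leLHS](_ : _ = (fine (mu (C M `&` G)))%:E); last by rewrite fineK// setIC.
  by rewrite lee_fin ler_pdivlMr// mulrC.
rewrite -EFinD lee_fin /e le_eqVlt; apply/orP; left; apply/eqP.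
by field; rewrite ?gt_eqF//; lra.
Qed.

End rising_sun.
End cells.

(** * Integrals over superlevel sets of given measure *)

Section quantile.
Context d (T : measurableType d) (R : realType) (mu : {measure set T -> \bar R}).
Variables (D : set T) (v : T -> R).
Hypotheses (mD : measurable D) (Dfin : (mu D < +oo)%E) (mv : measurable_fun setT v).

Definition superlevel (y : R) : set T := D `&` [set x | y < v x].
Definition tail (y : R) : R := fine (mu (superlevel y)).
Definition quantile (t : R) : R := inf [set y | tail y <= t].
Local Notation M := (fine (mu D)).

Lemma measurable_superlevel y : measurable (superlevel y).
Proof.
apply: measurableI => //; rewrite (_ : [set x | _] = v @^-1` `]y, +oo[%classic).
  by rewrite -[X in measurable X]setTI; exact: mv.
by apply/seteqP; split => x /=; rewrite in_itv/= andbT.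
Qed.

Lemma fin_subset (A : set T) : measurable A -> A `<=` D -> mu A \is a fin_num.
Proof.
move=> mA AD; rewrite ge0_fin_numE//; apply: le_lt_trans Dfin.
by apply: le_measure; rewrite ?inE.
Qed.

Lemma superlevel_fin y : mu (superlevel y) \is a fin_num.
Proof. by apply: fin_subset; [exact: measurable_superlevel|move=> x []]. Qed.

Lemma tail_le (y z : R) : y <= z -> tail z <= tail y.
Proof.
move=> yz; apply: fine_le; rewrite ?superlevel_fin//.
apply: le_measure; rewrite ?inE; try exact: measurable_superlevel.
by move=> x [Dx /= zx]; split => //=; exact: le_lt_trans zx.
Qed.

Lemma tail_ge0 y : 0 <= tail y. Proof. exact: fine_ge0. Qed.

Lemma tail_cvgy : tail n%:R @[n --> \oo] --> (0 : R).
Proof.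
have : mu \o (fun n => superlevel n%:R) @ \oo --> mu (\bigcap_n superlevel n%:R).
  apply: nonincreasing_cvg_mu.
  - by rewrite /= ltey_eq superlevel_fin.
  - by move=> n; exact: measurable_superlevel.
  - by apply: bigcapT_measurable => n; exact: measurable_superlevel.
  - move=> m n mn; apply/subsetPset => x [Dx /= nx]; split => //=.
    by apply: le_lt_trans nx; rewrite ler_nat.
have -> : \bigcap_n superlevel n%:R = set0.
  apply/seteqP; split => // x H.
  have [_ /=] := H (Num.bound `|v x|) Logic.I; apply/negP; rewrite -leNgt.
  by apply: le_trans (ler_norm _) _; exact/ltW/archi_boundP.
rewrite measure0; move=> /fine_cvgP[_]; exact.
Qed.

Lemma tail_cvgNy : tail (- n%:R) @[n --> \oo] --> M.
Proof.
have : mu \o (fun n => superlevel (- n%:R)) @ \oo --> mu (\bigcup_n superlevel (- n%:R)).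
  apply: nondecreasing_cvg_mu.
  - by move=> n; exact: measurable_superlevel.
  - by apply: bigcupT_measurable => n; exact: measurable_superlevel.
  - move=> m n mn; apply/subsetPset => x [Dx /= nx]; split => //=.
    by apply: le_lt_trans nx; rewrite lerN2 ler_nat.
have -> : \bigcup_n superlevel (- n%:R) = D.
  apply/seteqP; split => [x [n _ []]//|x Dx].
  exists (Num.bound `|v x|) => //; split => //=; rewrite ltrNl.
  by apply: le_lt_trans (ler_norm _) _; rewrite normrN; exact: archi_boundP.
rewrite -[X in _ --> X -> _]fineK; last exact: fin_subset.
by move=> /fine_cvgP[_]; exact.
Qed.

Section fixed_t.
Variable t : R.
Hypotheses (t_gt0 : 0 < t) (t_ltM : t < M).

Lemma tail_le_has_inf : has_inf [set y | tail y <= t].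
Proof.
split.
  have /cvgrPdist_lt/(_ _ t_gt0)[n _ /(_ n (leqnn n))] := tail_cvgy.
  rewrite /= sub0r normrN ger0_norm ?tail_ge0// => /ltW nt.
  by exists n%:R.
have Mt : 0 < M - t by rewrite subr_gt0.
have /cvgrPdist_lt/(_ _ Mt)[n _ /(_ n (leqnn n))] := tail_cvgNy.
move=> /=; rewrite ltr_norml => /andP[_ h].
have {}h : t < tail (- n%:R) by move: h; lra.
exists (- n%:R) => y /= yt; rewrite leNgt; apply/negP => /ltW/tail_le yn.
by have := lt_le_trans h yn; rewrite ltNge yt.
Qed.

Lemma lt_quantile y : y < quantile t -> t < tail y.
Proof.
apply: contraTT; rewrite -!leNgt => yt; apply: ge_inf => //.
by case: tail_le_has_inf.
Qed.

Lemma quantile_le y : tail y <= t -> quantile t <= y.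
Proof. by move=> yt; rewrite leNgt; apply/negP => /lt_quantile; rewrite ltNge yt. Qed.

Lemma tail_quantile : tail (quantile t) <= t.
Proof.
have : mu \o (fun n => superlevel (quantile t + n.+1%:R^-1)) @ \oo -->
       mu (\bigcup_n superlevel (quantile t + n.+1%:R^-1)).
  apply: nondecreasing_cvg_mu.
  - by move=> n; exact: measurable_superlevel.
  - by apply: bigcupT_measurable => n; exact: measurable_superlevel.
  - move=> m n mn; apply/subsetPset => x [Dx /= nx]; split => //=.
    by apply: le_lt_trans nx; rewrite lerD2l lef_pV2 ?posrE// ler_nat.
have -> : \bigcup_n superlevel (quantile t + n.+1%:R^-1) = superlevel (quantile t).
  apply/seteqP; split => [x [n _ [Dx /= nx]]|x [Dx /= qx]].
    by split => //=; apply: lt_trans nx; rewrite ltrDl.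
  by have [n nx] := ltr_add_invr qx; exists n => //; split.
move=> h; have {}h : tail (quantile t + n.+1%:R^-1) @[n --> \oo] --> tail (quantile t).
  by move: h; rewrite -[X in _ --> X -> _]fineK ?superlevel_fin// => /fine_cvgP[_]; exact.
apply: (cvgr_to_le h); apply: nearW => n.
have ql : quantile t < quantile t + n.+1%:R^-1 by rewrite ltrDl.
have [z /= zt zq] := inf_lt tail_le_has_inf.1 ql.
by apply: le_trans zt; apply: tail_le; exact: ltW.
Qed.

Lemma tail_le_quantile (y : R) : quantile t < y -> tail y <= t.
Proof.
move=> qy; have [z /= zt zy] := inf_lt tail_le_has_inf.1 qy.
by apply: le_trans zt; apply: tail_le; exact: ltW.
Qed.

(** Together with [tail_quantile] this places [t] between the measures of [v > quantile t] and
    [v >= quantile t]; they differ when [v] has an atom at this value. *)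
Lemma quantile_superlevel : t <= fine (mu (D `&` [set x | quantile t <= v x])).
Proof.
have : mu \o (fun n => superlevel (quantile t - n.+1%:R^-1)) @ \oo -->
       mu (\bigcap_n superlevel (quantile t - n.+1%:R^-1)).
  apply: nonincreasing_cvg_mu.
  - by rewrite /= ltey_eq superlevel_fin.
  - by move=> n; exact: measurable_superlevel.
  - by apply: bigcapT_measurable => n; exact: measurable_superlevel.
  - move=> m n mn; apply/subsetPset => x [Dx /= nx]; split => //=.
    by apply: le_lt_trans nx; rewrite lerD2l lerN2 lef_pV2 ?posrE// ler_nat.
have -> : \bigcap_n superlevel (quantile t - n.+1%:R^-1) = D `&` [set x | quantile t <= v x].
  apply/seteqP; split => [x H|x [Dx /= qx] n _]; last first.
    by split => //=; apply: lt_le_trans qx; rewrite ltrBlDr ltrDl.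
  have [Dx _] := H 0%N Logic.I; split => //=; rewrite leNgt; apply/negP => vq.
  have [n nx] := ltr_add_invr vq; have [_ /=] := H n Logic.I.
  by rewrite ltrBlDr; apply/negP; rewrite -leNgt ltW.
move=> h; have {}h : tail (quantile t - n.+1%:R^-1) @[n --> \oo] -->
    fine (mu (D `&` [set x | quantile t <= v x])).
  move: h; rewrite -[X in _ --> X -> _]fineK.
    by move=> /fine_cvgP[_]; exact.
  apply: fin_subset; last by move=> x [].
  apply: measurableI => //; rewrite (_ : [set x | _] = v @^-1` `[quantile t, +oo[%classic).
    by rewrite -[X in measurable X]setTI; exact: mv.
  by apply/seteqP; split => x /=; rewrite in_itv/= andbT.
apply: (cvgr_to_ge h); apply: nearW => n; apply/ltW/lt_quantile.
by rewrite ltrBlDr ltrDl.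
Qed.

End fixed_t.

Lemma quantile_anti (s t : R) : 0 < s -> s <= t -> t < M -> quantile t <= quantile s.
Proof.
move=> s0 st tM; apply: quantile_le => //; first exact: lt_le_trans s0 st.
by apply: (le_trans _ st); apply: tail_quantile => //; exact: (le_lt_trans st tM).
Qed.

(** As [quantile] is nonincreasing, this is right continuity. From the left it jumps where [v] omits
    a range of values, hence only right derivatives are available below. *)
Lemma quantile_right_cts (t y : R) : 0 < t -> t < M -> y < quantile t ->
  exists2 e, 0 < e & forall s, t <= s -> s < t + e -> s < M -> y <= quantile s.
Proof.
move=> t0 tM yt; have yN := lt_quantile t0 tM yt.
exists (tail y - t); first by rewrite subr_gt0.
move=> s ts se sM; rewrite leNgt; apply/negP => qy.
have s0 : 0 < s by exact: lt_le_trans ts.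
have := tail_le_quantile s0 sM qy.
by move: se; rewrite addrC subrK => /lt_le_trans h /h; rewrite ltxx.
Qed.

Section top_integral.
Variable g : R -> R.
Hypotheses (g_homo : {homo g : x y / x <= y}) (gi : mu.-integrable D (EFin \o (g \o v))).

Definition excess (c : R) : R := \int[mu]_(x in D) Num.max (g (v x) - c) 0.
(** The integral of [g o v] over a part of measure exactly [t] where [v] is largest. At an atom only
    a portion of the level set belongs to the part; the term [t * g (quantile t)] accounts for it
    without choosing that portion. *)
Definition top_integral (t : R) : R := t * g (quantile t) + excess (g (quantile t)).

Lemma integrable_cst_fin (c : R) : mu.-integrable D (EFin \o cst c).
Proof.
apply/integrableP; split; first exact/measurable_EFinP.
by rewrite (eq_integral (cst `|c|%:E))// integral_cst//= lte_mul_pinfty// lee_fin.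
Qed.

Lemma integrable_excess (c : R) : mu.-integrable D (EFin \o (fun x => Num.max (g (v x) - c) 0)).
Proof.
have h : mu.-integrable D (EFin \o (fun x => g (v x) - c)).
  have := integrableB mD gi (integrable_cst_fin c).
  by apply: eq_integrable => // x _ /=; rewrite EFinB.
have mh : measurable_fun D (fun x => g (v x) - c).
  by case/integrableP : h => /measurable_EFinP.
apply: le_integrable h => //.
  by apply/measurable_EFinP/measurable_maxr.
move=> x _ /=; rewrite lee_fin ger0_norm ?le_max ?lexx ?orbT// ge_max ler_norm.
by rewrite normr_ge0.
Qed.

Lemma integrable_indic_fin (A : set T) (c : R) : measurable A ->
  mu.-integrable D (EFin \o (fun x => c * \1_A x)).
Proof.
move=> mA; apply: le_integrable (integrable_cst_fin c) => //.
  by apply/measurable_EFinP/measurable_funM => //; exact: measurable_indic.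
move=> x _ /=; rewrite lee_fin normrM ler_piMr// indicE.
by case: (_ \in _); rewrite ?normr1 ?normr0.
Qed.

Lemma excess_ge0 c : 0 <= excess c.
Proof. by apply: Rintegral_ge0 => x _; rewrite le_max lexx orbT. Qed.

Lemma Rintegral_indic_fin (A : set T) (c : R) : measurable A -> A `<=` D ->
  \int[mu]_(x in D) (c * \1_A x) = c * fine (mu A).
Proof.
move=> mA AD; rewrite RintegralZl//.
  by rewrite /Rintegral integral_indic// setIidl.
have := integrable_indic_fin 1 mA; apply: eq_integrable => // x _ /=.
by rewrite mul1r.
Qed.

(** The right-hand side is minimal at [y = quantile t], because [t] lies between the measures of
    [v > y] and [v >= y] there. This minimum property yields the increments of [top_integral]. *)
Lemma top_integral_le (t y : R) : 0 < t -> t < M -> top_integral t <= t * g y + excess (g y).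
Proof.
move=> t0 tM; rewrite /top_integral; set m := quantile t.
have [my|ym] := leP m y.
  have gmy := g_homo my.
  suff : excess (g m) - (g y - g m) * tail m <= excess (g y).
    have h1 : (g y - g m) * tail m <= (g y - g m) * t.
      by rewrite ler_wpM2l ?subr_ge0//; exact: tail_quantile.
    by move: h1; lra.
  have mS := measurable_superlevel m.
  rewrite -Rintegral_indic_fin//; last by move=> x [].
  rewrite -RintegralB//; [|exact: integrable_excess|exact: integrable_indic_fin].
  apply: le_Rintegral => //.
  - have := integrableB mD (integrable_excess (g m)) (integrable_indic_fin (g y - g m) mS).
    by apply: eq_integrable => // x _ /=; rewrite EFinB.
  - exact: integrable_excess.
  - move=> x Dx; rewrite indicE; case: (ltP m (v x)) => [mv'|vm].
      rewrite mem_set//= mulr1 /Num.max.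
      by do 2 case: ifP; move: gmy; lra.
    rewrite memNset ?mulr0 ?subr0; last by move=> [_ /=]; rewrite ltNge vm.
    have gvm := g_homo vm.
    by rewrite /Num.max; do 2 case: ifP; move: gvm; lra.
have gym := g_homo (ltW ym).
pose A := D `&` [set x | m <= v x].
have mA : measurable A.
  apply: measurableI => //; rewrite (_ : [set x | _] = v @^-1` `[m, +oo[%classic).
    by rewrite -[X in measurable X]setTI; exact: mv.
  by apply/seteqP; split => x /=; rewrite in_itv/= andbT.
suff : excess (g m) + (g m - g y) * fine (mu A) <= excess (g y).
  have h1 : (g m - g y) * t <= (g m - g y) * fine (mu A).
    by rewrite ler_wpM2l ?subr_ge0//; exact: quantile_superlevel.
  by move: h1; lra.
rewrite -Rintegral_indic_fin//; last by move=> x [].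
rewrite -RintegralD//; [|exact: integrable_excess|exact: integrable_indic_fin].
apply: le_Rintegral => //.
- have := integrableD mD (integrable_excess (g m)) (integrable_indic_fin (g m - g y) mA).
  by apply: eq_integrable => // x _ /=; rewrite EFinD.
- exact: integrable_excess.
- move=> x Dx; rewrite indicE; case: (leP m (v x)) => [mv'|vm].
    rewrite mem_set//= mulr1.
    have gmv := g_homo mv'.
    by rewrite /Num.max; do 2 case: ifP; move: gym gmv; lra.
  rewrite memNset ?mulr0 ?addr0; last by move=> [_ /=]; rewrite leNgt vm.
  have gvm := g_homo (ltW vm).
  by rewrite /Num.max; do 2 case: ifP; move: gvm gym; lra.
Qed.

(** Each of the two minimum properties is tested at the quantile of the other. *)
Lemma top_integral_incr (s t : R) : 0 < s -> s <= t -> t < M ->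
  (t - s) * g (quantile t) <= top_integral t - top_integral s <= (t - s) * g (quantile s).
Proof.
move=> s0 st tM; have sM := le_lt_trans st tM; have t0 := lt_le_trans s0 st.
have h1 := @top_integral_le t (quantile s) t0 tM.
have h2 := @top_integral_le s (quantile t) s0 sM.
move: h1 h2; rewrite /top_integral.
by move=> h1 h2; apply/andP; split; lra.
Qed.

Lemma top_integral_ge (t : R) : 0 < t -> t < M ->
  t * \int[mu]_(x in D) g (v x) <= M * top_integral t.
Proof.
move=> t0 tM; rewrite /top_integral; set c := g (quantile t).
have h : \int[mu]_(x in D) g (v x) <= M * c + excess c.
  rewrite mulrC -Rintegral_cst// -RintegralD//; [|exact: integrable_cst_fin|exact: integrable_excess].
  apply: le_Rintegral => //.
    have := integrableD mD (integrable_cst_fin c) (integrable_excess c).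
    by apply: eq_integrable => // x _ /=; rewrite EFinD.
  by move=> x _; rewrite -lerBlDl le_max lexx.
have : t * \int[mu]_(x in D) g (v x) <= t * (M * c + excess c) by rewrite ler_wpM2l// ltW.
have : t * excess c <= M * excess c by rewrite ler_wpM2r ?excess_ge0// ltW.
by move: (\int[mu]_(x in D) g (v x)) => u; lra.
Qed.

Lemma top_integral_right_diff (t : R) : {for quantile t, continuous g} -> 0 < t -> t < M ->
  forall e, 0 < e -> exists2 r, 0 < r & forall s, t <= s -> s < t + r ->
    `|top_integral s - top_integral t - (s - t) * g (quantile t)| <= e * (s - t).
Proof.
move=> cg t0 tM e e0.
have [y yq gy] : exists2 y, y < quantile t & g (quantile t) - e <= g y.
  have /cvgrPdist_lt/(_ _ e0)/nbhs_ballP[r /= r0 H] := cg.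
  exists (quantile t - r / 2); first by rewrite ltrBlDr ltrDl divr_gt0.
  have /H/= : ball (quantile t) r (quantile t - r / 2).
    by rewrite /ball/= opprB addrC subrK ger0_norm; [move: r0; lra|rewrite divr_ge0// ltW].
  by move=> /(le_lt_trans (ler_norm _)); lra.
have [r r0 H] := quantile_right_cts t0 tM yq.
exists (Num.min r (M - t)); first by rewrite lt_min r0 subr_gt0.
move=> s ts; rewrite -ltrBlDl lt_min => /andP[sr sM].
have {}sM : s < M by move: sM; lra.
have ys : y <= quantile s by apply: H => //; move: sr; lra.
have /andP[h1 h2] := top_integral_incr t0 ts sM.
have gys := g_homo ys.
have : (s - t) * (g (quantile t) - e) <= (s - t) * g (quantile s).
  by rewrite ler_wpM2l ?subr_ge0//; exact: le_trans gy gys.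
rewrite ler_norml; move: h1 h2 (subr_ge0 t s); rewrite ts.
move: (top_integral s) (top_integral t) => S X h1 h2 st h3.
have es : 0 <= e * (s - t) by rewrite mulr_ge0// ?subr_ge0// ltW.
apply/andP; split; [move: h1 h3|move: h2 es]; lra.
Qed.

Lemma top_integral_lipschitz (a b : R) : 0 < a -> b < M ->
  exists2 L, 0 < L & forall s t, a <= s -> s <= t -> t <= b ->
    `|top_integral t - top_integral s| <= L * (t - s).
Proof.
move=> a0 bM; exists (`|g (quantile a)| + `|g (quantile b)| + 1).
  by rewrite ltr_wpDl// addr_ge0.
move=> s t as_ st tb.
have s0 := lt_le_trans a0 as_; have tM := le_lt_trans tb bM.
have /andP[h1 h2] := top_integral_incr s0 st tM.
have h3 : g (quantile s) <= `|g (quantile a)|.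
  apply: le_trans (ler_norm _); apply: g_homo; apply: quantile_anti => //.
  exact: le_lt_trans tM.
have h4 : - `|g (quantile b)| <= g (quantile t).
  apply: le_trans (_ : g (quantile b) <= _); first by rewrite lerNl -normrN ler_norm.
  by apply: g_homo; apply: quantile_anti => //; exact: lt_le_trans st.
have st0 : 0 <= t - s by rewrite subr_ge0.
have h5 : (t - s) * g (quantile s) <= (t - s) * `|g (quantile a)| by rewrite ler_wpM2l.
have h6 : (t - s) * - `|g (quantile b)| <= (t - s) * g (quantile t) by rewrite ler_wpM2l.
have n1 : 0 <= (t - s) * `|g (quantile a)| by rewrite mulr_ge0.
have n2 : 0 <= (t - s) * `|g (quantile b)| by rewrite mulr_ge0.
rewrite ler_norml; move: (top_integral t) (top_integral s) h1 h2 => S X h1 h2.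
apply/andP; split; [move: h1 h6 n1 st0|move: h2 h5 n2 st0]; lra.
Qed.

End top_integral.
End quantile.

(** * The differential inequality *)

Section right_derivatives.
Context {R : realType}.
Implicit Types (f g X : R -> R) (t d : R).

Lemma is_derive_addf f g (x df dg : R) : is_derive x 1 f df -> is_derive x 1 g dg ->
  is_derive x 1 (fun y => f y + g y) (df + dg).
Proof. exact: is_deriveD. Qed.

Lemma is_derive_mulf f g (x df dg : R) : is_derive x 1 f df -> is_derive x 1 g dg ->
  is_derive x 1 (fun y => f y * g y) (f x * dg + g x * df).
Proof. exact: is_deriveM. Qed.

Lemma is_derive_powf f (x df a : R) : 0 < f x -> is_derive x 1 f df ->
  is_derive x 1 (fun y => f y `^ a) (a * f x `^ (a - 1) * df).
Proof.
move=> fx0 fd; have p := is_derive1_powR a fx0.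
exact: (@is_derive1_comp _ (fun y => y `^ a) f x _ _ p fd).
Qed.

Lemma cvg_powRf {T : Type} {F : set_system T} {FF : Filter F} (f : T -> R) (b x : R) :
  0 < b -> f @ F --> b -> f s `^ x @[s --> F] --> b `^ x.
Proof.
move=> b0 fb; have cb : {for b, continuous (fun y : R => y `^ x)}.
  apply: differentiable_continuous; apply/derivable1_diffP.
  exact: (@ex_derive _ _ _ _ _ _ _ (is_derive1_powR x b0)).
exact: (cvg_comp f (fun y => y `^ x) fb cb).
Qed.

(** For fixed [v], each side is the difference of the values at z = y and z = 1 of z^q / q - v z^(q
    - 1) / (q - 1), with q = p or q = r. The two functions differ by [H], with derivative (z^(r - 2)
    - z^(p - 2)) (z - v). In both cases this has the sign of z - 1 between 1 and [y], so [H] is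
    minimal at 1. *)
Lemma power_gap (p r a y : R) : 0 < y -> 1 < p -> r != 0 -> r != 1 ->
  [/\ p < r, a < 0 & (1 + a) * y <= 1] \/ [/\ r < p, 0 < a & 1 <= (1 + a) * y] ->
  (y `^ p - 1) / p - (1 + a) * y * ((y `^ (p - 1) - 1) / (p - 1)) <=
  (y `^ r - 1) / r - (1 + a) * y * ((y `^ (r - 1) - 1) / (r - 1)).
Proof.
move=> y0 p1 r0 r1 cases; set v := (1 + a) * y.
have p0 : p != 0 by rewrite gt_eqF//; lra.
have p10 : p - 1 != 0 by rewrite subr_eq0 gt_eqF.
have r10 : r - 1 != 0 by rewrite subr_eq0.
pose G (q z : R) := q^-1 * (z `^ q) - v * (q - 1)^-1 * (z `^ (q - 1)).
pose H z := G r z - G p z.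
pose dH z := (z `^ (r - 2) - z `^ (p - 2)) * (z - v).
have dG (q z : R) : q != 0 -> q - 1 != 0 -> 0 < z -> is_derive z 1 (G q) (z `^ (q - 2) * (z - v)).
  move=> q0 q1 z0; rewrite /G.
  have d1 := is_derive1_powR q z0; have d2 := is_derive1_powR (q - 1) z0.
  have d3 := is_derive_mulf (is_derive_cst q^-1 z 1) d1.
  have d4 := is_derive_mulf (is_derive_cst (- (v * (q - 1)^-1)) z 1) d2.
  have := is_derive_addf d3 d4.
  have -> : (fun y0 : R => cst q^-1 y0 * y0 `^ q + cst (- (v * (q - 1)^-1)) y0 * y0 `^ (q - 1)) =
            (fun z0 => q^-1 * z0 `^ q - v * (q - 1)^-1 * z0 `^ (q - 1)).
    by apply/funext => u /=; rewrite mulNr.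
  move=> h; apply: is_derive_eq h _ => /=.
  have -> : q - 1 = q - 2 + 1 by ring.
  have zE : z `^ (q - 2 + 1) = z `^ (q - 2) * z.
    by rewrite powRD ?powRr1 ?ltW//; apply/implyP => _; rewrite gt_eqF.
  rewrite zE (_ : q - 2 + 1 - 1 = q - 2); last ring.
  have q2 : q - 2 + 1 != 0 by rewrite (_ : q - 2 + 1 = q - 1)//; ring.
  by field; rewrite ?q0 ?q2.
have dHd (z : R) : 0 < z -> is_derive z 1 H (dH z).
  move=> z0; have := is_derive_addf (dG r z r0 r10 z0) (is_deriveN (dG p z p0 p10 z0)).
  by move=> h; apply: is_derive_eq h _; rewrite /dH; ring.
have mvt (s t : R) : 0 < s -> s <= t -> exists2 z, s <= z <= t & H t - H s = dH z * (t - s).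
  move=> s0 st; have [||z zst E] := @MVT_segment R H dH s t st.
  - by move=> z; rewrite in_itv/= => /andP[sz _]; apply: dHd; exact: lt_trans sz.
  - apply: derivable_within_continuous => z; rewrite in_itv/= => /andP[sz _].
    exact: (@ex_derive _ _ _ _ _ _ _ (dHd z (lt_le_trans s0 sz))).
  by exists z => //; move: zst; rewrite in_itv.
suff : H 1 <= H y.
  rewrite /H /G !powR1 !mulr1 => h; rewrite -subr_ge0.
  by apply: le_trans (_ : H y - H 1 <= _); rewrite ?subr_ge0// /H /G !powR1; lra.
have v_y : y - v = - a * y by rewrite /v; ring.
have [y1|y1] := leP 1 y.
  have [z /andP[z1 zy] E] := mvt 1 y ltr01 y1.
  rewrite -subr_ge0 E mulr_ge0 ?subr_ge0//.
  case: cases => [[pr a0 v1]|[rp a0 v1]].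
    rewrite /dH mulr_ge0 ?subr_ge0//; last exact: le_trans z1.
    by apply: ler_powR => //; lra.
  rewrite /dH mulr_le0// ?subr_le0.
    by apply: ler_powR => //; lra.
  apply: le_trans zy _; rewrite -subr_le0 v_y mulNr oppr_le0.
  by rewrite mulr_ge0// ltW.
have [z /andP[zy z1] E] := mvt y 1 y0 (ltW y1).
have z0 : 0 < z by exact: lt_le_trans zy.
rewrite -subr_le0 E.
case: cases => [[pr a0 v1]|[rp a0 v1]].
  apply: mulr_le0_ge0; last by rewrite subr_ge0 ltW.
  rewrite /dH; apply: mulr_le0_ge0; rewrite ?subr_ge0 ?subr_le0.
    by apply: ger_powR; [rewrite z0|lra].
  apply: le_trans zy; rewrite -subr_ge0 v_y mulr_ge0//; first by rewrite oppr_ge0 ltW.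
  exact: ltW.
apply: mulr_le0_ge0; last by rewrite subr_ge0 ltW.
rewrite /dH; apply: mulr_ge0_le0; rewrite ?subr_ge0 ?subr_le0.
  by apply: ger_powR; [rewrite z0|lra].
exact: le_trans v1.
Qed.

(* The ratio of the mean of [f `^ q] to the [q]-th power of the mean of [f] on
   any interval [(0, t)], for the extremal function [f x = x `^ a]. *)
Definition power_ratio (a q : R) : R := (1 + a) `^ q / (1 + a * q).

(** Both sides of [power_tangent_gap] vanish at [v = 1 + a], the ratio of f(t) to the mean of f on
    (0, t) for f(x) = x^a. An inequality on both sides of this point forces equal derivatives in [v]
    there, which determines the coefficient. *)
Definition gap_coef (p r a : R) : R :=
  r * (r - 1) * power_ratio a r / (p * (p - 1) * power_ratio a p).

Lemma power_ratio_gt0 (a q : R) : 0 < 1 + a -> 0 < 1 + a * q -> 0 < power_ratio a q.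
Proof. by move=> a0 aq; rewrite divr_gt0// powR_gt0. Qed.

(** After division by q (q - 1) K(q), for q = p and q = r, and the substitution [y = v / (1 + a)],
    the two sides are those of [power_gap]. The lemma is what makes the derivative in
    [growth_estimate] nonnegative. *)
Lemma power_tangent_gap (p r a v : R) : 1 < p -> 0 <= v -> 0 < 1 + a * p -> 0 < 1 + a * r ->
  0 < 1 + a ->
  [/\ p < r, a < 0 & v <= 1] \/ [/\ r < 0, 0 < a & 1 <= v] ->
  gap_coef p r a * (power_ratio a p * (1 - p + p * v) - v `^ p) <=
  power_ratio a r * (1 - r + r * v) - v `^ r.
Proof.
move=> p1 v0 ap ar a1 cases; rewrite /gap_coef; set K := power_ratio a; set c := (X in X * _).
have rr : 0 < r * (r - 1).
  case: cases => [[pr _ _]|[r0 _ _]]; nra.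
have r0 : r != 0 by case: cases => [[]|[]] *; [rewrite gt_eqF|rewrite lt_eqF]; lra.
have r1 : r != 1 by case: cases => [[]|[]] *; [rewrite gt_eqF|rewrite lt_eqF]; lra.
have Kp : 0 < K p by exact: power_ratio_gt0.
have Kr : 0 < K r by exact: power_ratio_gt0.
have pp : 0 < p * (p - 1) by nra.
suff : (1 - p + p * v - v `^ p / K p) / (p * (p - 1)) <= (1 - r + r * v - v `^ r / K r) / (r * (r - 1)).
  set X := (X in X <= _); set Y := (X in _ <= X) => XY.
  have -> : c * (K p * (1 - p + p * v) - v `^ p) = r * (r - 1) * K r * X.
    rewrite /c /X; field; rewrite ?gt_eqF//; lra.
  have -> : K r * (1 - r + r * v) - v `^ r = r * (r - 1) * K r * Y.
    rewrite /Y; field; rewrite ?r0 ?subr_eq0 ?r1 ?gt_eqF//.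
  by rewrite ler_pM2l// mulr_gt0.
(* [power_gap] requires [y > 0]; at [v = 0] the claim reduces to -1/p <= -1/r. *)
move: v0; rewrite le_eqVlt => /predU1P[v0|v0].
  move: cases; rewrite -v0 => -[[pr a0 _]|[_ _]]; last by rewrite ler10.
  rewrite !powR0//; last by rewrite gt_eqF//; lra.
  rewrite !mulr0 !mul0r !addr0 !subr0.
  have -> : (1 - p) / (p * (p - 1)) = - p^-1 by field; rewrite ?gt_eqF//; lra.
  have -> : (1 - r) / (r * (r - 1)) = - r^-1 by field; rewrite ?r0 ?subr_eq0 ?r1.
  by rewrite lerN2 lef_pV2 ?posrE; lra.
pose y := v / (1 + a); have y0 : 0 < y by rewrite divr_gt0.
have vE : (1 + a) * y = v by rewrite /y; field; rewrite gt_eqF.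
have E (q : R) : q != 0 -> q != 1 -> 0 < 1 + a * q -> (1 - q + q * v - v `^ q / K q) / (q * (q - 1)) =
    (y `^ q - 1) / q - (1 + a) * y * ((y `^ (q - 1) - 1) / (q - 1)).
  move=> q0 q1 aq; have -> : v `^ q / K q = (1 + a * q) * y `^ q.
    rewrite -vE powRM ?ltW// /K /power_ratio; field.
    by rewrite ?gt_eqF// powR_gt0.
  have yq : y `^ q = y * y `^ (q - 1).
    rewrite -[X in X * _]powRr1 ?ltW// -powRD; last by apply/implyP => _; rewrite gt_eqF.
    by congr powR; ring.
  by rewrite -vE yq; field; rewrite q0 subr_eq0 q1.
rewrite !E//; try (rewrite gt_eqF//; lra).
apply: power_gap => //; rewrite vE.
by case: cases => [[? ? ?]|[? ? ?]]; [left|right; split => //; lra].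
Qed.

Definition right_diff X (t d : R) := forall e : R, 0 < e ->
  exists2 r, 0 < r & forall s, t <= s -> s < t + r -> `|X s - X t - (s - t) * d| <= e * (s - t).

(** Replacing [X] to the left of [t] by its tangent turns a right derivative into a derivative at
    [t], so that the rules for products and powers apply. *)
Definition linear_ext X (t d s : R) : R := if s < t then X t + (s - t) * d else X s.

Lemma linear_ext_right X (t d s : R) : t <= s -> linear_ext X t d s = X s.
Proof. by rewrite /linear_ext ltNge => ->. Qed.

Lemma is_derive_linear_ext X (t d : R) : right_diff X t d -> is_derive t 1 (linear_ext X t d) d.
Proof.
move=> Xd.
have H : (fun h => h^-1 *: ((linear_ext X t d \o shift t) (h *: 1) - linear_ext X t d t)) @ 0^' --> d.
  apply/cvgrPdist_le => e e0; have [r r0 Hr] := Xd e e0.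
  near=> h; rewrite /= [linear_ext X t d t]linear_ext_right// /linear_ext.
  have h0 : h != 0 by near: h; exact: nbhs_dnbhs_neq.
  have hr : `|h| < r by near: h; exact: dnbhs0_lt.
  rewrite /GRing.scale/= mulr1; have [hn|hp] := ltP (h + t) t.
    rewrite [X in `|_ - X|](_ : _ = d) ?subrr ?normr0 ?ltW//.
    by field.
  have hp0 : 0 < h by rewrite lt_neqAle eq_sym h0/= -(lerD2r t) add0r.
  have := Hr (h + t) hp; rewrite addrC ltrD2l => /(_ (le_lt_trans (ler_norm _) hr)).
  rewrite (addrC t h) addrK => Hle.
  have -> : d - h^-1 * (X (h + t) - X t) = - (h^-1 * (X (h + t) - X t - h * d)) by field.
  by rewrite normrN normrM gtr0_norm ?invr_gt0// ler_pdivrMl// [h * e]mulrC.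
exact: (DeriveDef (cvgP _ H) (cvg_lim _ H)).
Unshelve. all: by end_near. Qed.

(** Take the supremum of the points up to which [f] stays above the line of slope [- e] from [a].
    Continuity keeps [f] above the line there, and the nonnegative derivative of [g] carries it
    further, so the supremum is [b]. The function [g] agrees with [f] only to the right of [t],
    where right differentiability gives information. *)
Lemma right_derivative_mono f (a b : R) : a <= b -> {within `[a, b], continuous f} ->
  (forall t, a <= t -> t < b -> exists g d, [/\ is_derive t 1 g d, 0 <= d &
     forall s, t <= s -> s < b -> g s = f s]) ->
  f a <= f b.
Proof.
rewrite le_eqVlt => /predU1P[->//|ab] cf df.
suff H e : 0 < e -> f a - e * (b - a) <= f b.
  apply/ler_addgt0Pr => e e0; have ba : 0 < b - a by rewrite subr_gt0.
  have := H (e / (b - a)); rewrite divr_gt0// => /(_ isT).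
  by rewrite divfK ?gt_eqF// lerBlDr.
move=> e0.
have : {within `[a, b], continuous f} by [].
pose ok x := f a - e * (x - a) <= f x.
pose A := [set x | a <= x <= b /\ forall y, a <= y -> y <= x -> ok y].
have Aa : A a.
  split; first by rewrite lexx ltW.
  move=> y ay ya; have -> : y = a by apply/eqP; rewrite eq_le ay ya.
  by rewrite /ok subrr mulr0 subr0.
have hA : has_sup A by split; [exists a|exists b => x [/andP[]]].
pose c := sup A.
have ac : a <= c by apply: sup_upper_bound.
have cb : c <= b by apply: ge_sup; [exists a|move=> x [/andP[]]].
have below y : a <= y -> y < c -> ok y.
  move=> ay yc; have [x [_ Hx] yx] := sup_gt (ex_intro _ a Aa) yc.
  by apply: Hx => //; exact: ltW.
have okc : ok c.
  move: ac; rewrite le_eqVlt => /predU1P[<-|ac]; first by have [_] := Aa; apply.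
  rewrite /ok leNgt; apply/negP => bad.
  pose eta := f a - e * (c - a) - f c; have eta0 : 0 < eta by rewrite subr_gt0.
  have /subspace_continuousP/(_ c) := cf; rewrite /= in_itv/= (ltW ac) cb => /(_ isT).
  move=> /cvgrPdist_lt/(_ _ eta0); rewrite near_withinE => /nbhs_ballP[r /= r0 Hr].
  pose y := Num.max a (c - r / 2).
  have ay : a <= y by rewrite le_max lexx.
  have yc : y < c by rewrite gt_max ac ltrBlDr ltrDl divr_gt0.
  have := Hr y; rewrite /ball/= in_itv/= ay (le_trans (ltW yc) cb) => /(_ _ isT).
  have cyr : `|c - y| < r.
    rewrite gtr0_norm ?subr_gt0// ltrBlDr -ltrBlDl.
    by apply: lt_le_trans (_ : c - r / 2 <= _); [lra|rewrite le_max lexx orbT].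
  move=> /(_ cyr); rewrite ltr_norml => /andP[+ _].
  have := below y ay yc; rewrite /ok /eta => h1 h2.
  have : e * (y - a) <= e * (c - a) by rewrite ler_pM2l// lerD2r ltW.
  move: h1 h2; rewrite /from_subspace; lra.
move=> _; have := okc; move: cb; rewrite le_eqVlt => /predU1P[-> //|cb] _.
exfalso.
have [g [dg [gd dg0 gf]]] := df c ac cb.
have := @ex_derive _ _ _ _ _ _ _ gd => dgc.
have Hlim : (fun h => h^-1 *: ((g \o shift c) (h *: 1) - g c)) @ 0^' --> dg.
  have <- : 'D_1 g c = dg by exact: derive_val.
  exact: dgc.
have /cvgrPdist_lt/(_ _ e0) := Hlim; rewrite /dnbhs near_withinE => /nbhs_ballP[r /= r0 Hr].
pose x := Num.min ((c + b) / 2) (c + r / 2).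
have cx : c < x by rewrite lt_min; apply/andP; split; lra.
have xb : x < b by rewrite gt_min; apply/orP; left; lra.
have xr : x <= c + r / 2 by rewrite ge_min lexx orbT.
have xA : A x.
  split; first by rewrite (le_trans ac (ltW cx)) ltW.
  move=> y ay yx; have [yc|cy] := ltP y c; first exact: below.
  move: cy; rewrite le_eqVlt => /predU1P[<- //|cy].
  have h0 : 0 < y - c by rewrite subr_gt0.
  have := Hr (y - c); rewrite /ball/= sub0r normrN gtr0_norm// => /(_ _ _).
  have hr : y - c < r by lra.
  move=> /(_ hr (lt0r_neq0 h0)); rewrite /GRing.scale/= mulr1 subrK.
  rewrite ltr_norml => /andP[_].
  rewrite gf ?(ltW cy) ?(le_lt_trans yx)// gf// => h.
  have {}h : (dg - e) * (y - c) <= f y - f c.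
    rewrite mulrC -ler_pdivlMl//; move: h; lra.
  have : 0 <= dg * (y - c) by rewrite mulr_ge0// ltW.
  by move: okc; rewrite /ok; lra.
have : x <= c by apply: sup_upper_bound.
by rewrite leNgt cx.
Qed.

Section growth.
Variables (p r a : R).
Hypotheses (p1 : 1 < p) (ap : 0 < 1 + a * p) (ar : 0 < 1 + a * r) (a1 : 0 < 1 + a).
Local Notation K := (power_ratio a).
Local Notation c := (gap_coef p r a).

(* With [A = F / t] this is [t * A `^ r * (K r - c * (K p - P / (t * A `^ p)))]. *)
Definition growth_bound (t F P : R) : R :=
  (K r - c * K p) * (F `^ r * t `^ (1 - r)) + c * (F `^ (r - p) * t `^ (p - r) * P).

Lemma growth_boundE (t F P : R) : 0 < t -> 0 < F ->
  growth_bound t F P =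
  t * (F / t) `^ r * (K r - c * (K p - P / (t * (F / t) `^ p))).
Proof.
move=> t0 F0; rewrite /growth_bound; set A := F / t.
have A0 : 0 < A by rewrite divr_gt0.
have FE : F = A * t by rewrite /A divfK ?gt_eqF.
have E x y z : x + y = z -> F `^ x * t `^ y = A `^ x * t `^ z.
  by move=> <-; rewrite FE powRM ?ltW// -mulrA -powRD//; apply/implyP => _; rewrite gt_eqF.
have T1 : F `^ r * t `^ (1 - r) = A `^ r * t by rewrite (E _ _ 1) ?powRr1 ?ltW//; ring.
have T2 : F `^ (r - p) * t `^ (p - r) = A `^ r / A `^ p.
  rewrite (E _ _ 0) ?powRr0 ?mulr1; last by ring.
  by rewrite powRB//; apply/implyP => _; rewrite gt_eqF.
rewrite T1 T2; have Ap : A `^ p != 0 by rewrite gt_eqF// powR_gt0.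
move: (A `^ r) (A `^ p) (K r) (K p) c Ap => x1 x2 x3 x4 x5 x20.
by field; rewrite x20 gt_eqF.
Qed.

Lemma growth_estimate (t0 t1 : R) (m q F P Q : R -> R) :
  0 < t0 -> t0 <= t1 ->
  ([/\ p < r, a < 0 & forall t, t0 <= t -> t < t1 -> m t <= F t / t] \/
   [/\ r < 0, 0 < a & forall t, t0 <= t -> t < t1 -> F t / t <= m t]) ->
  {within `[t0, t1], continuous F} -> {within `[t0, t1], continuous P} ->
  {within `[t0, t1], continuous Q} ->
  (forall t, t0 <= t -> t < t1 -> [/\ right_diff F t (m t), right_diff P t (m t `^ p),
     right_diff Q t (q t), 0 <= m t & q t <= m t `^ r]) ->
  (forall t, t0 <= t -> t <= t1 -> 0 < F t /\ P t <= K p * (t * (F t / t) `^ p)) ->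
  Q t1 - Q t0 <= growth_bound t1 (F t1) (P t1) - growth_bound t0 (F t0) (P t0).
Proof.
move=> t00 t01 cases cF cP cQ dX FP.
pose phi t := growth_bound t (F t) (P t) - Q t.
suff : phi t0 <= phi t1 by rewrite /phi; lra.
apply: right_derivative_mono => //.
  apply/subspace_continuousP => t /= tt.
  have t0' : 0 < t by move: tt; rewrite in_itv/= => /andP[h _]; exact: lt_le_trans h.
  have F0 : 0 < F t by move: tt; rewrite in_itv/= => /andP[h1 h2]; have [] := FP t h1 h2.
  move/subspace_continuousP/(_ t tt) : cF => cF; move/subspace_continuousP/(_ t tt) : cP => cP.
  move/subspace_continuousP/(_ t tt) : cQ => cQ.
  have cid : id s @[s --> within [set` `[t0, t1]] (nbhs t)] --> id t.
    exact: cvg_within.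
  apply: cvgB => //; apply: cvgD.
    apply: cvgM; first exact: cvg_cst.
    by apply: cvgM; [exact: cvg_powRf|exact: (cvg_powRf _ (f := id))].
  apply: cvgM; first exact: cvg_cst.
  by apply: cvgM => //; apply: cvgM; [exact: cvg_powRf|exact: (cvg_powRf _ (f := id))].
move=> t tt0 tt1; have t0' : 0 < t by exact: lt_le_trans tt0.
have [rF rP rQ m0 qm] := dX t tt0 tt1; have [F0 PF] := FP t tt0 (ltW tt1).
pose Fx := linear_ext F t (m t); pose Px := linear_ext P t (m t `^ p).
pose Qx := linear_ext Q t (q t).
have FxE : Fx t = F t by exact: linear_ext_right.
have PxE : Px t = P t by exact: linear_ext_right.
have dF : is_derive t 1 Fx (m t) by exact: is_derive_linear_ext.
have dP : is_derive t 1 Px (m t `^ p) by exact: is_derive_linear_ext.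
have dQ : is_derive t 1 Qx (q t) by exact: is_derive_linear_ext.
have Fx0 : 0 < Fx t by rewrite FxE.
have dFp x := is_derive_powf x Fx0 dF.
have dtp x := is_derive1_powR x t0'.
have d1 := is_derive_mulf (is_derive_cst (K r - c * K p) t 1) (is_derive_mulf (dFp r) (dtp (1 - r))).
have d2 := is_derive_mulf (is_derive_cst c t 1) (is_derive_mulf (is_derive_mulf (dFp (r - p)) (dtp (p - r))) dP).
have d3 := is_derive_addf (is_derive_addf d1 d2) (is_deriveN dQ).
exists (fun s => growth_bound s (Fx s) (Px s) - Qx s).
set A := F t / t; have A0 : 0 < A by rewrite divr_gt0.
have FE : F t = A * t by rewrite /A divfK ?gt_eqF.
pose v := m t / A; have v0 : 0 <= v by rewrite divr_ge0// ltW.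
have mE : m t = v * A by rewrite /v divfK ?gt_eqF.
pose g := P t / (t * A `^ p).
have Ap0 : 0 < A `^ p by rewrite powR_gt0.
have PE : P t = g * (t * A `^ p) by rewrite /g divfK ?gt_eqF// mulr_gt0.
(* The derivative in terms of [v] and [g]. Its dependence on [g] is through c (r - p) (v - 1) g with
   (r - p) (v - 1) <= 0, so the worst case is [g = K p], equality in the hypothesis; there
   [power_tangent_gap] gives at least A^r v^r = m^r. *)
exists (A `^ r * ((K r - c * K p) * (1 - r + r * v) + c * ((r - p) * (v - 1) * g + v `^ p)) - q t).
split.
- apply: is_derive_eq d3 _; rewrite !FxE !PxE /=.
  have E x y z : x + y = z -> F t `^ x * t `^ y = A `^ x * t `^ z.
    by move=> <-; rewrite FE powRM ?ltW// -mulrA -powRD//; apply/implyP => _; rewrite gt_eqF.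
  have AB x y : A `^ (x - y) = A `^ x / A `^ y by rewrite powRB//; apply/implyP => _; rewrite gt_eqF.
  have A1 : A `^ 1 = A by rewrite powRr1 ?ltW.
  have T1 : F t `^ r * t `^ (1 - r - 1) = A `^ r by rewrite (E _ _ 0) ?powRr0 ?mulr1//; ring.
  have T2 : F t `^ (r - 1) * t `^ (1 - r) = A `^ r / A.
    by rewrite (E _ _ 0) ?powRr0 ?mulr1; [rewrite AB A1|ring].
  have tN1 : t `^ (-1) = t^-1 by rewrite powR_inv1// ltW.
  have T3 : F t `^ (r - p - 1) * t `^ (p - r) = A `^ r / A `^ p / A / t.
    by rewrite (E _ _ (-1)) ?tN1; [rewrite !AB A1|ring].
  have T4 : F t `^ (r - p) * t `^ (p - r - 1) = A `^ r / A `^ p / t.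
    by rewrite (E _ _ (-1)) ?tN1; [rewrite !AB|ring].
  have T5 : F t `^ (r - p) * t `^ (p - r) = A `^ r / A `^ p.
    by rewrite (E _ _ 0) ?powRr0 ?mulr1; [rewrite !AB|ring].
  transitivity ((K r - c * K p) * (r * (F t `^ (r - 1) * t `^ (1 - r)) * m t +
      (1 - r) * (F t `^ r * t `^ (1 - r - 1))) +
    c * ((r - p) * (F t `^ (r - p - 1) * t `^ (p - r)) * m t * P t +
         (p - r) * (F t `^ (r - p) * t `^ (p - r - 1)) * P t +
         (F t `^ (r - p) * t `^ (p - r)) * m t `^ p) - q t); first by ring.
  rewrite T1 T2 T3 T4 T5 {3}mE (powRM p v0 (ltW A0)) PE mE.
  field.
  by rewrite !gt_eqF.
- have Kp : 0 < K p by exact: power_ratio_gt0.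
  have Kr : 0 < K r by exact: power_ratio_gt0.
  have rr : 0 < r * (r - 1).
    case: cases => [[pr _ _]|[r0 _ _]]; last by rewrite nmulr_rgt0// subr_lt0 (lt_trans r0).
    by rewrite mulr_gt0 ?subr_gt0 ?(lt_trans p1)// (lt_trans _ pr)// (lt_trans ltr01).
  have pp : 0 < p * (p - 1) by rewrite mulr_gt0 ?subr_gt0// (lt_trans ltr01).
  have c0 : 0 < c.
    rewrite /gap_coef; apply: divr_gt0; exact: mulr_gt0.
  have gK : g <= K p by rewrite /g ler_pdivrMr// mulr_gt0.
  have vcase : [/\ p < r, a < 0 & v <= 1] \/ [/\ r < 0, 0 < a & 1 <= v].
    case: cases => [[pr a0 /(_ t tt0 tt1) mA]|[r0 a0 /(_ t tt0 tt1) mA]]; [left|right].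
      by split => //; rewrite /v ler_pdivrMr// mul1r.
    by split => //; rewrite /v ler_pdivlMr// mul1r.
  have rv : (r - p) * (v - 1) <= 0.
    case: vcase => [[pr _ v1]|[r0 _ v1]].
      by apply: mulr_ge0_le0; rewrite ?subr_ge0 ?subr_le0// ltW.
    apply: mulr_le0_ge0; rewrite ?subr_ge0 ?subr_le0//.
    by rewrite ltW// (lt_trans r0)// (lt_trans ltr01).
  have gap := power_tangent_gap p1 v0 ap ar a1 vcase.
  have mr : m t `^ r = A `^ r * v `^ r by rewrite mE (powRM r v0 (ltW A0)) mulrC.
  rewrite subr_ge0; apply: le_trans qm _; rewrite mr ler_pM2l ?powR_gt0//.
  have h1 : (r - p) * (v - 1) * K p <= (r - p) * (v - 1) * g by rewrite ler_wnM2l.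
  have h2 : c * ((r - p) * (v - 1) * K p) <= c * ((r - p) * (v - 1) * g) by rewrite ler_pM2l.
  by clear -gap h2; lra.
- move=> s ts st1.
  by rewrite /phi /Fx /Px /Qx !linear_ext_right.
Qed.

End growth.
End right_derivatives.

(** * The reverse Hoelder inequality for rearrangements *)

Section convexity.
Context {R : realType}.
Implicit Types (p s x y A : R).

(** Young's inequality for [s] and A^(p - 1). *)
Lemma powR_tangent p A s : 1 < p -> 0 < A -> 0 <= s ->
  A `^ p + p * A `^ (p - 1) * (s - A) <= s `^ p.
Proof.
move=> p1 A0 s0; have p0 : 0 < p by lra.
have q0 : 0 < p / (p - 1) by rewrite divr_gt0//; lra.
have p10 : p - 1 != 0 by rewrite gt_eqF//; lra.
have := @conjugate_powR R s (A `^ (p - 1)) p (p / (p - 1)) s0 (powR_ge0 _ _) p0 q0.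
have -> : p^-1 + (p / (p - 1))^-1 = 1 by field; rewrite p10 gt_eqF.
move=> /(_ erefl); rewrite -powRrM (_ : (p - 1) * (p / (p - 1)) = p); last by field.
have AE : A `^ p = A * A `^ (p - 1) by rewrite mulr_powRB1// ltW.
move: (s `^ p) (A `^ (p - 1)) AE => S B ->.
have -> : S / p + A * B / (p / (p - 1)) = (S + (p - 1) * (A * B)) / p by field; rewrite p10 gt_eqF.
by rewrite ler_pdivlMr//; lra.
Qed.

Lemma powR_convex p x y (t : R) : 1 < p -> 0 <= x -> 0 < y -> 0 <= t -> t < 1 -> 
  (t * x + (1 - t) * y) `^ p <= t * x `^ p + (1 - t) * y `^ p.
Proof.
move=> p1 x0 y0 t0 t1.
have A0 : 0 < t * x + (1 - t) * y by rewrite ltr_wpDl ?mulr_ge0// mulr_gt0 ?subr_gt0.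
set A := t * x + _ in A0 *.
have h1 := powR_tangent p1 A0 x0; have h2 := powR_tangent p1 A0 (ltW y0).
have h3 : t * (A `^ p + p * A `^ (p - 1) * (x - A)) <= t * x `^ p by rewrite ler_wpM2l.
have h4 : (1 - t) * (A `^ p + p * A `^ (p - 1) * (y - A)) <= (1 - t) * y `^ p.
  by rewrite ler_wpM2l// subr_ge0 ltW.
apply: le_trans (lerD h3 h4); rewrite le_eqVlt; apply/orP; left; apply/eqP.
by move: (A `^ p) (A `^ (p - 1)) => B C; rewrite /A; ring.
Qed.

(* The line through [(l, l `^ p)] and [(A, L)], with [(A, L)] above the graph. *)
Lemma secant_above p (l A L t : R) : 1 < p -> 0 < l -> 0 < A -> A `^ p <= L ->
  0 <= t <= 1 -> (l + t * (A - l)) `^ p <= l `^ p + t * (L - l `^ p).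
Proof.
move=> p1 l0 A0 AL /andP[t0]; rewrite le_eqVlt => /predU1P[->|t1].
  by rewrite !mul1r !subrKC.
have -> : l + t * (A - l) = t * A + (1 - t) * l by ring.
apply: le_trans (powR_convex p1 (ltW A0) l0 t0 t1) _.
have : t * A `^ p <= t * L by rewrite ler_wpM2l.
lra.
Qed.

Lemma secant_below p (l A L t : R) : 1 < p -> 0 < A -> A `^ p <= L ->
  0 < l + t * (A - l) -> t <= 0 -> l `^ p + t * (L - l `^ p) <= (l + t * (A - l)) `^ p.
Proof.
move=> p1 A0 AL s0 t0; set s := l + t * (A - l) in s0 *.
have t1 : 0 < 1 - t by lra.
pose u := - t / (1 - t).
have u0 : 0 <= u by rewrite divr_ge0 ?oppr_ge0// ltW.
have u1 : u < 1 by rewrite ltr_pdivrMr//; lra.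
have lE : l = u * A + (1 - u) * s by rewrite /u /s; field; rewrite gt_eqF.
have := powR_convex p1 (ltW A0) s0 u0 u1; rewrite -lE => h.
have {}h : (1 - t) * l `^ p <= - t * A `^ p + s `^ p.
  move: h; rewrite -(ler_pM2l t1); congr (_ <= _).
  by rewrite /u; move: (A `^ p) (s `^ p) => B C; field; rewrite gt_eqF.
have : t * L <= t * A `^ p by rewrite ler_wnM2l.
lra.
Qed.

(** [sg] selects the side of [l] on which [A] lies, so that parts of large and of small values share
    one proof. By convexity the power is below the secant between [l] and [A] and above it beyond
    [l]; that the end [(A, L)] is above the graph only helps. *)
Lemma secant_sign p (l A L sg : R) : sg = 1 \/ sg = -1 -> 1 < p -> 0 < l -> 0 < A ->
  A `^ p <= L -> sg * l < sg * A ->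
  exists b, [/\ l `^ p + b * (A - l) = L,
    forall s, 0 < s -> sg * l <= sg * s -> sg * s <= sg * A -> s `^ p <= l `^ p + b * (s - l) &
    forall s, 0 < s -> sg * s <= sg * l -> l `^ p + b * (s - l) <= s `^ p].
Proof.
move=> sg2 p1 l0 A0 AL lA.
have Al : A - l != 0.
  by rewrite subr_eq0; apply: contraTneq lA => ->; rewrite ltxx.
pose u s := (s - l) / (A - l).
have uE s : s = l + u s * (A - l) by rewrite /u divfK// subrKC.
have u2 s : u s = (sg * s - sg * l) / (sg * A - sg * l).
  rewrite /u -!mulrBr invfM mulrACA divff ?mul1r//.
  by case: sg2 => ->; rewrite ?oppr_eq0 oner_eq0.
have sgA : 0 < sg * A - sg * l by rewrite subr_gt0.
exists ((L - l `^ p) / (A - l)).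
have bE s : (L - l `^ p) / (A - l) * (s - l) = u s * (L - l `^ p).
  by rewrite /u; move: (L - _) => B; field.
split.
- by rewrite divfK// subrKC.
- move=> s s0 ls sA; rewrite bE {1}(uE s); apply: secant_above => //.
  by rewrite u2 divr_ge0 ?subr_ge0 ?(ltW lA)//= ler_pdivrMr// mul1r lerD2r.
- move=> s s0 ls; rewrite bE {2}(uE s); apply: secant_below => //.
    by rewrite -uE.
  by rewrite u2 ler_pdivrMr// mul0r subr_le0.
Qed.

End convexity.

Lemma le_Rintegral_null d (T : measurableType d) (R : realType)
    (mu : {measure set T -> \bar R}) (D N : set T) (f1 f2 : T -> R) :
  measurable D -> measurable N -> mu N = 0%E ->
  mu.-integrable D (EFin \o f1) -> mu.-integrable D (EFin \o f2) ->
  (forall x, D x -> ~ N x -> f1 x <= f2 x) ->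
  \int[mu]_(x in D) f1 x <= \int[mu]_(x in D) f2 x.
Proof.
move=> mD mN N0 i1 i2 f12; have mDN : measurable (D `\` N) by exact: measurableD.
have E f : mu.-integrable D (EFin \o f) ->
    \int[mu]_(x in D) f x = \int[mu]_(x in D `\` N) f x.
  by move=> fi; rewrite /Rintegral (negligible_integral mN mD fi N0).
rewrite (E _ i1) (E _ i2); apply: le_Rintegral => //.
- by apply: integrableS i1 => // x [].
- by apply: integrableS i2 => // x [].
- by move=> x [Dx Nx]; exact: f12.
Qed.

Lemma subcell_subset (R : realType) (n : nat) (d c : 'rV[R]_n.+1 * 'rV[R]_n.+1) :
  subcell d c -> cell d `<=` cell c.
Proof.
move=> dc x xd j; have [h1 h2] := dc j; have /andP[h3 h4] := xd j.
by rewrite (le_lt_trans h1 h3) (le_trans h4 h2).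
Qed.

Lemma Rintegral_cell_cst (R : realType) (n : nat) (d : 'rV[R]_n.+1 * 'rV[R]_n.+1) (k : R) :
  \int[@lebesgue R n]_(x in cell d) k = k * box_volume d.1 d.2.
Proof.
rewrite Rintegral_cst; last exact: measurable_cell.
by congr (_ * _); rewrite [X in fine X]lebesgue_cbox.
Qed.

Lemma integrable_extension d (T : measurableType d) (R : realType)
    (mu : {measure set T -> \bar R}) (D : set T) (f : T -> R) :
  measurable D -> mu.-integrable D (EFin \o f) -> mu.-integrable setT (EFin \o (f \_ D)).
Proof.
move=> mD fi; have -> : EFin \o (f \_ D) = (EFin \o f) \_ D.
  by apply/funext => x /=; rewrite restrict_EFin.
by apply/(integrable_mkcond _ mD).
Qed.

Lemma Rintegral_extension d (T : measurableType d) (R : realType)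
    (mu : {measure set T -> \bar R}) (D A : set T) (f : T -> R) : A `<=` D ->
  \int[mu]_(x in A) (f \_ D) x = \int[mu]_(x in A) f x.
Proof. by move=> AD; rewrite -Rintegral_mkcondr setIidl. Qed.

Section rearrangement_bounds.
Context {R : realType} {n : nat}.
Local Notation mu := (@lebesgue R n).
Variables (c : 'rV[R]_n.+1 * 'rV[R]_n.+1) (W : Rn R n -> R) (eta p Delta sg : R).
Local Notation D := (cell c).
Local Notation vol d := (box_volume d.1 d.2).
Hypotheses (nc : proper_cell c) (eta0 : 0 < eta) (p1 : 1 < p) (Delta1 : 1 <= Delta)
  (sg2 : sg = 1 \/ sg = -1).
Hypotheses (mW : measurable_fun setT W) (Weta : forall x, D x -> eta <= W x)
  (iW : mu.-integrable D (EFin \o W)) (iWp : mu.-integrable D (EFin \o (fun x => W x `^ p))).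
Hypothesis RH : forall d, proper_cell d -> subcell d c ->
  \int[mu]_(x in cell d) (W x `^ p) <=
  Delta * (vol d * (\int[mu]_(x in cell d) W x / vol d) `^ p).

Let v x := sg * W x.
Local Notation q t := (quantile mu D v t).
Definition quantile_level (t : R) : R := sg * q t.
(** Conjugation by the sign keeps [G] nondecreasing, so that [top_integral] for [v = sg * W] handles
    the largest and the smallest values alike. *)
Definition sgconj (G : R -> R) (y : R) : R := sg * G (sg * y).
Definition part (G : R -> R) (t : R) : R := sg * top_integral mu D v (sgconj G) t.
(** Clamped at [eta] to be nondecreasing on the whole line, while equal to the power on the values
    of [W]. *)
Definition powp (s : R) : R := Num.max eta s `^ p.
Local Notation S t := (superlevel D v (q t)).

Let mD : measurable D. Proof. exact: measurable_cell. Qed.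

Let muD : mu D = (vol c)%:E. Proof. exact: lebesgue_cbox. Qed.

Let Dfin : (mu D < +oo)%E. Proof. by rewrite muD ltry. Qed.

Let mv : measurable_fun setT v. Proof. by apply: measurable_funM. Qed.

Let M0 : 0 < vol c.
Proof. exact: box_volume_gt0. Qed.

Let fmuD : fine (mu D) = vol c. Proof. by rewrite muD. Qed.

Let sgsg : sg * sg = 1. Proof. by case: sg2 => ->; rewrite ?mulrNN mul1r. Qed.

Let sgK x : sg * (sg * x) = x. Proof. by rewrite mulrA sgsg mul1r. Qed.

Lemma sgconj_homo (G : R -> R) : {homo G : x y / x <= y} -> {homo sgconj G : x y / x <= y}.
Proof.
move=> Gh x y xy; rewrite /sgconj; case: sg2 => ->; first by rewrite !mul1r; exact: Gh.
by rewrite !mulN1r lerN2; apply: Gh; rewrite lerN2.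
Qed.

Lemma powp_homo : {homo powp : x y / x <= y}.
Proof.
move=> x y xy; have p0 : 0 <= p by rewrite ltW// (lt_trans ltr01).
have mxy : Num.max eta x <= Num.max eta y by rewrite ge_max !le_max lexx xy orbT.
by apply: (ge0_ler_powR p0) => //; rewrite nnegrE le_max (ltW eta0).
Qed.

Lemma powp_W x : D x -> powp (W x) = W x `^ p.
Proof. by move=> Dx; rewrite /powp max_r// Weta. Qed.

Lemma sgconj_v (G : R -> R) x : sgconj G (v x) = sg * G (W x).
Proof. by rewrite /sgconj /v sgK. Qed.

Lemma integrable_sgconj (G : R -> R) : mu.-integrable D (EFin \o (fun x => G (W x))) ->
  mu.-integrable D (EFin \o (sgconj G \o v)).
Proof.
move=> Gi; have := integrableZl mD sg Gi; apply: eq_integrable => // x _ /=.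
by rewrite sgconj_v EFinM.
Qed.

Let ipow : mu.-integrable D (EFin \o (fun x => powp (W x))).
Proof.
by apply: eq_integrable iWp => // x /[!inE] Dx /=; rewrite powp_W.
Qed.

Lemma superlevel_full (y : R) : (forall x, D x -> y < v x) -> tail mu D v y = vol c.
Proof.
move=> yv; rewrite /tail (_ : superlevel D v y = D) ?fmuD//.
by apply/seteqP; split => [x []//|x Dx]; split => //=; exact: yv.
Qed.

Lemma superlevel_empty (y : R) : (forall x, D x -> v x <= y) -> tail mu D v y = 0.
Proof.
move=> yv; rewrite /tail (_ : superlevel D v y = set0) ?measure0//.
by apply/seteqP; split => // x [Dx /=]; rewrite ltNge yv.
Qed.

Lemma level_ge (t : R) : 0 < t -> t < vol c -> eta <= quantile_level t.
Proof.
rewrite -fmuD => t0 tM; rewrite /quantile_level leNgt; apply/negP.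
have H1 y : q t < y -> tail mu D v y <= t by exact: tail_le_quantile.
have H2 y : tail mu D v y <= t -> q t <= y by exact: quantile_le.
move: H1 H2; move: (q t) => z H1 H2; rewrite fmuD in tM.
have [s1|s1] := sg2; rewrite s1.
  rewrite mul1r => qe; have [m1 m2] := midf_lt qe.
  have := H1 _ m1; rewrite superlevel_full; first by rewrite leNgt tM.
  by move=> x Dx; rewrite /v s1 mul1r; apply: lt_le_trans (Weta Dx).
rewrite mulN1r => qe; have := H2 (- eta).
rewrite superlevel_empty; last by move=> x Dx; rewrite /v s1 mulN1r lerN2 Weta.
by move=> /(_ (ltW t0)); rewrite leNgt ltrNl qe.
Qed.

Lemma integrable_indicator (g : Rn R n -> R) (A : set (Rn R n)) :
  mu.-integrable D (EFin \o g) -> measurable A ->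
  mu.-integrable D (EFin \o (fun x => g x * \1_A x)).
Proof.
move=> gi mA; have mg : measurable_fun D g.
  by case/integrableP : gi => /measurable_EFinP.
apply: le_integrable gi => //.
  by apply/measurable_EFinP/measurable_funM => //; exact: measurable_indic.
move=> x _ /=; rewrite lee_fin normrM ler_piMr// indicE.
by case: (_ \in _); rewrite ?normr1 ?normr0.
Qed.

(** The strict superlevel set may have measure below [t]. The missing measure is taken at the level
    itself, where the integrand vanishes. *)
Lemma partE (G : R -> R) (t : R) : {homo G : x y / x <= y} ->
  mu.-integrable D (EFin \o (fun x => G (W x))) ->
  part G t = t * G (quantile_level t) + \int[mu]_(x in D) ((G (W x) - G (quantile_level t)) * \1_(S t) x).
Proof.
move=> Gh Gi; rewrite /part /top_integral mulrDr; congr (_ + _).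
  by rewrite /sgconj mulrCA sgK.
rewrite /excess -RintegralZl//; last exact: integrable_excess (integrable_sgconj Gi) _.
apply: eq_Rintegral => x /set_mem Dx; rewrite sgconj_v {1}/sgconj -mulrBr indicE.
have [qv|vq] := ltP (q t) (v x).
  rewrite mem_set// mulr1 max_l; first by rewrite sgK.
  by have := sgconj_homo Gh (ltW qv); rewrite sgconj_v /sgconj -subr_ge0 -mulrBr.
rewrite memNset ?mulr0; last by move=> [_ /=]; rewrite ltNge vq.
by rewrite max_r ?mulr0//; have := sgconj_homo Gh vq; rewrite sgconj_v /sgconj -subr_le0 -mulrBr.
Qed.

Local Notation F := (part id).
Local Notation P := (part powp).

Let idh : {homo (id : R -> R) : x y / x <= y}. Proof. by []. Qed.

Lemma level_part (G : R -> R) (t : R) : 0 < t -> t < vol c -> {homo G : x y / x <= y} ->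
  mu.-integrable D (EFin \o (fun x => G (W x))) -> sg * (t * G (quantile_level t)) <= sg * part G t.
Proof.
move=> t0 tM Gh Gi; rewrite /part sgK /top_integral {1}/sgconj mulrCA lerDl.
exact: excess_ge0.
Qed.

Lemma FE (t : R) : F t = t * quantile_level t + \int[mu]_(x in D) ((W x - quantile_level t) * \1_(S t) x).
Proof. exact: (partE t idh iW). Qed.

Lemma PE (t : R) : 0 < t -> t < vol c ->
  P t = t * quantile_level t `^ p + \int[mu]_(x in D) ((W x `^ p - quantile_level t `^ p) * \1_(S t) x).
Proof.
move=> t0 tM; have le := level_ge t0 tM.
have lp : powp (quantile_level t) = quantile_level t `^ p by rewrite /powp max_r.
rewrite (partE t powp_homo ipow) lp.
have -> : \int[mu]_(x in D) ((powp (W x) - quantile_level t `^ p) * \1_(S t) x) =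
    \int[mu]_(x in D) ((W x `^ p - quantile_level t `^ p) * \1_(S t) x).
  by apply: eq_Rintegral => x /set_mem Dx; rewrite powp_W.
by [].
Qed.

Lemma F_ge (t : R) : 0 < t -> t < vol c -> t * eta <= F t.
Proof.
move=> t0 tM; have le := level_ge t0 tM.
have [s1|s1] := sg2.
  have := level_part t0 tM idh iW; rewrite s1 !mul1r; apply: le_trans.
  by rewrite ler_wpM2l// ltW.
(* For the smallest values the minimum property is tested at [- eta], where [excess] vanishes
   because [eta <= W]. *)
rewrite /part s1 mulN1r lerNr -mulrN; rewrite -fmuD in tM.
apply: le_trans (top_integral_le mD Dfin mv (sgconj_homo idh) (integrable_sgconj (G := id) iW) (- eta) t0 tM) _.
rewrite /sgconj s1 !mulN1r opprK -[leRHS]addr0 lerD2l.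
have -> : excess mu D v (fun y => -1 * (-1 * y)) (- eta) = 0; last by [].
rewrite /excess (@eq_Rintegral _ _ _ mu _ (cst 0)); first by rewrite Rintegral_cst// mul0r.
move=> x /set_mem Dx; rewrite max_r// /v s1 !mulN1r opprK subr_le0 lerN2.
exact: Weta.
Qed.

Lemma F_total (t : R) : 0 < t -> t < vol c ->
  sg * (t * \int[mu]_(x in D) W x) <= sg * (vol c * F t).
Proof.
move=> t0 tM; rewrite -fmuD in tM.
have := top_integral_ge mD Dfin (integrable_sgconj (G := id) iW) t0 tM; rewrite fmuD => h.
rewrite [leRHS]mulrCA /part sgK; apply: le_trans h.
rewrite mulrCA ler_pM2l// -RintegralZl//.
rewrite le_eqVlt; apply/orP; left; apply/eqP; apply: eq_Rintegral => x _.
by rewrite sgconj_v.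
Qed.

Lemma integrable_constD (k : R) : mu.-integrable D (EFin \o cst k).
Proof. exact: integrable_cst_fin. Qed.

Lemma integrable_affine (g : Rn R n -> R) (k b : R) : mu.-integrable D (EFin \o g) ->
  mu.-integrable D (EFin \o (fun x => b * g x + k)).
Proof.
move=> gi; have := integrableD mD (integrableZl mD b gi) (integrable_constD k).
by apply: eq_integrable => // x _ /=; rewrite EFinD EFinM.
Qed.

Lemma measurable_S (t : R) : measurable (S t).
Proof. exact: measurable_superlevel. Qed.

Lemma S_lt (t : R) x : S t x -> sg * quantile_level t < sg * W x.
Proof. by case=> _ /=; rewrite /quantile_level sgK. Qed.

Lemma notS_le (t : R) x : D x -> ~ S t x -> sg * W x <= sg * quantile_level t.
Proof. by move=> Dx Sx; rewrite leNgt; apply/negP => h; apply: Sx; split => //=; rewrite /quantile_level sgK in h. Qed.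

Lemma mean_ge (t : R) : 0 < t -> t < vol c -> eta <= F t / t.
Proof. by move=> t0 tM; rewrite ler_pdivlMr// mulrC F_ge. Qed.

Lemma level_mean (t : R) : 0 < t -> t < vol c -> sg * quantile_level t <= sg * (F t / t).
Proof.
move=> t0 tM; rewrite mulrA ler_pdivlMr// -mulrA [_ * t]mulrC.
exact: (level_part t0 tM idh iW).
Qed.

(** The case left out by the secant argument of [rearranged_RH]: if mean and level coincide, there
    are no two points to draw a secant through, but then [W] equals the level almost everywhere on
    [S t]. *)
Lemma degenerate_part (t : R) : 0 < t -> t < vol c -> F t = t * quantile_level t ->
  P t = t * quantile_level t `^ p.
Proof.
move=> t0 tM FEt; have := FE t; rewrite FEt => /eqP.
rewrite eq_sym -subr_eq0 [X in X - _]addrC addrK => /eqP X0; rewrite PE//.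
set X2 := \int[mu]_(x in D) _; suff -> : X2 = 0 by rewrite addr0.
have i1 : mu.-integrable D (EFin \o (fun x => (W x - quantile_level t) * \1_(S t) x)).
  apply: integrable_indicator; last exact: measurable_S.
  have := integrable_affine (- quantile_level t) 1 iW.
  by apply: eq_integrable => // x _ /=; rewrite mul1r.
have i2 : mu.-integrable D (EFin \o (fun x => (W x `^ p - quantile_level t `^ p) * \1_(S t) x)).
  apply: integrable_indicator; last exact: measurable_S.
  have := integrable_affine (- quantile_level t `^ p) 1 iWp.
  by apply: eq_integrable => // x _ /=; rewrite mul1r.
have a1 : (\int[mu]_(x in D) `|((W x - quantile_level t) * \1_(S t) x)%:E| = 0)%E.
  under eq_integral => x xD.
    rewrite (_ : `|_|%E = (sg * ((W x - quantile_level t) * \1_(S t) x))%:E); last first.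
      rewrite /= normrM indicE; case: (boolP (x \in S t)) => xS; last by rewrite normr0 !mulr0.
      rewrite normr1 !mulr1; move/set_mem : xS => /S_lt; rewrite -subr_gt0 -mulrBr => h.
      congr EFin; rewrite -(gtr0_norm h) normrM.
      by case: sg2 => ->; rewrite ?normrN normr1 mul1r.
    over.
  have i3 := integrableZl mD sg i1.
  have := RintegralZl sg mD i1; rewrite X0 mulr0 => /= E0.
  rewrite -[LHS]fineK; first by rewrite -[fine _]/(\int[mu]_(x in D) _) E0.
  by apply: integrable_fin_num => //; apply: eq_integrable i3 => // x _ /=; rewrite EFinM.
have m1 : measurable_fun D (fun x => ((W x - quantile_level t) * \1_(S t) x)%:E).
  by case/integrableP : i1.
have m2 : measurable_fun D (fun x => ((W x `^ p - quantile_level t `^ p) * \1_(S t) x)%:E).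
  by case/integrableP : i2.
have /(ae_eq_integral_abs mu mD m1) ae1 := a1.
have ae2 : ae_eq mu D (fun x => ((W x `^ p - quantile_level t `^ p) * \1_(S t) x)%:E) (cst 0%E).
  apply: filterS ae1 => x H Dx; have := H Dx; rewrite /= indicE.
  case: (boolP (x \in S t)) => xS; last by rewrite !mulr0.
  rewrite !mulr1 => -[/eqP]; rewrite subr_eq0 => /eqP E.
  by move/set_mem : xS => /S_lt; rewrite E ltxx.
move/(ae_eq_integral_abs mu mD m2) : ae2 => a2.
apply/eqP; rewrite -normr_le0; apply: le_trans (le_normr_Rintegral mD i2) _.
by rewrite /Rintegral a2.
Qed.

(* Compare the superlevel set with the rising sun set [E] of [sg * (W - A)]: with
   [Theta] vanishing at the quantile_level and nonpositive at [A], [Theta o W] is nonpositive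
   on the former minus [E] and nonnegative on [E] minus the former. *)
Lemma rearranged_RH (t : R) : 0 < t -> t < vol c -> P t <= Delta * (t * (F t / t) `^ p).
Proof.
move=> t0 tM; have le := level_ge t0 tM; have Ae := mean_ge t0 tM.
have lA := level_mean t0 tM.
have FA : F t = t * (F t / t) by rewrite mulrCA divff ?mulr1// gt_eqF.
have FEt := FE t; have PEt := PE t0 tM; have dg := degenerate_part t0 tM.
have Ft := F_total t0 tM.
move: Ae lA FA dg; set l := quantile_level t in le FEt PEt *; set A := F t / t => Ae lA FA dg.
have l0 : 0 < l by exact: lt_le_trans le.
have A0 : 0 < A by exact: lt_le_trans Ae.
have Ap0 : 0 <= A `^ p by exact: powR_ge0.
have ADA : A `^ p <= Delta * A `^ p by rewrite ler_peMl.
have [lEA|lA'] := eqVneq l A.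
  rewrite dg; last by rewrite lEA.
  by rewrite lEA mulrCA ler_pM2l.
have {}lA : sg * l < sg * A.
  rewrite lt_neqAle lA andbT; apply: contra lA' => /eqP E.
  by rewrite -(sgK l) E sgK.
(* The secant ends at height Delta A^p, the bound that the hypothesis gives for the mean of W^p over
   a rectangle on which [W] has mean [A]. *)
have [b [bE below above]] := secant_sign sg2 p1 l0 A0 ADA lA.
pose Theta (s : R) := s `^ p - (l `^ p + b * (s - l)).
pose f := (fun x => sg * (W x - A)) \_ D.
pose h := (fun x => Theta (W x)) \_ D.
have fiD : mu.-integrable D (EFin \o (fun x => sg * (W x - A))).
  have := integrable_affine (- (sg * A)) sg iW.
  by apply: eq_integrable => // x _ /=; rewrite mulrBr.
have hiD : mu.-integrable D (EFin \o (fun x => Theta (W x))).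
  have := integrableD mD iWp (integrable_affine (- (l `^ p - b * l)) (- b) iW).
  apply: eq_integrable => // x _ /=; rewrite -EFinD; congr EFin; rewrite /Theta; ring.
have fi : mu.-integrable setT (EFin \o f) by exact: integrable_extension.
have hi : mu.-integrable setT (EFin \o h) by exact: integrable_extension.
have Intf d : subcell d c -> \int[mu]_(x in cell d) f x =
    sg * (\int[mu]_(x in cell d) W x - A * vol d).
  move=> dc; have dD := subcell_subset dc; have md : measurable (cell d) by exact: measurable_cell.
  rewrite Rintegral_extension// RintegralZl//; last first.
    have := integrable_affine (- A) 1 iW; move=> /(integrableS mD md dD).
    by apply: eq_integrable => // x _ /=; rewrite mul1r.
  rewrite RintegralB//; [|exact: integrableS iW|exact: integrableS (integrable_constD A)].
  by rewrite Rintegral_cell_cst.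
have Inth d : subcell d c -> \int[mu]_(x in cell d) h x =
    \int[mu]_(x in cell d) (W x `^ p) - (l `^ p - b * l) * vol d - b * \int[mu]_(x in cell d) W x.
  move=> dc; have dD := subcell_subset dc; have md : measurable (cell d) by exact: measurable_cell.
  rewrite Rintegral_extension//.
  transitivity (\int[mu]_(x in cell d) (W x `^ p - (l `^ p - b * l) - b * W x)).
    by apply: eq_Rintegral => x _; rewrite /Theta; ring.
  rewrite RintegralB//; last 2 first.
  - have := integrable_affine (- (l `^ p - b * l)) 1 iWp; move=> /(integrableS mD md dD).
    by apply: eq_integrable => // x _ /=; rewrite mul1r.
  - have := integrable_affine 0 b iW; move=> /(integrableS mD md dD).
    by apply: eq_integrable => // x _ /=; rewrite addr0.
  rewrite RintegralB//; [|exact: integrableS iWp|exact: integrableS (integrable_constD _)].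
  rewrite RintegralZl//; last exact: integrableS iW.
  by rewrite Rintegral_cell_cst.
have If : \int[mu]_(x in cell c) f x <= 0.
  rewrite Intf; last exact: subcell_refl.
  rewrite mulrBr subr_le0 -(ler_pM2l t0) mulrCA [leRHS]mulrCA [A * _]mulrC [t * (_ * A)]mulrCA -FA.
  exact: Ft.
have [E [mE Ec En Eh]] := rising_sun fi nc If.
(* On a rectangle of mean [A] the integral of the secant is its value at [A] times the volume, so
   the hypothesis says precisely that [Theta o W] has nonpositive integral. *)
have hE : \int[mu]_(x in E) h x <= 0.
  apply: Eh => // d nd dc; rewrite Intf// Inth// => /eqP.
  have vd : 0 < vol d by exact: box_volume_gt0.
  rewrite mulf_eq0 => /orP[/eqP s0|]; first by move: sgsg; rewrite s0 mul0r => /eqP; rewrite eq_sym oner_eq0.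
  rewrite subr_eq0 => /eqP Wd; have := RH nd dc; rewrite Wd mulfK ?gt_eqF//.
  rewrite mulrCA -bE -subr_ge0 => H; rewrite -oppr_ge0.
  apply: le_trans H _; rewrite le_eqVlt; apply/orP; left; apply/eqP.
  by move: (\int[mu]_(x in cell d) (W x `^ p)) => u; ring.
(* [rising_sun] excludes [f > r] for each [r > 0]; a countable union turns this into a null set on
   which [f > 0] off [E]. *)
pose N := \bigcup_k ((cell c `\` E) `&` [set x | k.+1%:R^-1 < f x]).
have mf : measurable_fun setT f by apply/measurable_EFinP; case/integrableP : fi.
have mlev (r : R) : measurable [set x | r < f x].
  rewrite (_ : [set x | _] = f @^-1` `]r, +oo[%classic).
    by rewrite -[X in measurable X]setTI; exact: mf.
  by apply/seteqP; split => x /=; rewrite in_itv/= andbT.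
have mNk k : measurable ((cell c `\` E) `&` [set x | k.+1%:R^-1 < f x]).
  by apply: measurableI => //; apply: measurableD.
have mN : measurable N by exact: bigcupT_measurable.
have N0 : mu N = 0%E.
  apply/negligibleP => //; apply: negligible_bigcup => k; apply/negligibleP => //.
  by apply: En; rewrite invr_gt0.
have iS : mu.-integrable D (EFin \o (fun x => Theta (W x) * \1_(S t) x)).
  by apply: integrable_indicator => //; exact: measurable_S.
have iE : mu.-integrable D (EFin \o (fun x => Theta (W x) * \1_E x)).
  exact: integrable_indicator.
have cmp : \int[mu]_(x in D) (Theta (W x) * \1_(S t) x) <= \int[mu]_(x in D) (Theta (W x) * \1_E x).
  apply: (le_Rintegral_null mD mN N0 iS iE) => x Dx Nx.
  have W0 : 0 < W x by exact: lt_le_trans (Weta Dx).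
  rewrite !indicE; case: (boolP (x \in S t)) => xS; case: (boolP (x \in E)) => xE //.
    rewrite mulr1 mulr0 /Theta subr_le0; apply: below => //.
      by move/set_mem : xS => /S_lt/ltW.
    rewrite leNgt; apply/negP => h1; apply: Nx.
    have fx : 0 < f x by rewrite /f patchE mem_set// mulrBr subr_gt0.
    have [k] := ltr_add_invr fx; rewrite add0r => kf; exists k => //; split => //.
    by split => // /mem_set; rewrite (negbTE xE).
  rewrite mulr1 mulr0 /Theta subr_ge0; apply: above => //; apply: notS_le => //.
  by move=> /mem_set; rewrite (negbTE xS).
have ThE : \int[mu]_(x in D) (Theta (W x) * \1_E x) <= 0.
  apply: le_trans hE; rewrite (Rintegral_extension _ _ Ec).
  rewrite -{2}(setIidr Ec) Rintegral_mkcondr le_eqVlt; apply/orP; left; apply/eqP.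
  apply: eq_Rintegral => x _; rewrite patchE indicE.
  by case: (x \in E); rewrite ?mulr1 ?mulr0.
(* [Theta] vanishes at the level [l], so integrating over [S t] is the same as integrating over a
   part of measure [t]. *)
have ThS : \int[mu]_(x in D) (Theta (W x) * \1_(S t) x) = P t - t * (Delta * A `^ p).
  transitivity (\int[mu]_(x in D) ((W x `^ p - l `^ p) * \1_(S t) x - b * ((W x - l) * \1_(S t) x))).
    by apply: eq_Rintegral => x _; rewrite /Theta; ring.
  have i1 : mu.-integrable D (EFin \o (fun x => (W x - l) * \1_(S t) x)).
    apply: integrable_indicator; last exact: measurable_S.
    have := integrable_affine (- l) 1 iW.
    by apply: eq_integrable => // x _ /=; rewrite mul1r.
  have i2 : mu.-integrable D (EFin \o (fun x => (W x `^ p - l `^ p) * \1_(S t) x)).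
    apply: integrable_indicator; last exact: measurable_S.
    have := integrable_affine (- l `^ p) 1 iWp.
    by apply: eq_integrable => // x _ /=; rewrite mul1r.
  rewrite RintegralB//; last first.
    by have := integrable_affine 0 b i1; apply: eq_integrable => // x _ /=; rewrite addr0.
  rewrite RintegralZl// PEt -bE.
  have -> : \int[mu]_(x in D) ((W x - l) * \1_(S t) x) = t * A - t * l.
    by rewrite -FA FEt addrC addKr.
  by move: (\int[mu]_(x in D) _) => u; ring.
move: cmp; rewrite ThS => /le_trans/(_ ThE).
by rewrite subr_le0 mulrCA.
Qed.

End rearrangement_bounds.

(** * Moment bounds *)

Section right_diff_facts.
Context {R : realType}.
Implicit Types (X : R -> R) (t d a b : R).

Lemma right_diffZ (k : R) X t d : right_diff X t d -> right_diff (fun s => k * X s) t (k * d).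
Proof.
move=> Xd e e0; have k0 : 0 < `|k| + 1 by rewrite ltr_wpDl.
have [s s0 Hs] := Xd (e / (`|k| + 1)) (divr_gt0 e0 k0).
exists s => // u tu us; have := Hs u tu us.
have -> : k * X u - k * X t - (u - t) * (k * d) = k * (X u - X t - (u - t) * d) by ring.
rewrite normrM => h; apply: le_trans (_ : (`|k| + 1) * (e / (`|k| + 1) * (u - t)) <= _).
  by apply: ler_pM => //; rewrite lerDl.
by rewrite mulrA mulrCA divff ?mulr1// gt_eqF.
Qed.

Lemma lipschitz_within X a b (L : R) : 0 < L ->
  (forall s t, a <= s -> s <= t -> t <= b -> `|X t - X s| <= L * (t - s)) ->
  {within `[a, b], continuous X}.
Proof.
move=> L0 XL; apply/subspace_continuousP => x /=; rewrite in_itv/= => /andP[ax xb].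
apply/cvgrPdist_lt => e e0; rewrite near_withinE; near=> y => /=.
rewrite in_itv/= => /andP[ay yb]; rewrite /from_subspace.
have : `|x - y| < e / L by near: y; apply: cvgr_dist_lt; [exact: cvg_id|exact: divr_gt0].
rewrite ltr_pdivlMr// mulrC; apply: le_lt_trans.
have [xy|yx] := leP x y.
  by rewrite [`|x - y|]distrC (ger0_norm (x := y - x)) ?subr_ge0// distrC XL.
by rewrite (gtr0_norm (x := x - y)) ?subr_gt0//; apply: XL => //; exact: ltW.
Unshelve. all: by end_near. Qed.

Lemma gap_coef_gt0 (p r a : R) : 1 < p -> 0 < 1 + a -> 0 < 1 + a * p -> 0 < 1 + a * r ->
  p < r \/ r < 0 -> 0 < gap_coef p r a.
Proof.
move=> p1 a1 ap ar cases; have p0 := lt_trans ltr01 p1.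
rewrite /gap_coef; apply: divr_gt0; apply: mulr_gt0; rewrite ?power_ratio_gt0//.
  case: cases => [pr|r0]; first by rewrite mulr_gt0 ?subr_gt0 ?(lt_trans p1)// (lt_trans p0).
  by rewrite nmulr_rgt0// subr_lt0 (lt_trans r0).
by rewrite mulr_gt0// subr_gt0.
Qed.

End right_diff_facts.

Section moment_bounds.
Context {R : realType} {n : nat}.
Local Notation mu := (@lebesgue R n).
Variables (c : 'rV[R]_n.+1 * 'rV[R]_n.+1) (W : Rn R n -> R) (eta p Delta sg : R).
Local Notation D := (cell c).
Local Notation vol d := (box_volume d.1 d.2).
Hypotheses (nc : proper_cell c) (eta0 : 0 < eta) (p1 : 1 < p) (Delta1 : 1 <= Delta)
  (sg2 : sg = 1 \/ sg = -1).
Hypotheses (mW : measurable_fun setT W) (Weta : forall x, D x -> eta <= W x)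
  (iW : mu.-integrable D (EFin \o W)) (iWp : mu.-integrable D (EFin \o (fun x => W x `^ p))).
Hypothesis RH : forall d, proper_cell d -> subcell d c ->
  \int[mu]_(x in cell d) (W x `^ p) <=
  Delta * (vol d * (\int[mu]_(x in cell d) W x / vol d) `^ p).

Local Notation T := (vol c).
Local Notation F := (part c W sg id).
Local Notation P := (part c W sg (powp eta p)).
Local Notation level := (quantile_level c W sg).
Let v x := sg * W x.

Let mD : measurable D. Proof. exact: measurable_cell. Qed.

Let muD : mu D = T%:E. Proof. exact: lebesgue_cbox. Qed.

Let Dfin : (mu D < +oo)%E. Proof. by rewrite muD ltry. Qed.

Let mv : measurable_fun setT v. Proof. by apply: measurable_funM. Qed.

Let fmuD : fine (mu D) = T. Proof. by rewrite muD. Qed.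

Let T0 : 0 < T.
Proof. exact: box_volume_gt0. Qed.

Let sgK x : sg * (sg * x) = x.
Proof. by rewrite mulrA; case: sg2 => ->; rewrite ?mulrNN !mul1r. Qed.

Let sgn : `|sg| = 1. Proof. by case: sg2 => ->; rewrite ?normrN normr1. Qed.

(** Jensen's inequality on the part, from the tangent at its mean. The tangent is below the power at
    [l] as well, which gives [b <= 0] and lets [t] replace the measure of [S]. *)
Lemma P_ge (t : R) : 0 < t -> t < T -> t * (F t / t) `^ p <= P t.
Proof.
move=> t0 tM; have le := level_ge sg2 mW Weta t0 tM; have Ae := mean_ge sg2 mW Weta iW t0 tM.
have FA : F t = t * (F t / t) by rewrite mulrCA divff ?mulr1// gt_eqF.
have := FE sg2 iW t; have := PE eta0 p1 sg2 mW Weta iWp t0 tM.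
have : tail mu D v (quantile mu D v t) <= t by apply: tail_quantile => //; rewrite fmuD.
rewrite -/v.
set S := superlevel _ _ _; rewrite -[tail _ _ _ _]/(fine (mu S)).
have mS : measurable S by exact: measurable_superlevel.
have SD : S `<=` D by move=> x [].
move: le Ae FA; move: (level t) (F t / t) => l A le Ae -> St -> /eqP.
have A0 : 0 < A by exact: lt_le_trans Ae.
rewrite addrC -subr_eq => /eqP/esym FEt.
have i1 : mu.-integrable D (EFin \o (fun x => (W x - l) * \1_S x)).
  apply: integrable_indicator => //.
  by have := integrable_affine (- l) 1 iW; apply: eq_integrable => // x _ /=; rewrite mul1r.
have i2 : mu.-integrable D (EFin \o (fun x => (W x `^ p - l `^ p) * \1_S x)).
  apply: integrable_indicator => //.
  by have := integrable_affine (- l `^ p) 1 iWp; apply: eq_integrable => // x _ /=; rewrite mul1r.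
pose k := p * A `^ (p - 1); pose b := A `^ p + k * (l - A) - l `^ p.
have b0 : b <= 0 by rewrite subr_le0; apply: powR_tangent => //; rewrite (le_trans (ltW eta0)).
have i3 : mu.-integrable D (EFin \o (fun x => k * ((W x - l) * \1_S x))).
  by have := integrable_affine 0 k i1; apply: eq_integrable => // x _ /=; rewrite addr0.
have i4 := integrable_indic_fin mD Dfin b mS.
have : \int[mu]_(x in D) (k * ((W x - l) * \1_S x) + b * \1_S x) <=
    \int[mu]_(x in D) ((W x `^ p - l `^ p) * \1_S x).
  apply: le_Rintegral => //.
    by have := integrableD mD i3 i4; apply: eq_integrable => // x _ /=; rewrite EFinD.
  move=> x Dx; rewrite mulrA -mulrDl ler_wpM2r ?indicE ?ler0n// /b.
  have W0 : 0 <= W x by rewrite (le_trans (ltW eta0))// Weta.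
  have := powR_tangent p1 A0 W0; rewrite -/k; lra.
rewrite RintegralD// RintegralZl// FEt Rintegral_indic_fin//.
have : b * t <= b * fine (mu S) by rewrite ler_wnM2l.
rewrite /b; set X := Rintegral _ _ _.
by move: (fine _) => m' h1 h2; lra.
Qed.

Lemma part_right_diff (G : R -> R) (t : R) : {homo G : x y / x <= y} ->
  mu.-integrable D (EFin \o (fun x => G (W x))) -> {for level t, continuous G} ->
  0 < t -> t < T -> right_diff (part c W sg G) t (G (level t)).
Proof.
move=> Gh Gi cG t0; rewrite -fmuD => tM.
rewrite (_ : G (level t) = sg * sgconj sg G (quantile mu D v t)); last by rewrite /sgconj sgK.
apply: right_diffZ; apply: (top_integral_right_diff mD Dfin mv (sgconj_homo sg2 Gh) (integrable_sgconj sg2 Gi) _ t0 tM).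
apply: cvgM; first exact: cvg_cst.
apply: (cvg_comp ( *%R sg) G _ cG).
by apply: cvgM; [exact: cvg_cst|exact: cvg_id].
Qed.

Lemma part_within (G : R -> R) (t0 t1 : R) : {homo G : x y / x <= y} ->
  mu.-integrable D (EFin \o (fun x => G (W x))) -> 0 < t0 -> t1 < T ->
  {within `[t0, t1], continuous (part c W sg G)}.
Proof.
move=> Gh Gi t00; rewrite -fmuD => t1M.
have [L L0 HL] := top_integral_lipschitz mD Dfin mv (sgconj_homo sg2 Gh) (integrable_sgconj sg2 Gi) t00 t1M.
apply: (lipschitz_within L0) => s t t0s st tt1.
by rewrite /part -mulrBr normrM sgn mul1r; exact: HL.
Qed.

Let ipow : mu.-integrable D (EFin \o (fun x => powp eta p (W x))).
Proof.
by apply: eq_integrable iWp => // x /[!inE] Dx /=; rewrite (powp_W p Weta).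
Qed.

Section moment.
Variables (r a : R) (g : R -> R) (y0 : R).
Hypotheses (ap : 0 < 1 + a * p) (ar : 0 < 1 + a * r) (a1 : 0 < 1 + a)
  (Deltaa : Delta <= power_ratio a p)
  (cases : [/\ sg = 1, p < r & a < 0] \/ [/\ sg = -1, r < 0 & 0 < a]).
Hypotheses (gh : {homo g : x y / x <= y}) (cg : continuous g)
  (gle : forall y, 0 <= g y <= g y0) (gr : forall s, eta <= s -> g (sg * s) <= s `^ r).

Let gi : mu.-integrable D (EFin \o (g \o v)).
Proof.
apply: le_integrable (integrable_cst_fin mD Dfin (g y0)) => //.
  apply/measurable_EFinP; apply: measurableT_comp.
    exact: continuous_measurable_fun.
  exact: measurable_funTS.
move=> x _ /=; have /andP[h1 h2] := gle (v x).
by rewrite lee_fin !ger0_norm// (le_trans h1).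
Qed.

(** [g] is a bounded substitute for the r-th power, as a function of [sg * W]. Boundedness makes
    [Q t0] small for small [t0], and [growth_bound] is nonnegative there, so [growth_estimate] from
    [t0] to [t1] bounds [Q t1]. The hypothesis on [P] then lets the term with [gap_coef] be
    dropped. *)
Lemma moment_bound_at (t1 : R) : 0 < t1 -> t1 < T ->
  \int[mu]_(x in D) g (sg * W x) <= power_ratio a r * T * (F t1 / t1) `^ r.
Proof.
move=> t10 t1M; pose Q := top_integral mu D v g.
have c0 : 0 < gap_coef p r a by apply: gap_coef_gt0 => //; case: cases => [[_ ? _]|[_ ? _]]; [left|right].
have B0 : 0 <= g y0 by have /andP[h1 h2] := gle y0.
have K0 := power_ratio_gt0 a1 ar.
have F0 t : 0 < t -> t < T -> 0 < F t.
  by move=> h1 h2; apply: lt_le_trans (F_ge sg2 mW Weta iW h1 h2); rewrite mulr_gt0.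
have RHt t : 0 < t -> t < T -> P t <= power_ratio a p * (t * (F t / t) `^ p).
  move=> h1 h2; apply: le_trans (rearranged_RH nc eta0 p1 Delta1 sg2 mW Weta iW iWp RH h1 h2) _.
  by rewrite ler_wpM2r// mulr_ge0 ?powR_ge0// ltW.
(* By Jensen's inequality [P_ge] and the case [v = 1] of [power_tangent_gap], the last factor in
   [growth_boundE] is at least 1. *)
have GB0 t : 0 < t -> t < T -> 0 <= growth_bound p r a t (F t) (P t).
  move=> h1 h2; rewrite growth_boundE//; last exact: F0.
  have A0 : 0 < F t / t by rewrite divr_gt0// F0.
  rewrite mulr_ge0//; first by rewrite mulr_ge0 ?powR_ge0// ltW.
  have u1 : 1 <= P t / (t * (F t / t) `^ p).
    by rewrite ler_pdivlMr ?mul1r ?P_ge// mulr_gt0// powR_gt0.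
  have case1 : [/\ p < r, a < 0 & (1 : R) <= 1] \/ [/\ r < 0, 0 < a & (1 : R) <= 1].
    by case: cases => [[_ ? ?]|[_ ? ?]]; [left|right]; split.
  have := power_tangent_gap p1 ler01 ap ar a1 case1; rewrite !powR1 => gap.
  have h3 : gap_coef p r a * 1 <= gap_coef p r a * (P t / (t * (F t / t) `^ p)).
    by rewrite ler_pM2l.
  by apply: le_trans (_ : power_ratio a r - gap_coef p r a * (power_ratio a p - 1) <= _); lra.
have Q1 : Q t1 <= growth_bound p r a t1 (F t1) (P t1).
  apply/ler_addgt0Pr => e e0.
  (* Small enough for [Q t0 <= t0 * g y0 <= e]. *)
  pose t0 := Num.min t1 (e / (g y0 + 1)).
  have B1 : 0 < g y0 + 1 by rewrite ltr_wpDl.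
  have t00 : 0 < t0 by rewrite lt_min t10 divr_gt0.
  have t01 : t0 <= t1 by rewrite ge_min lexx.
  have Qt0 : Q t0 <= e.
    have t0M : t0 < fine (mu D) by rewrite fmuD (le_lt_trans t01).
    apply: le_trans (top_integral_le mD Dfin mv gh gi y0 t00 t0M) _.
    have -> : excess mu D v g (g y0) = 0.
      rewrite /excess (@eq_Rintegral _ _ _ mu _ (cst 0)); first by rewrite Rintegral_cst// mul0r.
      by move=> x _; rewrite max_r// subr_le0; have /andP[] := gle (v x).
    rewrite addr0; apply: le_trans (_ : t0 * (g y0 + 1) <= _).
      by rewrite ler_pM2l// lerDl.
    by rewrite -ler_pdivlMr// ge_min lexx orbT.
  have := @growth_estimate _ p r a p1 ap ar a1 t0 t1 level (g \o quantile mu D v) F P Q t00 t01.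
  move=> H; have : Q t1 - Q t0 <= growth_bound p r a t1 (F t1) (P t1) -
      growth_bound p r a t0 (F t0) (P t0).
    apply: H.
    - have lm t : t0 <= t -> t < t1 -> sg * level t <= sg * (F t / t).
        by move=> h1 h2; apply: level_mean => //; [exact: lt_le_trans h1|exact: lt_trans t1M].
      case: cases => [[s1 ? ?]|[s1 ? ?]]; [left|right]; split => // t h1 h2;
        by have := lm t h1 h2; rewrite s1 ?mul1r// !mulN1r lerN2.
    - exact: (part_within _ iW).
    - by apply: part_within => //; exact: powp_homo.
    - move: t1M; rewrite -fmuD => t1M.
      have [L L0 HL] := top_integral_lipschitz mD Dfin mv gh gi t00 t1M.
      exact: (lipschitz_within L0).
    - move=> t h1 h2; have t0' := lt_le_trans t00 h1; have tM := lt_trans h2 t1M.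
      have le := level_ge sg2 mW Weta t0' tM; have l0 := lt_le_trans eta0 le.
      have lp : level t `^ p = powp eta p (level t) by rewrite /powp max_r.
      split.
      + apply: (part_right_diff _ iW) => //; exact: cvg_id.
      + rewrite lp; apply: part_right_diff => //; first exact: powp_homo.
        have ms : Num.max eta s @[s --> level t] --> Num.max eta (level t).
          apply: (@continuous_max _ _ (cst eta) id); [exact: cvg_cst|exact: cvg_id].
        by apply: cvg_powRf ms; rewrite lt_max eta0.
      + by apply: (top_integral_right_diff mD Dfin mv gh gi _ t0') => //=; [exact: cg|rewrite [fine _]fmuD].
      + exact: ltW.
      + by have := gr le; rewrite /quantile_level sgK.
    - by move=> t h1 h2; have h3 := le_lt_trans h2 t1M; have h4 := lt_le_trans t00 h1; split; [exact: F0|exact: RHt].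
  have := GB0 t0 t00 (le_lt_trans t01 t1M).
  rewrite lerBlDr => g0 /le_trans; apply.
  by rewrite -addrA lerD2l addrC lerBlDr ler_wpDr.
have Q2 : Q t1 <= t1 * (F t1 / t1) `^ r * power_ratio a r.
  apply: le_trans Q1 _; rewrite growth_boundE ?F0//.
  rewrite ler_wpM2l ?mulr_ge0 ?powR_ge0 ?(ltW t10)//.
  rewrite lerBlDr lerDl mulr_ge0 ?(ltW c0)// subr_ge0 ler_pdivrMr ?RHt//.
  by rewrite mulr_gt0// powR_gt0// divr_gt0// F0.
move: (t1M); rewrite -fmuD => t1M'.
have := top_integral_ge mD Dfin gi t10 t1M'; rewrite fmuD -/Q => h.
rewrite -(ler_pM2l t10); apply: le_trans h _.
apply: le_trans (_ : T * (t1 * (F t1 / t1) `^ r * power_ratio a r) <= _).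
  by rewrite ler_pM2l.
by rewrite le_eqVlt; apply/orP; left; apply/eqP; ring.
Qed.

Local Notation m := (\int[mu]_(x in D) W x / T).

(** The bounds hold for parts of measure [t < T] and are carried to the whole cell by [t] close to
    [T]. One side is [F_total]; on the other the integral over the omitted portion is small because
    W^p is integrable. *)
Lemma mean_cvg (e : R) : 0 < e -> exists t, [/\ 0 < t, t < T & `|F t / t - m| <= e].
Proof.
move=> e0; pose C := \int[mu]_(x in D) (W x `^ p).
have C0 : 0 <= C by apply: Rintegral_ge0 => x _; exact: powR_ge0.
have W0 x : D x -> 0 <= W x by move=> /Weta; apply: le_trans; exact: ltW.
have m0 : 0 <= m by rewrite divr_ge0 ?(ltW T0)//; apply: Rintegral_ge0.
have WT : \int[mu]_(x in D) W x = m * T by rewrite divfK// gt_eqF.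
have p10 : 0 < p - 1 by rewrite subr_gt0.
(* [q] makes the integral of W^p / q at most [e * T / 4]; [N] is the height with N^(1 - p) = 1 / q,
   so that W <= W^p / q where [W > N]. *)
pose q := (4 * (C + 1)) / (e * T); have C1 : 0 < C + 1 by rewrite ltr_wpDl.
have q0 : 0 < q by rewrite divr_gt0 ?mulr_gt0.
pose N := q `^ (p - 1)^-1; have N0 : 0 < N by rewrite powR_gt0.
have NE : N `^ (1 - p) = q^-1.
  by rewrite -opprB powRN -powRrM mulVf ?gt_eqF// powRr1// ltW.
pose k := N + m + 1; have k0 : 0 < k by rewrite ltr_wpDl// addr_ge0// ltW.
(* At least [T / 2], so that [e * t] absorbs an error [e * T / 2], and close enough to [T] for
   [(T - t) * k <= e * T / 4]. *)
pose t := Num.max (T / 2) (T - e * T / (4 * k)).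
have tT : t < T.
  rewrite gt_max ltr_pdivrMr// mulr_natr mulr2n ltrDl T0 ltrBlDr ltrDl.
  by rewrite divr_gt0 ?mulr_gt0.
have t2 : T / 2 <= t by rewrite le_max lexx.
have t0 : 0 < t by apply: lt_le_trans t2; rewrite divr_gt0.
have Tt : (T - t) * k <= e * T / 4.
  have : T - t <= e * T / (4 * k) by rewrite lerBlDl -lerBlDr le_max lexx orbT.
  rewrite -(ler_pM2r k0) => /le_trans; apply.
  by rewrite le_eqVlt; apply/orP; left; apply/eqP; field; rewrite gt_eqF.
exists t; split => //.
have low : sg * m <= sg * (F t / t).
  have := F_total sg2 iW t0 tT; rewrite {1}WT.
  have -> : sg * (t * (m * T)) = (t * T) * (sg * m) by ring.
  have -> : sg * (T * F t) = (t * T) * (sg * (F t / t)) by field; rewrite gt_eqF.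
  by rewrite ler_pM2l ?mulr_gt0//; rewrite mulfK// gt_eqF.
have up : sg * F t <= sg * (m * T) + (T - t) * N + q^-1 * C.
  have tM : t < fine (mu D) by rewrite fmuD.
  rewrite /part sgK.
  apply: le_trans (top_integral_le mD Dfin mv (sgconj_homo sg2 (G := id) _)
    (integrable_sgconj sg2 (G := id) iW) (- N) t0 tM) _ => //.
  rewrite {1 3}/sgconj sgK.
  suff : excess mu D v (sgconj sg id) (- N) <= sg * (m * T) + T * N + q^-1 * C.
    move=> h; rewrite mulrN addrC lerBlDr; apply: le_trans h _.
    by rewrite mulrBl le_eqVlt; apply/orP; left; apply/eqP; ring.
  have i5 : mu.-integrable D (EFin \o (fun x => sg * W x + N)) by exact: integrable_affine.
  have i6 : mu.-integrable D (EFin \o (fun x => q^-1 * W x `^ p)).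
    by have := integrable_affine 0 q^-1 iWp; apply: eq_integrable => // x _ /=; rewrite addr0.
  apply: le_trans (_ : \int[mu]_(x in D) ((sg * W x + N) + q^-1 * W x `^ p) <= _).
    apply: le_Rintegral => //.
    - apply: integrable_excess => //; exact: (integrable_sgconj sg2 (G := id) iW).
    - by have := integrableD mD i5 i6; apply: eq_integrable => // x _ /=; rewrite EFinD.
    - move=> x Dx; rewrite /sgconj sgK /v opprK ge_max lerDl mulr_ge0 ?powR_ge0 ?invr_ge0 ?(ltW q0)//=.
      have Wx0 : 0 < W x by exact: lt_le_trans (Weta Dx).
      case: sg2 => ->.
        by rewrite mul1r addr_ge0 ?mulr_ge0 ?powR_ge0 ?invr_ge0 ?(ltW q0)// addr_ge0 ?W0// ltW.
      rewrite mulN1r -NE; have [WN|NW] := leP (W x) N.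
        by rewrite addr_ge0 ?mulr_ge0 ?powR_ge0// addrC subr_ge0.
      suff : W x <= N `^ (1 - p) * W x `^ p.
        by move=> h; rewrite addrAC addr_ge0 ?(ltW N0)// addrC subr_ge0.
      have -> : N `^ (1 - p) * W x `^ p = W x * (W x / N) `^ (p - 1).
        rewrite powRM ?invr_ge0 ?(ltW N0) ?(ltW Wx0)// mulrA.
        rewrite (mulr_powRB1 (ltW Wx0) (lt_trans ltr01 p1)) mulrC; congr (_ * _).
        by rewrite -(powR_inv1 (ltW N0)) -powRrM mulN1r opprB.
      rewrite ler_peMr ?(ltW Wx0)//; apply: le_trans (_ : 1 `^ (p - 1) <= _); first by rewrite powR1.
      apply: (ge0_ler_powR (ltW p10)); rewrite ?nnegrE//.
        by rewrite divr_ge0 ?(ltW N0) ?(ltW Wx0).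
      by rewrite ler_pdivlMr// mul1r ltW.
  rewrite RintegralD// RintegralD//; last 2 first.
  - by have := integrable_affine 0 sg iW; apply: eq_integrable => // x _ /=; rewrite addr0.
  - exact: integrable_cst_fin.
  rewrite !RintegralZl// Rintegral_cell_cst -WT -/C [N * _]mulrC.
  exact: lexx.
have qC : q^-1 * C <= e * T / 4.
  rewrite invf_div mulrAC ler_pdivrMr ?mulr_gt0//.
  have -> : e * T / 4 * (4 * (C + 1)) = e * T * (C + 1) by field.
  by rewrite ler_pM2l ?mulr_gt0// lerDl.
have {}up : sg * (F t / t) <= sg * m + e.
  rewrite mulrA ler_pdivrMr//; apply: le_trans up _.
  have h1 : sg * m * (T - t) <= m * (T - t).
    apply: ler_wpM2r; first by rewrite subr_ge0 ltW.
    by rewrite (le_trans (ler_norm _))// normrM sgn mul1r ger0_norm.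
  have h2 : e * (T / 2) <= e * t by rewrite ler_pM2l.
  move: Tt; rewrite /k; move: m qC h1 h2 => m' qC h1 h2 h3.
  have h4 : 0 <= T - t by rewrite subr_ge0 ltW.
  move: (q^-1 * C) qC => u qC.
  lra.
rewrite ler_norml; case: sg2 low up => -> ; rewrite ?mul1r ?mulN1r => low up; apply/andP; split; lra.
Qed.

Lemma truncated_moment_bound :
  \int[mu]_(x in D) g (sg * W x) <= power_ratio a r * T * m `^ r.
Proof.
have m0 : 0 < m.
  rewrite divr_gt0//; apply: lt_le_trans (_ : eta * T <= _); first by rewrite mulr_gt0.
  rewrite -Rintegral_cell_cst; apply: le_Rintegral => //; exact: integrable_cst_fin.
have K0 := power_ratio_gt0 a1 ar.
apply/ler_addgt0Pr => e e0.
have KT : 0 < power_ratio a r * T by rewrite mulr_gt0.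
have cm : s `^ r @[s --> m] --> m `^ r by apply: (cvg_powRf _ (f := id)) => //; exact: cvg_id.
have /cvgrPdist_le/(_ _ (divr_gt0 e0 KT))/nbhs_ballP[d /= d0 Hd] := cm.
have [t [t0 tT At]] := mean_cvg (divr_gt0 d0 (ltr0Sn R 1)).
apply: le_trans (moment_bound_at t0 tT) _.
have : ball m d (F t / t).
  by rewrite /ball/= distrC (le_lt_trans At)// ltr_pdivrMr// mulr_natr mulr2n ltrDl.
move/Hd => /=; rewrite distrC ler_distl => /andP[_ h].
have : power_ratio a r * T * (F t / t) `^ r <= power_ratio a r * T * (m `^ r + e / (power_ratio a r * T)).
  by rewrite ler_pM2l.
by rewrite mulrDr [X in _ + X]mulrC divfK// gt_eqF.
Qed.

End moment.
End moment_bounds.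

Lemma integral_le_lim d (T : measurableType d) (R : realType)
    (mu : {measure set T -> \bar R}) (D : set T) (g : nat -> T -> \bar R)
    (f : T -> \bar R) (C : \bar R) :
  measurable D -> (forall k, measurable_fun D (g k)) ->
  (forall k x, D x -> (0 <= g k x)%E) ->
  (forall x, D x -> nondecreasing_seq (g^~ x)) ->
  (forall x, D x -> g k x @[k --> \oo] --> f x) ->
  (forall k, (\int[mu]_(x in D) g k x <= C)%E) ->
  (\int[mu]_(x in D) f x <= C)%E.
Proof.
move=> mD mg g0 nd gf gC.
have -> : (\int[mu]_(x in D) f x = \int[mu]_(x in D) limn (g^~ x))%E.
  by apply: eq_integral => x /set_mem Dx; apply/esym/cvg_lim => //; exact: gf.
rewrite monotone_convergence//; apply: lime_le; last exact: nearW.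
apply: ereal_nondecreasing_is_cvgn => k l kl; apply: ge0_le_integral => //.
- by move=> x Dx; exact: g0.
- by move=> x Dx; exact: nd.
Qed.

(** Convexity, with [x + eta] written as [A + eta] times a convex combination of [x / A] and 1.
    Integrating it with a suitable [A] proves Minkowski's inequality for [w + eta]. *)
Lemma powR_shift (R : realType) (p x A eta : R) : 1 < p -> 0 <= x -> 0 < A -> 0 < eta ->
  (x + eta) `^ p <= (A + eta) `^ p * (A / (A + eta) * (x / A) `^ p + eta / (A + eta)).
Proof.
move=> p1 x0 A0 e0; have S0 : 0 < A + eta by rewrite addr_gt0.
pose u := A / (A + eta).
have u0 : 0 <= u by rewrite divr_ge0// ltW.
have u1 : u < 1 by rewrite ltr_pdivrMr// mul1r ltrDl.
have uE : 1 - u = eta / (A + eta) by rewrite /u; field; rewrite gt_eqF.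
have := powR_convex p1 (divr_ge0 x0 (ltW A0)) (ltr01) u0 u1.
rewrite powR1 !mulr1 uE -/u => h.
have -> : x + eta = (A + eta) * (u * (x / A) + eta / (A + eta)).
  by rewrite /u; field; rewrite !gt_eqF.
rewrite powRM ?(ltW S0)//; last by rewrite addr_ge0 ?mulr_ge0 ?invr_ge0 ?(ltW A0) ?(ltW S0) ?(ltW e0).
by rewrite ler_pM2l ?powR_gt0.
Qed.

Lemma powR_homo (R : realType) (r x y : R) : 0 <= r -> 0 <= x -> x <= y -> x `^ r <= y `^ r.
Proof.
by move=> r0 x0 xy; apply: ge0_ler_powR; rewrite ?nnegrE// (le_trans x0).
Qed.

Lemma powR_anti (R : realType) (r x y : R) : r < 0 -> 0 < x -> x <= y -> y `^ r <= x `^ r.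
Proof.
move=> r0 x0 xy; have y0 := lt_le_trans x0 xy.
rewrite -(opprK r) !(powRN _ (- r)) lef_pV2 ?posrE ?powR_gt0//.
by apply: powR_homo => //; [rewrite oppr_ge0 ltW|exact: ltW].
Qed.

Lemma cvg_addV (R : realType) (m r : R) : 0 < m ->
  ((m + k.+1%:R^-1) `^ r) @[k --> \oo] --> m `^ r.
Proof.
move=> m0; apply: cvg_powRf => //; rewrite -[X in _ --> X]addr0.
by apply: cvgD; [exact: cvg_cst|exact: cvg_harmonic].
Qed.

(** * Moments of general weights, through a shift by a constant *)

Section shifted_moments.
Context {R : realType} {n : nat}.
Local Notation mu := (@lebesgue R n).
Variables (c : 'rV[R]_n.+1 * 'rV[R]_n.+1) (w : Rn R n -> R) (p delta r a : R).
Local Notation D := (cell c).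
Local Notation vol d := (box_volume d.1 d.2).
Hypotheses (nc : proper_cell c) (p1 : 1 < p) (delta1 : 1 <= delta).
Hypotheses (mw : measurable_fun setT w) (w0 : forall x, 0 <= w x)
  (iw : mu.-integrable D (EFin \o w)) (iwp : mu.-integrable D (EFin \o (fun x => w x `^ p))).
Hypothesis RH : forall d, proper_cell d -> subcell d c ->
  0 < \int[mu]_(x in cell d) w x /\
  \int[mu]_(x in cell d) (w x `^ p) <=
  delta `^ p * (vol d * (\int[mu]_(x in cell d) w x / vol d) `^ p).
Hypotheses (ap : 0 < 1 + a * p) (ar : 0 < 1 + a * r) (a1 : 0 < 1 + a)
  (deltaa : delta `^ p <= power_ratio a p).
Local Notation m := (\int[mu]_(x in D) w x / vol c).

Let mD : measurable D. Proof. exact: measurable_cell. Qed.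

Let muD : mu D = (vol c)%:E. Proof. exact: lebesgue_cbox. Qed.

Let Dfin : (mu D < +oo)%E. Proof. by rewrite muD ltry. Qed.

Let m0 : 0 < m.
Proof. by apply: divr_gt0; [have [] := RH nc (subcell_refl c)|exact: box_volume_gt0]. Qed.

Let d1 : 1 <= delta `^ p.
Proof.
rewrite -[leLHS](_ : 1 `^ p = 1); last by rewrite powR1.
by apply: powR_homo => //; rewrite ltW// (lt_trans ltr01).
Qed.

Section shift.
Variable eta : R.
Hypothesis eta0 : 0 < eta.
Let W x := w x + eta.

Let mW : measurable_fun setT W. Proof. by apply: measurable_funD. Qed.

Let Weta x : D x -> eta <= W x. Proof. by rewrite lerDr. Qed.

Let iW : mu.-integrable D (EFin \o W).
Proof.
by have := integrable_affine eta 1 iw; apply: eq_integrable => // x _ /=; rewrite mul1r.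
Qed.

Let ishift (A : R) : 0 < A -> mu.-integrable D (EFin \o
  (fun x => (A + eta) `^ p * (A / (A + eta) * (w x / A) `^ p + eta / (A + eta)))).
Proof.
move=> A0; have S0 : 0 < A + eta by rewrite addr_gt0.
pose u := (A + eta) `^ p * (A / (A + eta) * A `^ (- p)).
have := integrable_affine ((A + eta) `^ p * (eta / (A + eta))) u iwp.
apply: eq_integrable => // x _ /=; congr EFin.
rewrite powRM ?invr_ge0 ?(ltW A0)// -(powR_inv1 (ltW A0)) -powRrM mulN1r /u.
by ring.
Qed.

Let iWp : mu.-integrable D (EFin \o (fun x => W x `^ p)).
Proof.
apply: le_integrable (ishift ltr01) => //.
  apply/measurable_EFinP; apply: measurable_funTS.
  exact: (measurableT_comp (measurable_powR p) mW).
move=> x Dx /=; rewrite lee_fin (ger0_norm (powR_ge0 _ _)).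
by apply: le_trans (ler_norm _); exact: powR_shift.
Qed.

(** A shift keeps the reverse Hoelder constant. For [A = delta * M], with [M] the mean of [w], the
    mean of (w / A)^p is at most 1, so [powR_shift] bounds the mean of (w + eta)^p by (A + eta)^p,
    and [A + eta <= delta * (M + eta)]. *)
Let RHW d : proper_cell d -> subcell d c ->
  \int[mu]_(x in cell d) (W x `^ p) <=
  delta `^ p * (vol d * (\int[mu]_(x in cell d) W x / vol d) `^ p).
Proof.
move=> nd dc; have dD := subcell_subset dc; have md : measurable (cell d) by exact: measurable_cell.
have [i0 RHd] := RH nd dc; have v0 := box_volume_gt0 nd.
have del0 := lt_le_trans ltr01 delta1.
have -> : \int[mu]_(x in cell d) W x = \int[mu]_(x in cell d) w x + eta * vol d.
  rewrite RintegralD//; [|exact: integrableS iw|].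
    by rewrite Rintegral_cell_cst.
  by apply: (integrableS mD md dD); exact: integrable_cst_fin.
rewrite mulrDl mulfK ?gt_eqF//.
set M := _ / vol d; have M0 : 0 < M by rewrite divr_gt0.
pose A := delta * M; have A0 : 0 < A by rewrite mulr_gt0.
have S0 : 0 < A + eta by rewrite addr_gt0.
have iq : mu.-integrable (cell d) (EFin \o (fun x => (w x / A) `^ p)).
  have := integrable_affine 0 (A `^ (- p)) iwp; move=> /(integrableS mD md dD).
  apply: eq_integrable => // x _ /=; congr EFin.
  by rewrite powRM ?invr_ge0 ?(ltW A0)// -(powR_inv1 (ltW A0)) -powRrM mulN1r addr0 mulrC.
have I1 : \int[mu]_(x in cell d) ((w x / A) `^ p) <= vol d.
  have -> : \int[mu]_(x in cell d) ((w x / A) `^ p) = A `^ (- p) * \int[mu]_(x in cell d) (w x `^ p).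
    rewrite -RintegralZl//; last exact: (integrableS mD md dD).
    apply: eq_Rintegral => x _.
    by rewrite powRM ?invr_ge0 ?(ltW A0)// -(powR_inv1 (ltW A0)) -powRrM mulN1r mulrC.
  rewrite powRN mulrC ler_pdivrMr ?powR_gt0//; apply: le_trans RHd _.
  by rewrite -/M /A powRM ?(ltW del0) ?(ltW M0)// mulrCA.
have cstd (k : R) : mu.-integrable (cell d) (EFin \o cst k).
  by apply: (integrableS mD md dD); exact: integrable_cst_fin.
apply: le_trans (_ : (A + eta) `^ p * vol d <= _).
  have isum : mu.-integrable (cell d) (EFin \o (fun x => A / (A + eta) * (w x / A) `^ p + eta / (A + eta))).
    have := integrableD md (integrableZl md (A / (A + eta)) iq) (cstd (eta / (A + eta))).
    by apply: eq_integrable => // x _ /=; rewrite EFinD EFinM.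
  apply: le_trans (_ : \int[mu]_(x in cell d)
      ((A + eta) `^ p * (A / (A + eta) * (w x / A) `^ p + eta / (A + eta))) <= _).
    apply: le_Rintegral => //.
    - exact: (integrableS mD md dD).
    - by have := ishift A0; exact: (integrableS mD md dD).
    - by move=> x _; exact: powR_shift.
  rewrite RintegralZl// ler_pM2l ?powR_gt0//.
  have iqZ : mu.-integrable (cell d) (EFin \o (fun x => A / (A + eta) * (w x / A) `^ p)).
    by have := integrableZl md (A / (A + eta)) iq; apply: eq_integrable => // x _ /=; rewrite EFinM.
  rewrite (RintegralD md iqZ (cstd _)).
  rewrite RintegralZl// Rintegral_cell_cst.
  have h : A / (A + eta) * \int[mu]_(x in cell d) ((w x / A) `^ p) <= A / (A + eta) * vol d.
    by rewrite ler_pM2l// divr_gt0.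
  apply: le_trans (lerD h (lexx _)) _.
  by rewrite -mulrDl -mulrDl divff ?mul1r// gt_eqF.
rewrite mulrCA mulrC ler_pM2l// -powRM ?(ltW del0)//; last by rewrite addr_ge0// ltW.
have p0 : 0 <= p by rewrite ltW// (lt_trans ltr01).
apply: (powR_homo p0 (ltW S0)).
by rewrite mulrDr lerD2l ler_peMl// ltW.
Qed.

Let WE : \int[mu]_(x in D) W x / vol c = m + eta.
Proof.
rewrite RintegralD//; last exact: integrable_cst_fin.
by rewrite Rintegral_cell_cst mulrDl mulfK// gt_eqF// box_volume_gt0.
Qed.

Lemma shifted_negative_moment : r < 0 -> 0 < a ->
  \int[mu]_(x in D) (w x + eta) `^ r <= power_ratio a r * vol c * (m + eta) `^ r.
Proof.
move=> r0 a0; pose g (y : R) := Num.max eta (- y) `^ r.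
have cs : [/\ (-1 : R) = 1, p < r & a < 0] \/ [/\ (-1 : R) = -1, r < 0 & 0 < a] by right.
have gh : {homo g : x y / x <= y}.
  move=> x y xy; apply: powR_anti => //; first by rewrite lt_max eta0.
  by rewrite ge_max !le_max lexx lerN2 xy orbT.
have cg : continuous g.
  move=> y; apply: cvg_powRf; first by rewrite lt_max eta0.
  by apply: (@continuous_max _ _ (cst eta) -%R); [exact: cvg_cst|exact: opp_continuous].
have gle y : 0 <= g y <= g (- eta).
  rewrite powR_ge0/=; apply: powR_anti => //; rewrite opprK maxxx// le_max lexx//.
have gr s : eta <= s -> g (-1 * s) <= s `^ r.
  by move=> es; rewrite /g mulN1r opprK max_r.
have := truncated_moment_bound nc eta0 p1 d1 (or_intror erefl) mW Weta iW iWp RHW ap ar a1 deltaa cs gh cg gle gr.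
rewrite WE; apply: le_trans; rewrite le_eqVlt; apply/orP; left; apply/eqP.
by apply: eq_Rintegral => x _; rewrite /g mulN1r opprK max_r// /W lerDr.
Qed.

(** The truncation at [M] keeps the power bounded, since finiteness of the r-th moment is part of
    what is to be proved. *)
Lemma shifted_truncated_moment (M : R) : p < r -> a < 0 -> eta <= M ->
  \int[mu]_(x in D) Num.min M (w x + eta) `^ r <= power_ratio a r * vol c * (m + eta) `^ r.
Proof.
move=> pr a0 eM; pose g (y : R) := Num.min M (Num.max eta y) `^ r.
have r0 : 0 <= r by rewrite ltW// (lt_trans _ pr)// (lt_trans ltr01).
have cs : [/\ (1 : R) = 1, p < r & a < 0] \/ [/\ (1 : R) = -1, r < 0 & 0 < a] by left.
have pos y : 0 < Num.min M (Num.max eta y) by rewrite lt_min lt_max eta0 (lt_le_trans eta0 eM).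
have gh : {homo g : x y / x <= y}.
  move=> x y xy; apply: (powR_homo r0); first exact: ltW.
  by rewrite le_min ge_min lexx/= ge_min; apply/orP; right; rewrite ge_max !le_max lexx xy orbT.
have cg : continuous g.
  move=> y; apply: cvg_powRf => //.
  apply: (@continuous_min _ _ (cst M)); first exact: cvg_cst.
  by apply: (@continuous_max _ _ (cst eta) id); [exact: cvg_cst|exact: cvg_id].
have gle y : 0 <= g y <= g M.
  rewrite powR_ge0/=; apply: (powR_homo r0); first exact: ltW.
  by rewrite (max_r eM) minxx ge_min lexx.
have gr s : eta <= s -> g (1 * s) <= s `^ r.
  move=> es; apply: (powR_homo r0); first exact: ltW.
  by rewrite mul1r max_r// ge_min lexx orbT.
have := truncated_moment_bound nc eta0 p1 d1 (or_introl erefl) mW Weta iW iWp RHW ap ar a1 deltaa cs gh cg gle gr.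
rewrite WE; apply: le_trans; rewrite le_eqVlt; apply/orP; left; apply/eqP.
by apply: eq_Rintegral => x _; rewrite /g mul1r max_r// /W lerDr.
Qed.

End shift.

Let K0 : 0 < power_ratio a r := power_ratio_gt0 a1 ar.

Lemma negative_moment : r < 0 -> 0 < a ->
  (\int[mu]_(x in D) powRe (w x) r <= (power_ratio a r * vol c * m `^ r)%:E)%E.
Proof.
move=> r0 a0.
apply: (@integral_le_lim _ _ _ mu D (fun k x => ((w x + k.+1%:R^-1) `^ r)%:E) _ _ mD).
- move=> k; apply/measurable_EFinP; apply: measurable_funTS.
  by apply: (measurableT_comp (measurable_powR r)); apply: measurable_funD.
- by move=> k x _; rewrite lee_fin powR_ge0.
- move=> x _ k l kl; rewrite lee_fin; apply: powR_anti => //; first by rewrite ltr_wpDl.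
  by rewrite lerD2l lef_pV2 ?posrE// ler_nat.
- move=> x _; rewrite /powRe r0 andbT; have [wx0|wx0] := eqVneq (w x) 0.
    (* Where [w] vanishes the shifted powers increase to [+oo], the value of [powRe] there. *)
    rewrite wx0; apply/cvgeryP; apply/cvgryPge => A.
    near=> k; rewrite add0r -(powR_inv1 (ler0n _ _)) -powRrM mulN1r.
    have A1 : 0 < `|A| + 1 by rewrite ltr_wpDl.
    have r0' : 0 < - r by rewrite oppr_gt0.
    apply: le_trans (_ : ((`|A| + 1) `^ (- r)^-1) `^ (- r) <= _).
      rewrite -powRrM mulVf ?gt_eqF// powRr1 ?(ltW A1)//.
      by rewrite (le_trans (ler_norm _))// lerDl.
    apply: (powR_homo (ltW r0') (powR_ge0 _ _)).
    apply: le_trans (_ : k%:R <= _); last by rewrite ler_nat.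
    by near: k; exact: nbhs_infty_ger.
  apply: cvg_EFin; first exact: nearW.
  by apply: cvg_addV; rewrite lt_neqAle eq_sym wx0/= w0.
- move=> k; have e0 : (0 : R) < k.+1%:R^-1 by [].
  have ik : mu.-integrable D (EFin \o (fun x => (w x + k.+1%:R^-1) `^ r)).
    apply: le_integrable (integrable_cst_fin mD Dfin (k.+1%:R^-1 `^ r)) => //.
      apply/measurable_EFinP; apply: measurable_funTS.
      by apply: (measurableT_comp (measurable_powR r)); apply: measurable_funD.
    move=> x _ /=; rewrite lee_fin !ger0_norm ?powR_ge0//.
    by apply: powR_anti => //; rewrite lerDr.
  rewrite -[leLHS]fineK; last exact: integrable_fin_num.
  rewrite lee_fin; apply: le_trans (shifted_negative_moment e0 r0 a0) _.
  rewrite ler_pM2l; last by apply: mulr_gt0; [exact: K0|exact: box_volume_gt0].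
  by apply: powR_anti => //; rewrite lerDl.
Unshelve. all: by end_near. Qed.

Lemma positive_moment : p < r -> a < 0 ->
  (\int[mu]_(x in D) (w x `^ r)%:E <= (power_ratio a r * vol c * m `^ r)%:E)%E.
Proof.
move=> pr a0; have r0 : 0 < r by rewrite (lt_trans _ pr)// (lt_trans ltr01).
apply: (@integral_le_lim _ _ _ mu D (fun k x => (Num.min k.+1%:R (w x) `^ r)%:E) _ _ mD).
- move=> k; apply/measurable_EFinP; apply: measurable_funTS.
  by apply: (measurableT_comp (measurable_powR r)); apply: measurable_minr.
- by move=> k x _; rewrite lee_fin powR_ge0.
- move=> x _ k l kl; rewrite lee_fin; apply: (powR_homo (ltW r0)).
  + by rewrite le_min w0 ler0n.
  + by rewrite le_min !ge_min ler_nat ltnS kl lexx orbT.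
- move=> x _; apply: cvg_EFin; first exact: nearW.
  apply: cvg_near_cst; near=> k; rewrite /= min_r//.
  apply: le_trans (_ : k%:R <= _); last by rewrite ler_nat.
  by near: k; exact: nbhs_infty_ger.
- move=> k.
  have imin (h : Rn R n -> R) : measurable_fun setT h -> (forall x, 0 <= h x) ->
      mu.-integrable D (EFin \o (fun x => Num.min k.+1%:R (h x) `^ r)).
    move=> mh h0; apply: le_integrable (integrable_cst_fin mD Dfin (k.+1%:R `^ r)) => //.
      apply/measurable_EFinP; apply: measurable_funTS.
      by apply: (measurableT_comp (measurable_powR r)); apply: measurable_minr.
    move=> x _ /=; rewrite lee_fin !ger0_norm ?powR_ge0//.
    by apply: (powR_homo (ltW r0)); rewrite ?le_min ?h0 ?ler0n// ge_min lexx.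
  rewrite -[leLHS]fineK; last by apply: integrable_fin_num => //; exact: imin.
  rewrite lee_fin.
  (* At a fixed truncation level the shift tends to 0; the level tends to infinity only afterwards,
     by monotone convergence. *)
  have cK : power_ratio a r * vol c * (m + j.+1%:R^-1) `^ r @[j --> \oo] -->
      power_ratio a r * vol c * m `^ r.
    by apply: cvgM; [exact: cvg_cst|exact: cvg_addV].
  apply: (cvgr_to_ge cK); apply: nearW => j.
  have e0 : (0 : R) < j.+1%:R^-1 by [].
  have e1 : (j.+1%:R^-1 : R) <= k.+1%:R.
    by apply: (@le_trans _ _ 1); rewrite ?invf_le1// ler1n.
  apply: le_trans (shifted_truncated_moment e0 pr a0 e1).
  apply: le_Rintegral => //; first exact: imin.
    by apply: imin => [|x]; [apply: measurable_funD|rewrite addr_ge0].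
  move=> x _; apply: (powR_homo (ltW r0)); first by rewrite le_min w0 ler0n.
  by rewrite le_min !ge_min lexx/= lerDl invr_ge0 ler0n orbT.
Unshelve. all: by end_near. Qed.

End shifted_moments.

(** * Bounds for the characteristics *)

Lemma measurable_powRe (R : realType) (r : R) : measurable_fun setT (fun x : R => powRe x r).
Proof.
rewrite /powRe; case: (ltP r 0) => [r0|r0]; last first.
  under eq_fun do rewrite andbF.
  by apply/measurable_EFinP; exact: measurable_powR.
under eq_fun do rewrite andbT.
apply: measurable_fun_ifT => //; last by apply/measurable_EFinP; exact: measurable_powR.
apply: (measurable_fun_bool true); rewrite setTI (_ : _ @^-1` _ = [set 0])//.
by apply/seteqP; split => x /=; [move/eqP|move=> ->; exact/eqP].
Qed.

Section averages.
Context {R : realType} {n : nat}.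
Local Notation mu := (@lebesgue R n).
Implicit Types (d c : 'rV[R]_n.+1 * 'rV[R]_n.+1) (I J : set (Rn R n)).
Local Notation vol d := (box_volume d.1 d.2).
Local Notation obox d := (box d.1 d.2 : set (Rn R n)).

Lemma rectangle_cell J : open_rectangle J -> exists2 d, proper_cell d & J = obox d.
Proof. by move=> [a [b [ab ->]]]; exists (a, b). Qed.

Lemma cell_rectangle d : proper_cell d -> open_rectangle (obox d).
Proof. by move=> nd; exists d.1, d.2. Qed.

Lemma measurable_rectangle J : open_rectangle J -> measurable J.
Proof. by move=> [a [b [_ ->]]]; exact: measurable_box. Qed.

Lemma avg_box d (f : Rn R n -> \bar R) : proper_cell d ->
  avg (obox d) f = ((\int[mu]_(x in obox d) f x) * (vol d)^-1%:E)%E.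
Proof.
move=> nd; rewrite /avg [X in (_ / X)%E]lebesgue_box inver gt_eqF//.
exact: box_volume_gt0.
Qed.

Lemma avg_EFin d (g : Rn R n -> R) : proper_cell d ->
  mu.-integrable (obox d) (EFin \o g) ->
  avg (obox d) (EFin \o g) = ((\int[mu]_(x in obox d) g x) / vol d)%:E.
Proof.
move=> nd gi; rewrite avg_box// EFinM; congr (_ * _)%E.
by rewrite fineK//; apply: integrable_fin_num => //; exact: measurable_box.
Qed.

Lemma avg_integrable d (g : Rn R n -> R) : proper_cell d -> measurable_fun (obox d) g ->
  (forall x, obox d x -> 0 <= g x) -> (avg (obox d) (EFin \o g) < +oo)%E ->
  mu.-integrable (obox d) (EFin \o g).
Proof.
move=> nd mg g0; rewrite avg_box// => h; apply/integrableP; split; first exact/measurable_EFinP.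
have -> : (\int[mu]_(x in obox d) `|(EFin \o g) x| = \int[mu]_(x in obox d) (EFin \o g) x)%E.
  by apply: eq_integral => x /set_mem Dx; rewrite /= ger0_norm// g0.
move: h; case: (\int[mu]_(x in _) _)%E => [r _|h|_]; rewrite ?ltry ?ltNyr//.
by move: h; rewrite gt0_mulye// lte_fin invr_gt0 box_volume_gt0.
Qed.

Lemma strong_RH_box (p delta : R) I w d : 1 < p -> 1 <= delta -> open_rectangle I ->
  strong_RH p delta I w -> proper_cell d -> obox d `<=` I ->
  [/\ mu.-integrable (obox d) (EFin \o w),
      mu.-integrable (obox d) (EFin \o (fun x => w x `^ p)),
      0 < \int[mu]_(x in obox d) w x &
      \int[mu]_(x in obox d) (w x `^ p) <=
      delta `^ p * (vol d * (\int[mu]_(x in obox d) w x / vol d) `^ p)].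
Proof.
move=> p1 delta1 rI [[mw w0] H] nd dI; have p0 : 0 < p by exact: lt_trans p1.
have v0 := box_volume_gt0 nd.
have [/andP[h1 h2] h3] := H (obox d) (conj (cell_rectangle nd) dI).
have mwd : measurable_fun (obox d) w.
  exact: (measurable_funS (measurable_rectangle rI) dI mw).
have iw : mu.-integrable (obox d) (EFin \o w).
  by apply: avg_integrable => // x /dI; exact: w0.
have avgw := avg_EFin nd iw.
have iwp : mu.-integrable (obox d) (EFin \o (fun x => w x `^ p)).
  apply: (avg_integrable nd).
  - exact: (measurableT_comp (measurable_powR p) mwd).
  - by move=> x _; exact: powR_ge0.
  - apply: (@lty_poweRy _ _ p^-1); first by rewrite invr_neq0// gt_eqF.
    by apply: (le_lt_trans h3); rewrite avgw -EFinM ltry.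
split => //.
  by move: h1; rewrite avgw lte_fin pmulr_lgt0// invr_gt0.
move: h3; rewrite avgw -[X in (avg _ X `^ _)%E]/(EFin \o (fun x => w x `^ p)) (avg_EFin nd iwp).
rewrite poweR_EFin -EFinM lee_fin.
set Y := _ / vol d; set A := \int[mu]_(x in _) w x / _ => h.
have Y0 : 0 <= Y by rewrite divr_ge0 ?(ltW v0)//; apply: Rintegral_ge0 => x _; exact: powR_ge0.
have A0 : 0 <= A by rewrite divr_ge0 ?(ltW v0)//; apply: Rintegral_ge0 => x /dI; exact: w0.
have : (Y `^ p^-1) `^ p <= (delta * A) `^ p by apply: powR_homo => //; [exact: ltW|exact: powR_ge0].
rewrite -powRrM mulVf ?gt_eqF// powRr1// powRM ?A0 ?(le_trans ler01 delta1)//.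
by rewrite /Y ler_pdivrMr// => h'; rewrite [vol d * _]mulrC mulrA.
Qed.

Lemma strong_RH_moments (p delta : R) I J w : 1 < p -> 1 <= delta -> open_rectangle I ->
  strong_RH p delta I w -> rectangles_in I J -> exists m : R, [/\ 0 < m,
   avg J (EFin \o w) = m%:E,
   (forall a r, 0 < a -> r < 0 -> 0 < 1 + a * r -> delta `^ p <= power_ratio a p ->
     (avg J (fun x => powRe (w x) r) <= (power_ratio a r * m `^ r)%:E)%E) &
   (forall a r, -1 < a < 0 -> p < r -> 0 < 1 + a * r -> delta `^ p <= power_ratio a p ->
     (avg J (fun x => (w x `^ r)%:E) <= (power_ratio a r * m `^ r)%:E)%E)].
Proof.
move=> p1 delta1 rI Hw [rJ JI]; have [c nc JE] := rectangle_cell rJ.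
have p0 : 0 < p by exact: lt_trans p1.
have [[mw w0] _] := Hw; have v0 := box_volume_gt0 nc.
have mJ : measurable (obox c) by exact: measurable_box.
rewrite JE in JI *.
have [iw iwp W0 _] := strong_RH_box p1 delta1 rI Hw nc JI.
(* [w] is a weight on [I] only. Its extension by 0 is measurable on the whole space and has the same
   integrals over subcells, since a cell and its open box differ by a null set. *)
pose u := w \_ (obox c).
have uE x : obox c x -> u x = w x by move=> Jx; rewrite /u patchE mem_set.
have up : (fun x => u x `^ p) = (fun x => w x `^ p) \_ (obox c).
  by apply/funext => x; rewrite /u !patchE; case: ifP => // _; rewrite powR0// gt_eqF.
have iuT : mu.-integrable setT (EFin \o u) by exact: integrable_extension.
have iupT : mu.-integrable setT (EFin \o (fun x => u x `^ p)).
  by rewrite up; exact: integrable_extension.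
have mu_ : measurable_fun setT u by case/integrableP : iuT => /measurable_EFinP.
have u0 x : 0 <= u x.
  by rewrite /u patchE; case: ifPn => // /set_mem /JI; exact: w0.
have mc : measurable (cell c) by exact: measurable_cell.
have iu := integrableS measurableT mc (@subsetT _ _) iuT.
have iup := integrableS measurableT mc (@subsetT _ _) iupT.
have sub d : subcell d c -> obox d `<=` obox c.
  move=> dc x xd i; have [h1 h2] := dc i; have /andP[h3 h4] := xd i.
  by rewrite (le_lt_trans h1 h3) (lt_le_trans h4 h2).
have intu d : subcell d c -> \int[mu]_(x in cell d) u x = \int[mu]_(x in obox d) w x.
  move=> dc; rewrite /cell (Rintegral_cbox d.1 d.2 iuT); apply: eq_Rintegral => x /set_mem xd.
  by rewrite uE//; exact: sub dc _ xd.
have intup d : subcell d c -> \int[mu]_(x in cell d) (u x `^ p) = \int[mu]_(x in obox d) (w x `^ p).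
  move=> dc; rewrite /cell (Rintegral_cbox d.1 d.2 iupT); apply: eq_Rintegral => x /set_mem xd.
  by rewrite uE//; exact: sub dc _ xd.
have RHu d : proper_cell d -> subcell d c ->
    0 < \int[mu]_(x in cell d) u x /\
    \int[mu]_(x in cell d) (u x `^ p) <=
    delta `^ p * (vol d * (\int[mu]_(x in cell d) u x / vol d) `^ p).
  move=> nd dc; rewrite intu// intup//.
  by have [] := strong_RH_box p1 delta1 rI Hw nd (subset_trans (sub _ dc) JI).
exists (\int[mu]_(x in cell c) u x / vol c); split.
- by rewrite divr_gt0//; have [] := RHu c nc (subcell_refl c).
- by rewrite avg_EFin// intu//; exact: subcell_refl.
- move=> a r a0 r0 ar da; rewrite avg_box// lee_pdivrMr ?v0// -EFinM mulrAC.
  have ap : 0 < 1 + a * p by rewrite addr_gt0 ?mulr_gt0.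
  have a1 : 0 < 1 + a by rewrite addr_gt0.
  apply: le_trans (negative_moment nc p1 delta1 mu_ u0 iu iup RHu ap ar a1 da r0 a0).
  have mpow : measurable_fun setT (fun x => powRe (u x) r).
    exact: (measurableT_comp (measurable_powRe r) mu_).
  have pow0 x : (0 <= powRe (u x) r)%E.
    by rewrite /powRe; case: ifP => // _; rewrite lee_fin powR_ge0.
  have -> : (\int[mu]_(x in obox c) powRe (w x) r = \int[mu]_(x in obox c) powRe (u x) r)%E.
    by apply: eq_integral => x /set_mem Jx; rewrite uE.
  apply: (@ge0_subset_integral _ _ _ mu _ _ mJ mc); [exact: measurable_funTS|by move=> x _|exact: subset_box_cbox].
- move=> a r /andP[aN a0] pr ar da; rewrite avg_box// lee_pdivrMr ?v0// -EFinM mulrAC.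
  have r0 : 0 < r by exact: lt_trans pr.
  have a1 : 0 < 1 + a by rewrite -ltrBlDl sub0r.
  have ap : 0 < 1 + a * p.
    by apply: lt_le_trans ar _; rewrite lerD2l ler_nM2l// ltW.
  apply: le_trans (positive_moment nc p1 delta1 mu_ u0 iu iup RHu ap ar a1 da pr a0).
  have -> : (\int[mu]_(x in obox c) (w x `^ r)%:E = \int[mu]_(x in obox c) (u x `^ r)%:E)%E.
    by apply: eq_integral => x /set_mem Jx; rewrite uE.
  apply: (@ge0_subset_integral _ _ _ mu _ _ mJ mc); last exact: subset_box_cbox.
    apply/measurable_EFinP; apply: measurable_funTS.
    exact: (measurableT_comp (measurable_powR r) mu_).
  by move=> x _; rewrite lee_fin powR_ge0.
Qed.

End averages.

Lemma le_cvg_EFin (R : realType) (x : \bar R) (u : nat -> R) (l : R) :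
  (forall k, (x <= (u k)%:E)%E) -> u @ \oo --> l -> (x <= l%:E)%E.
Proof.
case: x => [x|h|h _]; last exact: leNye.
- by move=> xu ul; rewrite lee_fin; apply: (cvgr_to_ge ul); apply: nearW => k; rewrite -lee_fin.
- by have := h 0%N; rewrite leye_eq.
Qed.

Lemma poweR_homo (R : realType) (x y : \bar R) (r : R) : 0 <= r -> (0 <= x)%E -> (x <= y)%E ->
  (x `^ r <= y `^ r)%E.
Proof.
by move=> r0 x0 xy; apply: gt0_ler_poweR; rewrite // in_itv/= ?x0 ?leey// (le_trans x0).
Qed.

(** Positive and negative parts are compared separately, which covers integrands such as log w,
    whose integral may be infinite. *)
Lemma le_integral_measurable d (T : measurableType d) (R : realType)
    (mu : {measure set T -> \bar R}) (D : set T) (f g : T -> \bar R) :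
  measurable D -> measurable_fun D f -> measurable_fun D g ->
  (forall x, D x -> (f x <= g x)%E) ->
  (\int[mu]_(x in D) f x <= \int[mu]_(x in D) g x)%E.
Proof.
move=> mD mf mg fg.
rewrite integralE [leRHS]integralE leeB//.
- apply: ge0_le_integral => //.
  + exact: measurable_funepos.
  + exact: measurable_funepos.
  + by move=> x Dx; apply: (@funepos_le _ _ D) => //; [move=> z /set_mem; exact: fg|exact/mem_set].
- apply: ge0_le_integral => //.
  + exact: measurable_funeneg.
  + exact: measurable_funeneg.
  + by move=> x Dx; apply: (@funeneg_le _ _ D) => //; [move=> z /set_mem; exact: fg|exact/mem_set].
Qed.

Lemma measurable_lne_EFin (R : realType) : measurable_fun setT (fun x : R => lne x%:E).
Proof.
rewrite (_ : (fun x : R => lne x%:E) = fun x => if x <= 0 then -oo%E else (ln x)%:E).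
  apply: measurable_fun_ifT => //; last by apply/measurable_EFinP; exact: measurable_ln.
  apply: (measurable_fun_bool true); rewrite setTI (_ : _ @^-1` _ = `]-oo, 0]%classic)//.
apply/funext => x; case: (leP x 0) => x0; first by rewrite le0_lneNy// lee_fin.
by rewrite lne_EFin.
Qed.

(** The exponent r = 1 - q' is -1 / (q - 1). Hence s^(r (q - 1)) = 1 / s and 1 + (s - 1) r = (q - s)
    / (q - 1), and the moment constant turns into that of the theorem. *)
Lemma inv_pow_Aq (R : realType) (s q : R) : 1 < s -> s < q ->
  power_ratio (s - 1) (1 - conj_exponent q) `^ (q - 1) = s^-1 * ((q - 1) / (q - s)) `^ (q - 1).
Proof.
move=> s1 sq; have q1 : 0 < q - 1 by rewrite subr_gt0 (lt_trans s1).
have q10 : q - 1 != 0 by rewrite gt_eqF.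
have qs : 0 < q - s by rewrite subr_gt0.
have s0 : 0 < s by rewrite (lt_trans ltr01).
rewrite /power_ratio [1 + (s - 1)]addrC subrK powRM ?powR_ge0//; last first.
  have -> : 1 + (s - 1) * (1 - conj_exponent q) = (q - s) / (q - 1) by rewrite /conj_exponent; field.
  by rewrite invr_ge0 divr_ge0 ?ltW.
have -> : (1 + (s - 1) * (1 - conj_exponent q))^-1 = (q - 1) / (q - s).
  by rewrite /conj_exponent; field; rewrite q10/= gt_eqF.
congr (_ * _); rewrite -powRrM.
have -> : (1 - conj_exponent q) * (q - 1) = -1 by rewrite /conj_exponent; field.
by rewrite powR_inv1 ?ltW.
Qed.

Lemma conj_exponent_lt0 (R : realType) (q : R) : 1 < q -> 1 - conj_exponent q < 0.
Proof.
move=> q1; have q10 : 0 < q - 1 by rewrite subr_gt0.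
by rewrite subr_lt0 /conj_exponent ltr_pdivlMr// mul1r ltrBlDr ltrDl.
Qed.

Lemma avg_ge0 (R : realType) (n : nat) (J : set (Rn R n)) (f : Rn R n -> \bar R) :
  open_rectangle J -> (forall x, J x -> (0 <= f x)%E) -> (0 <= avg J f)%E.
Proof.
move=> /rectangle_cell[c nc ->] f0; rewrite avg_box// mule_ge0 ?integral_ge0//.
by rewrite lee_fin invr_ge0 ltW// box_volume_gt0.
Qed.

Section characteristic_bounds.
Context {R : realType} {n : nat}.
Local Notation mu := (@lebesgue R n).
Variables (p delta : R) (I : set (Rn R n)) (w : Rn R n -> R).
Hypotheses (p1 : 1 < p) (delta1 : 1 <= delta) (rI : open_rectangle I)
  (Hw : strong_RH p delta I w).

Let coef (s q : R) : 1 < s -> s < q -> 0 < 1 + (s - 1) * (1 - conj_exponent q).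
Proof.
move=> s1 sq; have q1 : 0 < q - 1 by rewrite subr_gt0 (lt_trans s1).
have -> : 1 + (s - 1) * (1 - conj_exponent q) = (q - s) / (q - 1).
  by rewrite /conj_exponent; field; rewrite gt_eqF.
by rewrite divr_gt0// subr_gt0.
Qed.

Lemma Aq_le (s q : R) : 1 < s -> s < q -> delta `^ p <= power_ratio (s - 1) p ->
  (Aq_characteristic q I w <= (s^-1 * ((q - 1) / (q - s)) `^ (q - 1))%:E)%E.
Proof.
move=> s1 sq ds; have q1 : 1 < q by exact: lt_trans sq.
apply: ge_ereal_sup => _ [J JI <-].
have [m [m0 avgw H _]] := strong_RH_moments p1 delta1 rI Hw JI.
rewrite avgw -inv_pow_Aq//; set r := 1 - conj_exponent q.
have r0 : r < 0 by exact: conj_exponent_lt0.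
have Kr : 0 < power_ratio (s - 1) r.
  by apply: power_ratio_gt0; [rewrite addrC subrK (lt_trans ltr01)|exact: coef].
have {}H := H (s - 1) r; rewrite subr_gt0 in H.
have {}H := H s1 r0 (coef s1 sq) ds.
have q10 : 0 <= q - 1 by rewrite subr_ge0 ltW.
have A0 : (0 <= avg J (fun x => powRe (w x) r))%E.
  by apply: avg_ge0 (JI.1) _ => x _; rewrite /powRe; case: ifP => // _; rewrite lee_fin powR_ge0.
apply: le_trans (_ : m%:E * (power_ratio (s - 1) r * m `^ r)%:E `^ (q - 1) <= _)%E.
  by apply: lee_wpmul2l; [rewrite lee_fin ltW|exact: poweR_homo].
rewrite poweR_EFin -EFinM lee_fin powRM ?(ltW Kr) ?powR_ge0// -powRrM.
have -> : r * (q - 1) = -1 by rewrite /r /conj_exponent; field; rewrite gt_eqF// subr_gt0.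
by rewrite powR_inv1 ?(ltW m0)// mulrCA divff ?mulr1// gt_eqF.
Qed.

(** By Jensen's inequality the exponential mean is at most the average of the negative power raised
    to [q - 1], so it inherits the bound for each [q]; the limit in [q] is taken later. *)
Lemma Ainfty_le (s q : R) : 1 < s -> s < q -> delta `^ p <= power_ratio (s - 1) p ->
  (Ainfty_characteristic I w <= (s^-1 * ((q - 1) / (q - s)) `^ (q - 1))%:E)%E.
Proof.
move=> s1 sq ds; have q1 : 1 < q by exact: lt_trans sq.
apply: ge_ereal_sup => _ [J JI <-].
have [m [m0 avgw H _]] := strong_RH_moments p1 delta1 rI Hw JI.
rewrite avgw -inv_pow_Aq//; set r := 1 - conj_exponent q.
have r0 : r < 0 by exact: conj_exponent_lt0.
have Kr : 0 < power_ratio (s - 1) r.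
  by apply: power_ratio_gt0; [rewrite addrC subrK (lt_trans ltr01)|exact: coef].
have {}H := H (s - 1) r; rewrite subr_gt0 in H.
have {}H := H s1 r0 (coef s1 sq) ds.
have q10 : 0 < q - 1 by rewrite subr_gt0.
set A := power_ratio (s - 1) r * m `^ r in H.
have A0 : 0 < A by rewrite mulr_gt0 ?powR_gt0.
suff L : ((- ((q - 1) * ln A))%:E <= avg J (fun x => lne (w x)%:E))%E.
  apply: le_trans (_ : m%:E * expeR ((q - 1) * ln A)%:E <= _)%E.
    apply: lee_wpmul2l; first by rewrite lee_fin ltW.
    by rewrite lee_expeR leeNl -EFinN.
  rewrite /= -EFinM lee_fin.
  have -> : expR ((q - 1) * ln A) = A `^ (q - 1) by rewrite /powR gt_eqF.
  rewrite powRM ?(ltW Kr) ?powR_ge0// -powRrM.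
  have -> : r * (q - 1) = -1 by rewrite /r /conj_exponent; field; rewrite gt_eqF.
  by rewrite powR_inv1 ?(ltW m0)// mulrCA divff ?mulr1// gt_eqF.
have [[mw w0] _] := Hw; have [rJ JI'] := JI; have [c nc JE] := rectangle_cell rJ.
have mJ := measurable_rectangle rJ.
have mwJ : measurable_fun J w by exact: (measurable_funS (measurable_rectangle rI) JI' mw).
have v0 := box_volume_gt0 nc.
have pow0 x : (0 <= powRe (w x) r)%E by rewrite /powRe; case: ifP => // _; rewrite lee_fin powR_ge0.
have mpow : measurable_fun J (fun x => powRe (w x) r).
  exact: (measurableT_comp (measurable_powRe r) mwJ).
have Ile : (\int[mu]_(x in J) powRe (w x) r <= (A * box_volume c.1 c.2)%:E)%E.
  by move: H; rewrite JE avg_box// lee_pdivrMr// -EFinM.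
have iP : mu.-integrable J (fun x => powRe (w x) r).
  apply/integrableP; split => //.
  under eq_integral do rewrite gee0_abs//.
  by apply: le_lt_trans Ile _; rewrite ltry.
(* These come from ln y <= y - 1 at y = w^r / A, multiplied by [q - 1]; since (q - 1) r = -1 it
   reads k - b w^r <= ln w. Where [w = 0] the left side is [-oo]. *)
pose k := (q - 1) * (1 - ln A); pose b := (q - 1) / A.
have b0 : 0 < b by rewrite divr_gt0.
have Jfin : (mu J < +oo)%E by rewrite JE [X in (X < _)%E]lebesgue_box ltry.
have ic : mu.-integrable J (EFin \o cst k) by exact: integrable_cst_fin.
have ib : mu.-integrable J (fun x => b%:E * powRe (w x) r)%E by exact: integrableZl.
have pt x : J x -> ((EFin \o cst k) x - b%:E * powRe (w x) r <= lne (w x)%:E)%E.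
  move=> Jx; rewrite /powRe r0 andbT; have [->|wx0] := eqVneq (w x) 0.
    by rewrite gt0_muley ?lte_fin// addeNy leNye.
  have wx : 0 < w x by rewrite lt_neqAle eq_sym wx0 w0//; exact: JI'.
  rewrite lne_EFin// lee_fin.
  have y0 : 0 < w x `^ r by rewrite powR_gt0.
  have : ln (w x `^ r / A) <= w x `^ r / A - 1.
    rewrite -[X in ln X](subrKC 1); apply: le_ln1Dx.
    by rewrite ltrBrDl subrr divr_gt0.
  rewrite ln_div ?posrE// ln_powR => h.
  have : (q - 1) * (r * ln (w x) - ln A) <= (q - 1) * (w x `^ r / A - 1) by rewrite ler_pM2l.
  rewrite mulrBr mulrA.
  have -> : (q - 1) * r = -1 by rewrite /r /conj_exponent; field; rewrite gt_eqF.
  have -> : b * w x `^ r = (q - 1) * (w x `^ r / A) by rewrite /b -mulrA [A^-1 * _]mulrC.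
  rewrite /cst /k; move: (w x `^ r / A) (ln A) (ln (w x)) => X L l; lra.
rewrite JE avg_box// -JE lee_pdivlMr// -EFinM.
have mlog : measurable_fun J (fun x => lne (w x)%:E).
  exact: (measurableT_comp (@measurable_lne_EFin R) mwJ).
have /integrableP[mG _] := integrableB mJ ic ib.
apply: le_trans (@le_integral_measurable _ _ _ mu _ _ _ mJ mG mlog pt).
have Ek : (\int[mu]_(x in J) (EFin \o cst k) x = (k * box_volume c.1 c.2)%:E)%E.
  by rewrite EFinM -lebesgue_box -JE; exact: (integral_cst mu mJ k%:E).
rewrite (integralB mJ ic ib) Ek integralZl//.
move: Ile; have : (0 <= \int[mu]_(x in J) powRe (w x) r)%E by exact: integral_ge0.
case: (\int[mu]_(x in J) powRe (w x) r)%E => [y _|//|//]; rewrite lee_fin => yA.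
rewrite -!EFinM -EFinB lee_fin.
have : b * y <= (q - 1) * box_volume c.1 c.2.
  apply: le_trans (_ : b * (A * box_volume c.1 c.2) <= _); first by rewrite ler_pM2l.
  by rewrite /b mulrA divfK// gt_eqF.
rewrite /k; move: (box_volume _ _) (b * y) (ln A) => V Y L; lra.
Qed.

Lemma RH_le (a t : R) : -1 < a < 0 -> p < t -> 0 < 1 + a * t -> delta `^ p <= power_ratio a p ->
  (RH_characteristic t I w <= (power_ratio a t `^ t^-1)%:E)%E.
Proof.
move=> /andP[aN a0] pt at0 da; have t0 : 0 < t by rewrite (lt_trans _ pt)// (lt_trans ltr01).
apply: ge_ereal_sup => _ [J JI <-].
have [m [m0 avgw _ H]] := strong_RH_moments p1 delta1 rI Hw JI.
have aa : -1 < a < 0 by rewrite aN.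
have {}H := H a t aa pt at0 da.
have Kr : 0 < power_ratio a t by apply: power_ratio_gt0; rewrite // -ltrBlDl sub0r.
rewrite avgw inver gt_eqF// lee_pdivrMr// -EFinM.
have A0 : (0 <= avg J (fun x => (w x `^ t)%:E))%E.
  by apply: avg_ge0 (JI.1) _ => x _; rewrite lee_fin powR_ge0.
apply: le_trans (_ : (power_ratio a t * m `^ t)%:E `^ t^-1 <= _)%E.
  by apply: poweR_homo => //; rewrite invr_ge0 ltW.
rewrite poweR_EFin lee_fin powRM ?(ltW Kr) ?powR_ge0// -powRrM divff ?gt_eqF// powRr1// ltW//.
Qed.

(** The endpoint [t = p], which the moment bound for exponents above [p] leaves out. *)
Lemma RH_le_self : (RH_characteristic p I w <= delta%:E)%E.
Proof.
apply: ge_ereal_sup => _ [J JI <-].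
have [m [m0 avgw _ _]] := strong_RH_moments p1 delta1 rI Hw JI.
have [_ /(_ J JI)[_]] := Hw; rewrite avgw => h.
by rewrite inver gt_eqF// lee_pdivrMr.
Qed.

End characteristic_bounds.

(** * The constants *)

Section constants.
Context {R : realType}.
Implicit Types (s q p delta t a : R) (F : \bar R).

Lemma powR_gt1 (x r : R) : 1 < x -> 0 < r -> 1 < x `^ r.
Proof.
move=> x1 r0; rewrite /powR gt_eqF ?(lt_trans ltr01)//.
by rewrite -[ltLHS]expR0 ltr_expR mulr_gt0// ln_gt0.
Qed.

(** With [k.+2] the inverse is strictly below 1 already at [k = 0], which keeps approximating points
    inside open intervals. *)
Lemma cvg_addMV (x y : R) : x + y * k.+2%:R^-1 @[k --> \oo] --> x.
Proof.
rewrite -[X in _ --> X]addr0; apply: cvgD; first exact: cvg_cst.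
rewrite -[X in _ --> X](mulr0 y); apply: cvgM; first exact: cvg_cst.
rewrite (@cvg_shiftS R^o (@harmonic R)); exact: cvg_harmonic.
Qed.

(** The limit [s] to [s0] from above serves two purposes: [delta = 1], where the moment bound would
    need [a = 0], and part (ii), where every [s > delta] is admissible for some finite [p]. *)
Lemma Aq_constant_limit F s0 q : 1 <= s0 ->
  (forall s, s0 < s -> s < q -> (F <= (s^-1 * ((q - 1) / (q - s)) `^ (q - 1))%:E)%E) ->
  (F <= Aq_constant s0 q)%E.
Proof.
move=> s01 H; rewrite /Aq_constant; case: (leP q s0) => [_|sq]; first by rewrite leey.
have d0 : 0 < q - s0 by rewrite subr_gt0.
pose s k := s0 + (q - s0) * k.+2%:R^-1.
have ks k : s0 < s k < q.
  rewrite /s ltrDl mulr_gt0 ?invr_gt0//= -ltrBrDl -[ltRHS]mulr1 ltr_pM2l//.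
  by rewrite invf_lt1// ltr1n.
apply: (@le_cvg_EFin _ _ (fun k => (s k)^-1 * ((q - 1) / (q - s k)) `^ (q - 1))).
  by move=> k; have /andP[h1 h2] := ks k; exact: H.
have cs : s k @[k --> \oo] --> s0 by exact: cvg_addMV.
have s00 : s0 != 0 by rewrite gt_eqF// (lt_le_trans ltr01).
apply: cvgM; first exact: cvgV.
apply: cvg_powRf; first by rewrite divr_gt0// subr_gt0 (le_lt_trans s01).
apply: cvgM; first exact: cvg_cst.
apply: cvgV; first by rewrite gt_eqF.
by apply: cvgB => //; exact: cvg_cst.
Qed.

Lemma Ainfty_constant_limit F s0 : 1 <= s0 ->
  (forall s, s0 < s -> (F <= Ainfty_constant s)%E) -> (F <= Ainfty_constant s0)%E.
Proof.
move=> s01 H; pose s k := s0 + 1 * k.+2%:R^-1.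
apply: (@le_cvg_EFin _ _ (fun k => (s k)^-1 * expR (s k - 1))).
  by move=> k; apply: H; rewrite /s ltrDl mul1r.
have cs : s k @[k --> \oo] --> s0 by exact: cvg_addMV.
have s00 : s0 != 0 by rewrite gt_eqF// (lt_le_trans ltr01).
apply: cvgM; first exact: cvgV.
apply: (cvg_comp (fun k => s k - 1) (@expR R)); last exact: continuous_expR.
by apply: cvgB => //; exact: cvg_cst.
Qed.

Lemma Ainfty_constant_Aq F s : 1 < s ->
  (forall q, s < q -> (F <= (s^-1 * ((q - 1) / (q - s)) `^ (q - 1))%:E)%E) ->
  (F <= Ainfty_constant s)%E.
Proof.
move=> s1 H; have s0 : 0 < s by rewrite (lt_trans ltr01).
(* For [q = s + k.+2] the inequality ln(1 + x) <= x bounds the exponent (q - 1) ln((q - 1) / (q -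
   s)) by (q - 1) (s - 1) / (q - s), which equals [u k]. *)
pose u k := (s - 1) + (s - 1) ^+ 2 * k.+2%:R^-1.
apply: (@le_cvg_EFin _ _ (fun k => s^-1 * expR (u k))); last first.
  apply: cvgM; first exact: cvg_cst.
  apply: (cvg_comp u (@expR R)); last exact: continuous_expR.
  exact: cvg_addMV.
move=> k; pose q := s + k.+2%:R.
have sq : s < q by rewrite ltrDl.
apply: le_trans (H q sq) _; rewrite lee_fin ler_pM2l ?invr_gt0//.
have qs : 0 < q - s by rewrite subr_gt0.
have q1 : 0 < q - 1 by rewrite subr_gt0 (lt_trans s1).
have b0 : 0 < (q - 1) / (q - s) by rewrite divr_gt0.
rewrite /powR gt_eqF// ler_expR.
have -> : u k = (q - 1) * ((s - 1) / (q - s)).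
  rewrite /u /q (_ : s + k.+2%:R - s = k.+2%:R); last by rewrite addrAC subrr add0r.
  have : (k.+2%:R : R) != 0 by rewrite pnatr_eq0.
  by move: (k.+2%:R : R) => K K0; field.
rewrite ler_pM2l//; have -> : (q - 1) / (q - s) = 1 + (s - 1) / (q - s) by field; rewrite gt_eqF.
by apply: le_ln1Dx; rewrite (lt_trans (ltrN10 R))// divr_gt0// subr_gt0.
Qed.

(** For [delta = 1] it makes every such [a] admissible in the moment bounds. *)
Lemma bernoulli p a : 1 < p -> -1 < a -> 0 < 1 + a * p -> 1 <= power_ratio a p.
Proof.
move=> p1 a1 ap; rewrite /power_ratio ler_pdivlMr// mul1r.
have a0 : 0 <= 1 + a by rewrite -lerBlDl sub0r ltW.
by have := powR_tangent p1 ltr01 a0; rewrite !powR1 mulr1 (addrC 1 a) addrK mulrC.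
Qed.

(** The case [delta = 1]: negative [a] tends to 0, and [power_ratio a t] tends to 1. *)
Lemma RH_constant_limit F p t : 1 < p -> p < t ->
  (forall a, -1 < a < 0 -> 0 < 1 + a * t -> (F <= (power_ratio a t `^ t^-1)%:E)%E) -> (F <= 1)%E.
Proof.
move=> p1 pt H; have t1 : 1 < t by exact: lt_trans pt.
have t0 : 0 < t by exact: lt_trans t1.
pose a k := 0 + (- t^-1) * k.+2%:R^-1.
have ca : a k @[k --> \oo] --> 0 by exact: cvg_addMV.
have k1 k : (k.+2%:R^-1 : R) < 1 by rewrite invf_lt1// ltr1n.
have at_ k : 0 < 1 + a k * t.
  rewrite /a add0r mulrAC mulNr mulVf ?gt_eqF// mulN1r subr_gt0; exact: k1.
have a1 k : -1 < a k < 0.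
  rewrite /a add0r mulNr ltrN2 oppr_lt0 divr_gt0 ?invr_gt0// andbT.
  by rewrite -[ltRHS]mulr1; apply: ltr_pM; rewrite ?invr_ge0 ?(ltW t0)// invf_lt1.
apply: (@le_cvg_EFin _ _ (fun k => power_ratio (a k) t `^ t^-1)).
  by move=> k; exact: H.
have c1 : 1 + a k @[k --> \oo] --> (1 : R).
  by rewrite -[X in _ --> X]addr0; apply: cvgD => //; exact: cvg_cst.
have cK : power_ratio (a k) t @[k --> \oo] --> (1 : R).
  rewrite -[X in _ --> X](mulr1 1); apply: cvgM.
    by rewrite -[X in _ --> X](_ : 1 `^ t = 1); [exact: cvg_powRf|rewrite powR1].
  rewrite -[X in _ --> X]invr1; apply: cvgV; first exact: oner_neq0.
  rewrite -[X in _ --> X]addr0; apply: cvgD; first exact: cvg_cst.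
  by rewrite -(mul0r t); apply: cvgM => //; exact: cvg_cst.
by rewrite -[X in _ --> X](_ : 1 `^ t^-1 = 1); [exact: cvg_powRf|rewrite powR1].
Qed.

(** The intermediate value theorem provides a root, so [get] returns one, and clearing denominators
    shows that [qstar - 1] is the positive [a]. *)
Lemma qstar_spec p delta : 1 < p -> 1 < delta ->
  1 < qstar p delta /\ delta `^ p = power_ratio (qstar p delta - 1) p.
Proof.
move=> p1 d1; have p0 : 0 < p by exact: lt_trans p1.
have d0 : 0 < delta by exact: lt_trans d1.
have dp1 : 1 < delta `^ p by exact: powR_gt1.
rewrite /qstar gt_eqF//; set S := [set x : R | _].
suff [x Sx] : S !=set0.
  have [q1] : S (get S) by exact: getI Sx.
  set q := get S in q1 *; move=> /eqP.
  have q10 : q - 1 != 0 by rewrite subr_eq0 gt_eqF.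
  rewrite eq_sym -(inj_eq (mulIf q10)) divfK// eq_sym subr_eq => /eqP h; split=> //.
  rewrite /power_ratio [1 + (q - 1)]addrC subrK; have q0 : 0 < q by exact: lt_trans q1.
  have -> : 1 + (q - 1) * p = (q / delta) `^ p by rewrite h; ring.
  rewrite powRM ?invr_ge0 ?ltW// -(powR_inv1 (ltW d0)) -powRrM mulN1r powRN invfM invrK mulrA divff ?mul1r//.
  by rewrite gt_eqF// powR_gt0.
pose psi (x : R) := (x / delta) `^ p - 1 - p * (x - 1).
(* Chosen so that (X / delta)^p = p X, which gives [psi X = p - 1]. *)
pose X := (p * delta `^ p) `^ (p - 1)^-1.
have p10 : 0 < p - 1 by rewrite subr_gt0.
have pd : 1 < p * delta `^ p by rewrite -[ltLHS]mulr1 ltr_pM.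
have X1 : 1 < X by apply: powR_gt1; rewrite ?invr_gt0.
have X0 : 0 < X by exact: lt_trans X1.
have psi1 : psi 1 < 0.
  rewrite /psi subrr mulr0 subr0 subr_lt0 mul1r -(powR_inv1 (ltW d0)) -powRrM mulN1r powRN.
  by rewrite invf_lt1// (lt_trans _ dp1).
have psiX : 0 <= psi X.
  have XE : X `^ p = p * delta `^ p * X.
    rewrite -mulr_powRB1 ?(ltW X0)// mulrC; congr (_ * _).
    by rewrite /X -powRrM mulVf ?gt_eqF// powRr1// ltW// (lt_trans _ pd).
  rewrite /psi powRM ?invr_ge0 ?ltW// XE -(powR_inv1 (ltW d0)) -powRrM mulN1r powRN.
  have -> : p * delta `^ p * X / delta `^ p = p * X.
    by rewrite -!mulrA [X * _]mulrC [delta `^ p * _]mulrA divff ?mul1r// gt_eqF// powR_gt0.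
  by have -> : p * X - 1 - p * (X - 1) = p - 1 by ring; exact: ltW.
have cpsi : {within `[1, X], continuous psi}.
  apply/subspace_continuousP => x /=; rewrite in_itv/= => /andP[x1 _].
  have cid : id y @[y --> within [set` `[1, X]] (nbhs x)] --> id x by exact: cvg_within.
  apply: cvgB; first (apply: cvgB; last exact: cvg_cst).
    apply: cvg_powRf; first by rewrite divr_gt0// (lt_le_trans ltr01).
    by apply: cvgM => //; exact: cvg_cst.
  by apply: cvgM; [exact: cvg_cst|apply: cvgB => //; exact: cvg_cst].
have [|x xX psix] := @IVT R psi 1 X 0 (ltW X1) cpsi.
  by rewrite ge_min (ltW psi1)/= le_max psiX orbT.
move: xX; rewrite in_itv/= le_eqVlt => /andP[/predU1P[x1|x1] _].
  by move: psi1; rewrite x1 psix ltxx.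
exists x; split => //; have x10 : x - 1 != 0 by rewrite subr_eq0 gt_eqF.
move/eqP: psix; rewrite subr_eq0 => /eqP ->.
by rewrite mulfK.
Qed.

(** The substitution a = -1 / x moves the unbounded range x > p to -1/p < a < 0, where the equation
    reads delta^p (1 + a p) = (1 + a)^p and changes sign between the ends. *)
Lemma tstar_spec p delta : 1 < p -> 1 < delta -> exists ts,
  [/\ tstar p delta = ts%:E, p < ts & delta `^ p = power_ratio (- ts^-1) p].
Proof.
move=> p1 d1; have p0 : 0 < p by exact: lt_trans p1.
have d0 : 0 < delta by exact: lt_trans d1.
have dp1 : 1 < delta `^ p by exact: powR_gt1.
rewrite /tstar gt_eqF//; set S := [set x : R | _].
have key (x : R) : p < x -> (delta * x / (x - 1)) `^ p * ((x - p) / x) =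
    delta `^ p * (1 + (- x^-1) * p) / (1 - x^-1) `^ p.
  move=> px; have x0 : 0 < x by exact: lt_trans px.
  have x1 : 0 < x - 1 by rewrite subr_gt0 (lt_trans p1).
  have b0 : 0 < 1 - x^-1 by rewrite subr_gt0 invf_lt1// -subr_gt0.
  have -> : delta * x / (x - 1) = delta / (1 - x^-1) by field; rewrite !gt_eqF.
  have -> : (x - p) / x = 1 + - x^-1 * p by field; rewrite gt_eqF.
  rewrite powRM ?invr_ge0 ?ltW// -(powR_inv1 (ltW b0)) -powRrM mulN1r powRN.
  by rewrite mulrAC.
suff [x Sx] : S !=set0.
  have [px] : S (get S) by exact: getI Sx.
  set ts := get S in px *; rewrite key// => h; exists ts; split => //.
  have ts0 : 0 < ts by exact: lt_trans px.
  have b0 : 0 < (1 - ts^-1) `^ p by rewrite powR_gt0// subr_gt0 invf_lt1// (lt_trans p1).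
  have c0 : 0 < 1 + - ts^-1 * p by rewrite mulNr subr_gt0 mulrC ltr_pdivrMr// mul1r.
  move/eqP: h; rewrite -(inj_eq (mulIf (lt0r_neq0 b0))) (divfK (lt0r_neq0 b0)) mul1r => /eqP h.
  by rewrite /power_ratio -h mulfK// gt_eqF.
pose f (a : R) := delta `^ p * (1 + a * p) - (1 + a) `^ p.
have pV : p^-1 < 1 by rewrite invf_lt1.
have f1 : f (- p^-1) < 0.
  by rewrite /f mulNr mulVf ?gt_eqF// subrr mulr0 sub0r oppr_lt0 powR_gt0// subr_gt0.
have f0 : 0 < f 0 by rewrite /f mul0r addr0 mulr1 powR1 subr_gt0.
have pN : - p^-1 <= 0 by rewrite oppr_le0 invr_ge0 ltW.
have cf : {within `[- p^-1, 0], continuous f}.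
  apply/subspace_continuousP => x /=; rewrite in_itv/= => /andP[x1 _].
  have cid : id y @[y --> within [set` `[- p^-1, 0]] (nbhs x)] --> id x by exact: cvg_within.
  apply: cvgB.
    apply: cvgM; first exact: cvg_cst.
    by apply: cvgD; [exact: cvg_cst|apply: cvgM => //; exact: cvg_cst].
  apply: cvg_powRf; first by rewrite -ltrBlDl sub0r (lt_le_trans _ x1)// ltrN2.
  by apply: cvgD => //; exact: cvg_cst.
have [|a aX fa] := @IVT R f (- p^-1) 0 0 pN cf.
  by rewrite ge_min (ltW f1)/= le_max (ltW f0) orbT.
move: aX; rewrite in_itv/= => /andP[a1 a0].
have {}a0 : a < 0.
  rewrite lt_neqAle a0 andbT; apply: contraTneq f0 => aE; move: fa; rewrite aE => ->.
  by rewrite ltxx.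
have {}a1 : - p^-1 < a.
  rewrite lt_neqAle a1 andbT; apply: contraTneq f1 => aE; move: fa; rewrite -aE => ->.
  by rewrite ltxx.
have na0 : 0 < - a by rewrite oppr_gt0.
exists (- a)^-1; have px : p < (- a)^-1.
  by rewrite -(invrK p) ltf_pV2 ?posrE ?invr_gt0// ltrNl.
split => //; rewrite key// invrK opprK.
move/eqP: fa; rewrite subr_eq0 => /eqP ->; rewrite divff// gt_eqF// powR_gt0//.
by rewrite -ltrBlDl sub0r (lt_trans _ a1)// ltrN2.
Qed.

Lemma power_ratio_root (u ts : R) : 1 < ts -> 0 < u -> u < ts ->
  power_ratio (- ts^-1) u `^ u^-1 = (ts - 1) / ts * (ts / (ts - u)) `^ u^-1.
Proof.
move=> ts1 u0 uts; have ts0 : 0 < ts by exact: lt_trans ts1.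
have b0 : 0 < 1 - ts^-1 by rewrite subr_gt0 invf_lt1.
rewrite /power_ratio.
have -> : 1 + - ts^-1 * u = (ts - u) / ts by field; rewrite gt_eqF.
rewrite powRM ?powR_ge0 ?invr_ge0 ?divr_ge0 ?(ltW ts0) ?subr_ge0 ?(ltW uts)//.
by rewrite -powRrM divff ?gt_eqF// powRr1 ?(ltW b0)// invf_div; congr (_ * _); field; rewrite gt_eqF.
Qed.

(** (s / delta)^p grows exponentially in [p], the denominator [1 + (s - 1) * p] only linearly. This
    is how every [s > delta] in part (ii) is reached from a finite exponent. *)
Lemma power_beats_linear s delta : 1 <= delta -> delta < s ->
  exists2 p, 1 < p & delta `^ p <= power_ratio (s - 1) p.
Proof.
move=> d1 ds; have d0 : 0 < delta by exact: lt_le_trans d1.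
have s1 : 1 < s by exact: le_lt_trans ds.
pose h := s / delta - 1; have h0 : 0 < h by rewrite subr_gt0 ltr_pdivlMr// mul1r.
have sE : s = (1 + h) * delta by rewrite /h addrC subrK divfK// gt_eqF.
(* For [p = 2 * m] the square of Bernoulli's inequality contributes the quadratic term m^2 h^2, and
   this [m] makes it at least [2 * m * (s - 1)]. *)
pose m := (Num.truncn (2 * (s - 1) / h ^+ 2)).+1.
have mh : 2 * (s - 1) <= m%:R * h ^+ 2.
  by rewrite -ler_pdivrMr ?exprn_gt0// ltW// truncnS_gt.
exists (2 * m)%:R; first by rewrite ltr1n /m; lia.
have m0 : 0 < (1 + (s - 1) * (2 * m)%:R) :> R.
  by rewrite ltr_wpDr// mulr_ge0// ?ler0n// subr_ge0 ltW.
rewrite /power_ratio [1 + (s - 1)]addrC subrK ler_pdivlMr//.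
rewrite !powR_mulrn ?(ltW d0) ?(ltW (lt_trans ltr01 s1))// sE exprMn mulrC.
rewrite ler_pM2r ?exprn_gt0// -sE mulnC exprM.
have b1 : 1 + m%:R * h <= (1 + h) ^+ m.
  elim: (m) => [|k IH]; first by rewrite mul0r addr0 expr0.
  rewrite exprS -[k.+1%:R]natr1; apply: le_trans (_ : (1 + h) * (1 + k%:R * h) <= _).
    rewrite -subr_ge0.
    have -> : (1 + h) * (1 + k%:R * h) - (1 + (k%:R + 1) * h) = k%:R * h ^+ 2 by ring.
    by rewrite mulr_ge0// ?ler0n// sqr_ge0.
  by rewrite ler_pM2l// addr_gt0.
have mh0 : 0 <= m%:R * h by rewrite mulr_ge0 ?ler0n// ltW.
have b2 : (1 + m%:R * h) ^+ 2 <= ((1 + h) ^+ m) ^+ 2.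
  by rewrite ler_sqr ?nnegrE ?(le_trans _ b1)// addr_ge0.
apply: le_trans b2; rewrite natrM.
have : m%:R * (2 * (s - 1)) <= m%:R * (m%:R * h ^+ 2) by rewrite ler_wpM2l ?ler0n.
rewrite expr2; move: mh0; move: (m%:R : R) => M; nra.
Qed.

End constants.

(** * Upper bounds with the stated constants *)

Section upper_bounds.
Context {R : realType} {n : nat}.
Local Notation mu := (@lebesgue R n).
Variables (delta : R) (I : set (Rn R n)) (w : Rn R n -> R).
Hypotheses (delta1 : 1 <= delta) (rI : open_rectangle I).

Lemma strong_RH_infty_sub (p : R) : 1 < p -> strong_RH_infty delta I w -> strong_RH p delta I w.
Proof.
move=> p1 [[mw w0] H]; split => // J JI; have [h1 h2] := H J JI; split => //.
have p0 : 0 < p by exact: lt_trans p1.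
have [rJ JsI] := JI; have [c nc JE] := rectangle_cell rJ.
have mJ := measurable_rectangle rJ; have v0 := box_volume_gt0 nc.
have mwJ : measurable_fun J w by exact: (measurable_funS (measurable_rectangle rI) JsI mw).
have iw : mu.-integrable J (EFin \o w).
  rewrite JE; apply: (avg_integrable nc); rewrite -JE//; last by case/andP: h1.
  by move=> x Jx; apply: w0; exact: JsI.
have avgw : avg J (EFin \o w) = ((\int[mu]_(x in J) w x) / box_volume c.1 c.2)%:E.
  by rewrite JE avg_EFin// -JE.
rewrite avgw in h1 h2 *; set m := _ / _ in h1 h2 *; have m0 : 0 < m by move: h1; rewrite lte_fin => /andP[].
(* The essential supremum is an infimum; the slack [e] produces a number [y] that bounds [w] almost
   everywhere. *)
apply/lee_addgt0Pr => e e0; rewrite -EFinM -EFinD.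
have y0 : 0 < delta * m + e by rewrite addr_gt0// mulr_gt0// (lt_le_trans ltr01).
have : (ess_sup_on J (EFin \o w) < (delta * m + e)%:E)%E.
  by apply: le_lt_trans h2 _; rewrite -EFinM lte_fin ltrDl.
move=> /ereal_inf_lt[y /= wy ylt].
have wle : {ae mu, forall x, J x -> ((w x `^ p)%:E <= ((delta * m + e) `^ p)%:E)%E}.
  apply: filterS wy => x h Jx; rewrite lee_fin; apply: powR_homo; first exact: ltW.
    by apply: w0; exact: JsI.
  by rewrite -lee_fin; apply: le_trans (h Jx) (ltW ylt).
have A0 : (0 <= avg J (fun x => (w x `^ p)%:E))%E.
  by apply: avg_ge0 rJ _ => x _; rewrite lee_fin powR_ge0.
apply: le_trans (_ : ((delta * m + e) `^ p)%:E `^ p^-1 <= _)%E; last first.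
  by rewrite poweR_EFin -powRrM divff ?gt_eqF// powRr1// ltW.
apply: poweR_homo => //; first by rewrite invr_ge0 ltW.
rewrite [in leLHS]JE avg_box// lee_pdivrMr// -JE.
have <- : (\int[mu]_(x in J) (cst ((delta * m + e) `^ p)%:E) x =
    ((delta * m + e) `^ p)%:E * (box_volume c.1 c.2)%:E)%E.
  by rewrite integral_cst// JE; congr (_ * _)%E; exact: lebesgue_box.
apply: (ae_ge0_le_integral mJ) => //.
- by move=> x _; rewrite lee_fin powR_ge0.
- by apply/measurable_EFinP; exact: (measurableT_comp (measurable_powR p) mwJ).
- by move=> x _; rewrite lee_fin powR_ge0.
Qed.

Lemma Aq_characteristic_le (p q : R) : 1 < p -> strong_RH p delta I w ->
  (Aq_characteristic q I w <= Aq_constant (qstar p delta) q)%E.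
Proof.
move=> p1 Hw; have [dE|d1] := eqVneq delta 1.
  (* Here [qstar = 1] corresponds to [a = 0], outside the moment bound, so [s] tends to 1 from above
     and Bernoulli's inequality supplies the hypothesis. *)
  rewrite /qstar dE eqxx; apply: Aq_constant_limit => // s s1 sq.
  apply: (Aq_le p1 delta1 rI Hw) => //; rewrite dE powR1; apply: bernoulli => //.
    by rewrite ltrBrDl addrN (lt_trans ltr01).
  by rewrite addr_gt0// mulr_gt0 ?subr_gt0// (lt_trans ltr01).
have {}d1 : 1 < delta by rewrite lt_neqAle eq_sym d1.
have [q1 qE] := qstar_spec p1 d1.
rewrite /Aq_constant; case: (leP q _) => [_|qs]; first by rewrite leey.
by apply: (Aq_le p1 delta1 rI Hw) => //; rewrite qE.
Qed.

Lemma Ainfty_characteristic_le (p : R) : 1 < p -> strong_RH p delta I w ->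
  (Ainfty_characteristic I w <= Ainfty_constant (qstar p delta))%E.
Proof.
move=> p1 Hw; have [dE|d1] := eqVneq delta 1.
  rewrite /qstar dE eqxx; apply: Ainfty_constant_limit => // s s1.
  apply: Ainfty_constant_Aq => // q sq.
  apply: (Ainfty_le p1 delta1 rI Hw) => //; rewrite dE powR1; apply: bernoulli => //.
    by rewrite ltrBrDl addrN (lt_trans ltr01).
  by rewrite addr_gt0// mulr_gt0 ?subr_gt0// (lt_trans ltr01).
have {}d1 : 1 < delta by rewrite lt_neqAle eq_sym d1.
have [q1 qE] := qstar_spec p1 d1.
apply: Ainfty_constant_Aq => // q qs.
by apply: (Ainfty_le p1 delta1 rI Hw) => //; rewrite qE.
Qed.

Lemma Aq_characteristic_infty_le (q : R) : strong_RH_infty delta I w ->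
  (Aq_characteristic q I w <= Aq_constant delta q)%E.
Proof.
move=> Hw; apply: Aq_constant_limit => // s ds sq.
have [p p1 h] := power_beats_linear delta1 ds.
apply: (Aq_le p1 delta1 rI (strong_RH_infty_sub p1 Hw)) => //.
exact: le_lt_trans ds.
Qed.

Lemma Ainfty_characteristic_infty_le : strong_RH_infty delta I w ->
  (Ainfty_characteristic I w <= Ainfty_constant delta)%E.
Proof.
move=> Hw; apply: Ainfty_constant_limit => // s ds.
have s1 : 1 < s by exact: le_lt_trans ds.
have [p p1 h] := power_beats_linear delta1 ds.
apply: Ainfty_constant_Aq => // q qs.
exact: (Ainfty_le p1 delta1 rI (strong_RH_infty_sub p1 Hw)).
Qed.

Lemma RH_characteristic_le (p t : R) : 1 < p -> p <= t -> strong_RH p delta I w ->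
  (RH_characteristic t I w <= RH_constant p delta t)%E.
Proof.
move=> p1 pt Hw; have p0 : 0 < p by exact: lt_trans p1.
have t0 : 0 < t by exact: lt_le_trans pt.
have [dE|d1] := eqVneq delta 1.
  rewrite /RH_constant /tstar dE eqxx.
  move: pt; rewrite le_eqVlt => /predU1P[<-|pt]; first by have := RH_le_self p1 delta1 rI Hw; rewrite dE.
  apply: (RH_constant_limit p1 pt) => a a1 at0; apply: (RH_le p1 delta1 rI Hw) => //.
  have /andP[aN a0] := a1.
  rewrite dE powR1; apply: bernoulli => //.
  by apply: lt_le_trans at0 _; rewrite lerD2l ler_nM2l// ltW.
have {}d1 : 1 < delta by rewrite lt_neqAle eq_sym d1.
have [ts [tsE pts dE]] := tstar_spec p1 d1.
rewrite /RH_constant tsE; case: (ltP t ts) => [tts|_]; last by rewrite leey.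
have ts0 : 0 < ts by exact: lt_trans pts.
have ts1 : ts^-1 < 1 by rewrite invf_lt1// (lt_trans p1).
have CE := power_ratio_root (lt_trans p1 pts).
move: pt; rewrite le_eqVlt => /predU1P[<-|pt].
  rewrite -CE// -dE -powRrM divff ?gt_eqF// powRr1 ?(le_trans ler01)//.
  exact: (RH_le_self p1 delta1 rI Hw).
rewrite -CE//; apply: (RH_le p1 delta1 rI Hw) => //.
- by rewrite ltrN2 ts1 oppr_lt0 invr_gt0.
- by rewrite mulNr subr_gt0 mulrC ltr_pdivrMr// mul1r.
- by rewrite dE.
Qed.

End upper_bounds.

(** * Power weights *)

(* Summing the increments over [N] equal pieces telescopes, as [g] is monotone. *)
Lemma increments_eq (R : realType) (H g : R -> R) (a b : R) : a <= b ->
  (forall s t, a <= s -> s <= t -> t <= b -> g s <= g t) \/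
  (forall s t, a <= s -> s <= t -> t <= b -> g t <= g s) ->
  (forall s t, a <= s -> s <= t -> t <= b -> `|H t - H s| <= `|g t - g s| * (t - s)) ->
  H b = H a.
Proof.
move=> ab gm HH; apply/eqP; rewrite -subr_eq0 -normr_le0.
have add s t u : a <= s -> s <= t -> t <= u -> u <= b ->
    `|g t - g s| + `|g u - g t| = `|g u - g s|.
  move=> as_ st tu ub; have tb := le_trans tu ub; have at_ := le_trans as_ st.
  have su := le_trans st tu.
  case: gm => gm.
    have h1 := gm s t as_ st tb; have h2 := gm t u at_ tu ub; have h3 := gm s u as_ su ub.
    by rewrite !ger0_norm ?subr_ge0//; ring.
  have h1 := gm s t as_ st tb; have h2 := gm t u at_ tu ub; have h3 := gm s u as_ su ub.
  by rewrite !ler0_norm ?subr_le0//; ring.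
have bound (N : nat) : `|H b - H a| <= 0 + (`|g b - g a| * (b - a)) * N.+2%:R^-1.
  rewrite add0r -mulrA; set h := (b - a) / _.
  have h0 : 0 <= h by rewrite divr_ge0// subr_ge0.
  pose t k := a + k%:R * h.
  have tN : t N.+2 = b by rewrite /t mulrC divfK ?pnatr_eq0// addrC subrK.
  have tm k l : (k <= l)%N -> t k <= t l by move=> kl; rewrite lerD2l ler_wpM2r// ler_nat.
  have ta k : a <= t k by rewrite lerDl mulr_ge0// ler0n.
  have step k : (k <= N.+2)%N -> `|H (t k) - H a| <= `|g (t k) - g a| * h.
    elim: k => [|k IH] kN; first by rewrite /t mul0r addr0 !subrr normr0 mul0r.
    have tk : t k <= t k.+1 by exact: tm.
    have tb : t k.+1 <= b by rewrite -tN tm.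
    have h1 : t k.+1 - t k = h by rewrite /t -natr1; ring.
    rewrite -(add a (t k))// mulrDl -[X in _ <= _ + _ * X]h1.
    have -> : H (t k.+1) - H a = (H (t k) - H a) + (H (t k.+1) - H (t k)) by ring.
    apply: le_trans (ler_normD _ _) _; apply: lerD; first by apply: IH; exact: ltnW.
    exact: HH.
  by have := step _ (leqnn _); rewrite tN.
have lim0 := @cvg_addMV R 0 (`|g b - g a| * (b - a)).
by apply: (cvgr_to_ge lim0); apply: nearW.
Qed.

Section power_integrals.
Context {R : realType}.
Implicit Types (s t u b : R).

Lemma powR_between b s t u : 0 <= s -> s <= u -> u <= t -> 0 <= b \/ 0 < s ->
  Num.min (s `^ b) (t `^ b) <= u `^ b <= Num.max (s `^ b) (t `^ b).
Proof.
move=> s0 su ut; have u0 := le_trans s0 su.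
have [b0 _|b0 [//|s0']] := leP 0 b; last first.
  apply/andP; rewrite ge_min le_max; split; apply/orP; [right|left]; apply: powR_anti => //.
  exact: lt_le_trans su.
apply/andP; rewrite ge_min le_max; split; apply/orP; [left|right]; exact: powR_homo.
Qed.

Lemma powR_increment b s t : -1 < b -> 0 <= s -> s <= t -> 0 <= b \/ 0 < s ->
  Num.min (s `^ b) (t `^ b) * (t - s) <= (t `^ (b + 1) - s `^ (b + 1)) / (b + 1) <=
  Num.max (s `^ b) (t `^ b) * (t - s).
Proof.
move=> b1 s0 st bs; have c0 : 0 < b + 1 by rewrite -ltrBlDr sub0r.
have ts : 0 <= t - s by rewrite subr_ge0.
have [t0|tn] := eqVneq t 0.
  have -> : s = 0 by apply/eqP; rewrite eq_le s0 andbT -t0.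
  by rewrite t0 !subrr !mulr0 mul0r lexx.
have t0 : 0 < t by rewrite lt_neqAle eq_sym tn (le_trans s0).
have [b0|b0] := ltP b 0.
  have s0' : 0 < s by case: bs => // /(lt_le_trans b0); rewrite ltxx.
  (* For [b < 0] the power [b + 1] is concave, so the tangent inequality is applied to its inverse,
     the power [1 / (b + 1)], at x^(b + 1). *)
  have cV : 1 < (b + 1)^-1 by rewrite invf_gt1// gtrDr.
  have key (x y : R) : 0 < x -> 0 < y -> y `^ (b + 1) - x `^ (b + 1) <= (b + 1) * (x `^ b * (y - x)).
    move=> x0 y0; have := powR_tangent cV (powR_gt0 (b + 1) x0) (powR_ge0 y (b + 1)).
    rewrite -!powRrM divff ?gt_eqF// !powRr1 ?(ltW x0) ?(ltW y0)//.
    have -> : (b + 1) * ((b + 1)^-1 - 1) = - b by field; rewrite gt_eqF.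
    rewrite powRN; have xb : 0 < x `^ b by rewrite powR_gt0.
    move: (y `^ (b + 1)) (x `^ (b + 1)) => Y X h.
    have k0 : 0 < (b + 1) * x `^ b by rewrite mulr_gt0.
    have -> : Y - X = (b + 1) * x `^ b * ((b + 1)^-1 * (x `^ b)^-1 * (Y - X)).
      by field; rewrite !gt_eqF.
    by rewrite mulrA ler_pM2l// lerBrDl.
  rewrite ler_pdivlMr// ler_pdivrMr//.
  have k1 := key s t s0' t0; have k2 := key t s t0 s0'.
  have : t `^ b <= s `^ b by exact: powR_anti.
  move=> tsb; rewrite (min_r tsb) (max_l tsb).
  by apply/andP; split; [move: k2|move: k1]; lra.
rewrite ler_pdivlMr// ler_pdivrMr//.
have : s `^ b <= t `^ b by exact: powR_homo.
move=> stb; rewrite (min_l stb) (max_r stb).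
have [bE|bn] := eqVneq b 0.
  by rewrite bE add0r !powRr0 !powRr1 ?(ltW t0)// mul1r mulr1 lexx.
have b0' : 0 < b by rewrite lt_neqAle eq_sym bn.
have p1 : 1 < b + 1 by rewrite ltrDr.
have := powR_tangent p1 t0 s0; rewrite addrK => h1.
have h2 : s `^ b * (t - s) * (b + 1) <= t `^ (b + 1) - s `^ (b + 1).
  move: s0; rewrite le_eqVlt => /predU1P[<-|s0'].
    by rewrite !powR0 ?mul0r ?subr0 ?powR_ge0// gt_eqF.
  by have := powR_tangent p1 s0' (ltW t0); rewrite addrK; lra.
by apply/andP; split; [|move: h1]; lra.
Qed.

End power_integrals.

Section power_box.
Context {R : realType} {n : nat}.
Local Notation mu := (@lebesgue R n).
Implicit Types (c : 'rV[R]_n.+1 * 'rV[R]_n.+1).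
Local Notation coord x := ((x : 'rV[R]_n.+1) 0 0).
Local Notation cross c := (cross_section 0 c.1 c.2).

Definition coord_pow (z b : R) (x : Rn R n) : R := (coord x - z) `^ b.

Lemma measurable_coord_pow (z b : R) : measurable_fun setT (coord_pow z b).
Proof.
apply: (measurableT_comp (measurable_powR b)).
exact: (measurable_funB (@measurable_coord R n 0) (measurable_cst z)).
Qed.

Lemma integrable_coord_pow c (z b : R) : z <= c.1 0 0 -> 0 <= b \/ z < c.1 0 0 ->
  mu.-integrable (cell c) (EFin \o coord_pow z b).
Proof.
move=> za bz; have Dfin : (mu (cell c) < +oo)%E by rewrite [X in (X < _)%E]lebesgue_cbox ltry.
apply: le_integrable (integrable_cst_fin (measurable_cell c) Dfin
  (Num.max ((c.1 0 0 - z) `^ b) ((c.2 0 0 - z) `^ b))) => //.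
- exact: measurable_cell.
- by apply/measurable_EFinP; apply: measurable_funTS; exact: measurable_coord_pow.
- move=> x /(_ 0)/andP[h1 h2]; rewrite /= lee_fin !ger0_norm ?powR_ge0//; last first.
    by rewrite le_max powR_ge0.
  have : 0 <= b \/ 0 < c.1 0 0 - z by case: bz => ?; [left|right; rewrite subr_gt0].
  have z0 : 0 <= c.1 0 0 - z by rewrite subr_ge0.
  have h1' : c.1 0 0 - z <= coord x - z by rewrite lerD2r ltW.
  have h2' : coord x - z <= c.2 0 0 - z by rewrite lerD2r.
  by move=> /(powR_between z0 h1' h2')/andP[].
Qed.

(** As functions of the cut [t], the integral over the cut cell and the primitive have increments
    between the same bounds, the least and the greatest value of the power times the volume of the
    slab. By [increments_eq] they differ by a constant. *)
Lemma Rintegral_coord_pow c (z b : R) : proper_cell c -> -1 < b -> z <= c.1 0 0 ->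
  0 <= b \/ z < c.1 0 0 ->
  \int[mu]_(x in cell c) coord_pow z b x =
  cross c * (((c.2 0 0 - z) `^ (b + 1) - (c.1 0 0 - z) `^ (b + 1)) / (b + 1)).
Proof.
move=> nc b1 za bz; pose f := coord_pow z b \_ (cell c).
have mc := measurable_cell c.
have fi : mu.-integrable setT (EFin \o f) by apply: integrable_extension => //; exact: integrable_coord_pow.
pose G t := \int[mu]_(x in cell (c.1, row_set c.2 0 t)) f x.
pose F t := (t - z) `^ (b + 1) / (b + 1).
pose H t := G t - cross c * F t.
pose g t := cross c * (t - z) `^ b.
have cc0 : 0 <= cross c by exact: cross_section_ge0.
have ab : c.1 0 0 <= c.2 0 0 by exact: ltW.
have gm : (forall s t, c.1 0 0 <= s -> s <= t -> t <= c.2 0 0 -> g s <= g t) \/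
  (forall s t, c.1 0 0 <= s -> s <= t -> t <= c.2 0 0 -> g t <= g s).
  case: bz => [b0|zc]; [left|have [b0|b0] := leP 0 b; [left|right]] => s t as_ st tb;
    apply: ler_wpM2l => //.
  - by apply: powR_homo => //; [rewrite subr_ge0 (le_trans za)|rewrite lerD2r].
  - by apply: powR_homo => //; [rewrite subr_ge0 (le_trans za)|rewrite lerD2r].
  - by apply: powR_anti => //; [rewrite subr_gt0 (lt_le_trans zc)|rewrite lerD2r].
have HE : H (c.2 0 0) = H (c.1 0 0).
  apply: (increments_eq ab gm) => s t as_ st tb.
  pose e := (row_set c.1 0 s, row_set c.2 0 t) : 'rV[R]_n.+1 * 'rV[R]_n.+1.
  have ee : cross e = cross c by rewrite /= cross_section_setl cross_section_setr.
  have ve : box_volume e.1 e.2 = (t - s) * cross c.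
    by rewrite (box_volumeD1 0) ee /= !row_setE eqxx max_r// subr_ge0.
  have ec : subcell e c by move=> j; rewrite /= !row_setE; case: eqP => [->|].
  have ecs := subcell_subset ec.
  have GE : G t - G s = \int[mu]_(x in cell e) f x by exact: Rintegral_cutB.
  have s0 : 0 <= s - z by rewrite subr_ge0 (le_trans za).
  have st' : s - z <= t - z by rewrite lerD2r.
  have bs : 0 <= b \/ 0 < s - z by case: bz => [|zc]; [left|right; rewrite subr_gt0 (lt_le_trans zc)].
  have /andP[l1 l2] := powR_increment b1 s0 st' bs.
  have ts : t - z - (s - z) = t - s by ring.
  rewrite ts in l1 l2.
  have me := measurable_cell e.
  have efin : (mu (cell e) < +oo)%E by rewrite [X in (X < _)%E]lebesgue_cbox ltry.
  have fie : mu.-integrable (cell e) (EFin \o f) by exact: integrableS fi.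
  have fb x : cell e x -> Num.min ((s - z) `^ b) ((t - z) `^ b) <= f x <=
      Num.max ((s - z) `^ b) ((t - z) `^ b).
    move=> ex; rewrite /f patchE mem_set; last exact: ecs.
    have := ex 0; rewrite /= !row_setE eqxx => /andP[h1 h2].
    by apply: powR_between => //; rewrite lerD2r// ltW.
  have u1 : Num.min ((s - z) `^ b) ((t - z) `^ b) * ((t - s) * cross c) <= G t - G s.
    rewrite GE -ve -Rintegral_cell_cst; apply: le_Rintegral => //; first exact: integrable_cst_fin.
    by move=> x /fb/andP[].
  have u2 : G t - G s <= Num.max ((s - z) `^ b) ((t - z) `^ b) * ((t - s) * cross c).
    rewrite GE -ve -Rintegral_cell_cst; apply: le_Rintegral => //; first exact: integrable_cst_fin.
    by move=> x /fb/andP[].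
  have mM (x y : R) : Num.max x y - Num.min x y = `|y - x|.
    by case: (leP x y) => h; [rewrite ger0_norm ?subr_ge0|rewrite ltr0_norm ?subr_lt0// opprB].
  have -> : `|g t - g s| = cross c * (Num.max ((s - z) `^ b) ((t - z) `^ b) - Num.min ((s - z) `^ b) ((t - z) `^ b)).
    by rewrite mM /g -mulrBr normrM ger0_norm.
  have -> : H t - H s = (G t - G s) - cross c * (F t - F s) by rewrite /H; ring.
  have FE : F t - F s = ((t - z) `^ (b + 1) - (s - z) `^ (b + 1)) / (b + 1) by rewrite /F -mulrBl.
  rewrite -FE in l1 l2.
  have m1 : cross c * (Num.min ((s - z) `^ b) ((t - z) `^ b) * (t - s)) <= cross c * (F t - F s) by exact: ler_wpM2l.
  have m2 : cross c * (F t - F s) <= cross c * (Num.max ((s - z) `^ b) ((t - z) `^ b) * (t - s)) by exact: ler_wpM2l.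
  move: u1 u2 m1 m2; move: (Num.min _ _) (Num.max _ _) (cross c) (G t - G s) (F t - F s) => X Y C U V u1 u2 m1 m2.
  by rewrite ler_norml; apply/andP; split; lra.
have Ga : G (c.1 0 0) = 0.
  rewrite /G (_ : cell _ = set0) ?Rintegral_set0//; apply/seteqP; split => // x /(_ 0).
  by rewrite /= row_setE eqxx => /andP[/lt_le_trans h /h]; rewrite ltxx.
have Gb : G (c.2 0 0) = \int[mu]_(x in cell c) coord_pow z b x.
  by rewrite /G row_set_id -surjective_pairing Rintegral_extension.
rewrite -Gb; move: HE; rewrite /H Ga => /eqP; rewrite sub0r subr_eq => /eqP ->.
by rewrite /F mulrBl mulrBr addrC.
Qed.

End power_box.

Lemma cvg_le_EFin (R : realType) (x : \bar R) (u : nat -> R) (l : R) :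
  (forall k, ((u k)%:E <= x)%E) -> u @ \oo --> l -> (l%:E <= x)%E.
Proof.
case: x => [x|_ _|h]; last by have := h 0%N; rewrite leeNy_eq.
- by move=> ux ul; rewrite lee_fin; apply: (cvgr_to_le ul); apply: nearW => k; rewrite -lee_fin.
- exact: leey.
Qed.

Section mean_pow.
Context {R : realType}.
Implicit Types (s t b p a : R).

(** The mean of u^b over s < u < t, in closed form. *)
Definition mean_pow b s t : R := (t `^ (b + 1) - s `^ (b + 1)) / ((b + 1) * (t - s)).

Lemma mean_pow_gt0 b s t : -1 < b -> 0 <= s -> s < t -> 0 < mean_pow b s t.
Proof.
move=> b1 s0 st; have c0 : 0 < b + 1 by rewrite -ltrBlDr sub0r.
rewrite divr_gt0 ?mulr_gt0 ?subr_gt0//; apply: gt0_ltr_powR; rewrite ?nnegrE//.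
by rewrite (le_trans s0)// ltW.
Qed.

Lemma mean_pow0 b t : -1 < b -> 0 < t -> mean_pow b 0 t = t `^ b / (b + 1).
Proof.
move=> b1 t0; have c0 : 0 < b + 1 by rewrite -ltrBlDr sub0r.
rewrite /mean_pow powR0 ?gt_eqF// !subr0.
have -> : t `^ (b + 1) = t * t `^ b by rewrite -(mulr_powRB1 (ltW t0) c0) addrK.
by field; rewrite !gt_eqF.
Qed.

(** Since [X] is t t^a - s s^a, the value t^a is the convex combination of s^a and X / (t - s) with
    weights s / t and 1 - s / t. Convexity of the p-th power bounds t^(a p), and multiplying by [t]
    gives the claim for either sign of [a]. *)
Lemma mean_pow_RH p a s t : 1 < p -> -1 < a -> 0 < 1 + a * p -> 0 <= s -> s < t ->
  mean_pow (a * p) s t <= power_ratio a p * mean_pow a s t `^ p.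
Proof.
move=> p1 a1 ap s0 st; have t0 : 0 < t by exact: le_lt_trans st.
have c0 : 0 < a + 1 by rewrite -ltrBlDr sub0r.
have e0 : 0 < a * p + 1 by rewrite addrC.
have Y0 : 0 < t - s by rewrite subr_gt0.
pose X := t `^ (a + 1) - s `^ (a + 1).
have X0 : 0 < X by rewrite subr_gt0; apply: gt0_ltr_powR; rewrite ?nnegrE// ltW.
have splitx x b : 0 <= x -> 0 < b + 1 -> x `^ (b + 1) = x * x `^ b.
  by move=> x0 b0; rewrite -(mulr_powRB1 x0 b0) addrK.
have u0 : 0 <= s / t by rewrite divr_ge0// ltW.
have u1 : s / t < 1 by rewrite ltr_pdivrMr// mul1r.
have := powR_convex p1 (powR_ge0 s a) (divr_gt0 X0 Y0) u0 u1.
have -> : s / t * s `^ a + (1 - s / t) * (X / (t - s)) = t `^ a.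
  rewrite /X !splitx ?(ltW t0)//; move: (s `^ a) (t `^ a) => S T.
  by field; rewrite !gt_eqF.
rewrite -!powRrM => h.
have main : t `^ (a * p + 1) - s `^ (a * p + 1) <= (t - s) * (X / (t - s)) `^ p.
  rewrite !splitx ?(ltW t0)// lerBlDr.
  have := ler_wpM2l (ltW t0) h; move: (t `^ _) (s `^ (a * p)) ((X / _) `^ p) => T S Z.
  have -> : t * (s / t * S + (1 - s / t) * Z) = s * S + (t - s) * Z by field; rewrite gt_eqF.
  by rewrite addrC.
rewrite /mean_pow -/X /power_ratio ler_pdivrMr ?mulr_gt0//; apply: le_trans main _.
have -> : X / ((a + 1) * (t - s)) = (a + 1)^-1 * (X / (t - s)) by field; rewrite !gt_eqF.
have XY0 : 0 <= X / (t - s) by rewrite divr_ge0// ltW.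
rewrite (powRM _ _ XY0) ?invr_ge0 ?(ltW c0)// -(powR_inv1 (ltW c0)) -powRrM mulN1r powRN [1 + a]addrC.
have ca : (a + 1) `^ p != 0 by rewrite gt_eqF// powR_gt0.
move: ((a + 1) `^ p) ca ((X / (t - s)) `^ p) => C C0 Z.
rewrite le_eqVlt; apply/orP; left; apply/eqP; field.
by rewrite C0 addrC gt_eqF.
Qed.

Lemma mean_pow_RH_infty a s t : 0 <= a -> 0 <= s -> s < t -> t `^ a <= (1 + a) * mean_pow a s t.
Proof.
move=> a0 s0 st; have t0 : 0 < t by exact: le_lt_trans st.
have c0 : 0 < a + 1 by rewrite ltr_wpDl.
have Y0 : 0 < t - s by rewrite subr_gt0.
have splitx x : 0 <= x -> x `^ (a + 1) = x * x `^ a.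
  by move=> x0; rewrite -(mulr_powRB1 x0 c0) addrK.
have -> : (1 + a) * mean_pow a s t = (t `^ (a + 1) - s `^ (a + 1)) / (t - s).
  by rewrite /mean_pow; move: (t `^ _ - _) => X; field; rewrite gt_eqF //= gt_eqF.
rewrite ler_pdivlMr// !splitx ?(ltW t0)//.
have : s * s `^ a <= s * t `^ a by rewrite ler_wpM2l// powR_homo// ltW.
move: (s `^ a) (t `^ a) => S T; lra.
Qed.

End mean_pow.

Section power_averages.
Context {R : realType} {n : nat}.
Local Notation mu := (@lebesgue R n).
Implicit Types (c : 'rV[R]_n.+1 * 'rV[R]_n.+1) (z b : R).
Local Notation cross c := (cross_section 0 c.1 c.2).
Local Notation obox c := (box c.1 c.2 : set (Rn R n)).

Let integral_EFin c z b : mu.-integrable (cell c) (EFin \o coord_pow z b) ->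
  (\int[mu]_(x in cell c) (coord_pow z b x)%:E = (\int[mu]_(x in cell c) coord_pow z b x)%:E)%E.
Proof. by move=> fi; rewrite fineK//; apply: integrable_fin_num => //; exact: measurable_cell. Qed.

(** For [b < 0] the power is unbounded at the face where it is based, so the base is moved out of
    the cell by [e]. Both bounds tend to the integral of the unshifted power as [e] tends to 0. *)
Lemma coord_pow_shift c b (e : R) : proper_cell c -> -1 < b -> b < 0 -> 0 < e ->
  ((cross c * (((c.2 0 0 - c.1 0 0) `^ (b + 1) - e `^ (b + 1)) / (b + 1)))%:E <=
  \int[mu]_(x in cell c) (coord_pow (c.1 0 0 - e) b x)%:E <=
  (cross c * ((c.2 0 0 - c.1 0 0) `^ (b + 1) / (b + 1)))%:E)%E.
Proof.
move=> nc b1 b0 e0; have c0 : 0 < b + 1 by rewrite -ltrBlDr sub0r.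
have L0 : 0 < c.2 0 0 - c.1 0 0 by rewrite subr_gt0.
have ze : c.1 0 0 - e < c.1 0 0 by rewrite ltrBlDr ltrDl.
rewrite integral_EFin; last by apply: integrable_coord_pow; [exact: ltW|right].
rewrite Rintegral_coord_pow//; [|exact: ltW|by right].
have -> : c.2 0 0 - (c.1 0 0 - e) = (c.2 0 0 - c.1 0 0) + e by ring.
have -> : c.1 0 0 - (c.1 0 0 - e) = e by ring.
move: (c.2 0 0 - c.1 0 0) L0 => L L0.
have Le : 0 < L + e by rewrite addr_gt0.
rewrite !lee_fin; apply/andP; split; apply: (ler_wpM2l (cross_section_ge0 _ _ _));
  rewrite ler_pM2r ?invr_gt0//.
  by rewrite lerD2r; apply: powR_homo; rewrite ?(ltW c0) ?(ltW L0)// lerDl ltW.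
(* [t |-> t `^ (b + 1)] is subadditive, since [u <= u `^ (b + 1)] for [u] in [0, 1]. *)
have sub x : 0 < x -> x <= L + e -> x / (L + e) * (L + e) `^ (b + 1) <= x `^ (b + 1).
  move=> x0 xLe; have u1 : 0 < x / (L + e) <= 1 by rewrite divr_gt0// ler_pdivrMr// mul1r.
  have cle : b + 1 <= 1 by rewrite gerDr ltW.
  have := ger1_powR u1 cle; case/andP: u1 => u0 _ h.
  rewrite -[in leRHS](divfK (lt0r_neq0 Le) x) powRM ?(ltW u0) ?(ltW Le)//.
  by rewrite ler_pM2r// powR_gt0.
have h1 : L / (L + e) * (L + e) `^ (b + 1) <= L `^ (b + 1) by apply: sub; rewrite // lerDl ltW.
have h2 : e / (L + e) * (L + e) `^ (b + 1) <= e `^ (b + 1) by apply: sub; rewrite // lerDr ltW.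
have := lerD h1 h2; rewrite -mulrDl -mulrDl divff ?gt_eqF// mul1r.
by rewrite lerBlDr.
Qed.

Lemma integral_coord_pow c z b : proper_cell c -> -1 < b -> z <= c.1 0 0 ->
  (\int[mu]_(x in cell c) (coord_pow z b x)%:E =
  (cross c * (((c.2 0 0 - z) `^ (b + 1) - (c.1 0 0 - z) `^ (b + 1)) / (b + 1)))%:E)%E.
Proof.
move=> nc b1 zc; have c0 : 0 < b + 1 by rewrite -ltrBlDr sub0r.
have [bz|] := pselect (0 <= b \/ z < c.1 0 0).
  rewrite integral_EFin; last exact: integrable_coord_pow.
  by rewrite Rintegral_coord_pow.
move=> /not_orP[/negP]; rewrite -ltNge => b0 /negP; rewrite -leNgt => cz.
have {zc cz}-> : z = c.1 0 0 by apply/eqP; rewrite eq_le zc cz.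
rewrite subrr powR0 ?gt_eqF// subr0; apply/eqP; rewrite eq_le; apply/andP; split.
  apply: (@integral_le_lim _ _ _ mu (cell c)
    (fun k x => (coord_pow (c.1 0 0 - k.+1%:R^-1) b x)%:E) _ _ (measurable_cell c)).
  - by move=> k; apply/measurable_EFinP/measurable_funTS; exact: measurable_coord_pow.
  - by move=> k x _; rewrite lee_fin powR_ge0.
  - move=> x /(_ 0)/andP[h _] k l kl; rewrite lee_fin; apply: powR_anti => //.
      by rewrite subr_gt0 (lt_trans _ h)// ltrBlDr ltrDl invr_gt0.
    by rewrite lerD2l lerN2 lerD2l lerN2 lef_pV2 ?posrE// ler_nat.
  - move=> x /(_ 0)/andP[h _]; apply: cvg_EFin; first exact: nearW.
    suff -> : fine \o (fun k : nat => (coord_pow (c.1 0 0 - k.+1%:R^-1) b x)%:E) =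
        fun k => ((x : 'rV[R]_n.+1) 0 0 - c.1 0 0 + k.+1%:R^-1) `^ b.
      by apply: cvg_addV; rewrite subr_gt0.
    by apply/funext => k /=; congr (_ `^ _); rewrite opprB addrA addrAC.
  - move=> k; have k0 : (0 : R) < k.+1%:R^-1 by [].
    by have /andP[] := coord_pow_shift nc b1 b0 k0.
have lim0 : cross c * (((c.2 0 0 - c.1 0 0) `^ (b + 1) + (-1) * k.+2%:R^-1) / (b + 1)) @[k --> \oo] -->
    cross c * ((c.2 0 0 - c.1 0 0) `^ (b + 1) / (b + 1)).
  by apply: cvgM; [exact: cvg_cst|apply: cvgM; [exact: cvg_addMV|exact: cvg_cst]].
apply: (cvg_le_EFin _ lim0) => k.
(* For [b < 0] shifting the base outwards decreases the power, so the lower bound passes to the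
   unshifted integral; this [e] makes its error term e^(b + 1) equal to [1 / k.+2]. *)
pose e : R := k.+2%:R^-1 `^ (b + 1)^-1; have e0 : 0 < e by rewrite powR_gt0.
have eE : e `^ (b + 1) = k.+2%:R^-1 by rewrite -powRrM mulVf ?gt_eqF// powRr1.
have /andP[+ _] := coord_pow_shift nc b1 b0 e0; rewrite eE mulN1r => /le_trans; apply.
apply: ge0_le_integral => //.
- exact: measurable_cell.
- by move=> x _; rewrite lee_fin powR_ge0.
- by apply/measurable_EFinP/measurable_funTS; exact: measurable_coord_pow.
- by apply/measurable_EFinP/measurable_funTS; exact: measurable_coord_pow.
- move=> x /(_ 0)/andP[h _]; rewrite lee_fin; apply: powR_anti => //; first by rewrite subr_gt0.
  by rewrite lerD2l lerN2 lerBlDr lerDl ltW.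
Qed.

Lemma avg_coord_pow c z b : proper_cell c -> -1 < b -> z <= c.1 0 0 ->
  mu.-integrable (obox c) (EFin \o coord_pow z b) /\
  avg (obox c) (fun x => (coord_pow z b x)%:E) = (mean_pow b (c.1 0 0 - z) (c.2 0 0 - z))%:E.
Proof.
move=> nc b1 zc; have c0 : 0 < b + 1 by rewrite -ltrBlDr sub0r.
have mf D : measurable_fun D (fun x : Rn R n => (coord_pow z b x)%:E).
  by apply/measurable_EFinP/measurable_funTS; exact: measurable_coord_pow.
have iE := integral_coord_pow nc b1 zc.
have iEb : (\int[mu]_(x in obox c) (coord_pow z b x)%:E = \int[mu]_(x in cell c) (coord_pow z b x)%:E)%E.
  rewrite (@ge0_negligible_integral _ _ _ mu (cell c) (cell c `\` obox c))//.
  - by rewrite setDD setIidr//; exact: subset_box_cbox.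
  - by apply: measurableD; [exact: measurable_cell|exact: measurable_box].
  - exact: measurable_cell.
  - by move=> x _; rewrite lee_fin powR_ge0.
  - exact: cboxD_box.
split.
  apply/integrableP; split; first exact: mf.
  under eq_integral do rewrite gee0_abs ?lee_fin ?powR_ge0//.
  by rewrite iEb iE ltry.
rewrite avg_box// iEb iE -EFinM; congr EFin.
have L0 : 0 < c.2 0 0 - c.1 0 0 by rewrite subr_gt0.
rewrite (box_volumeD1 0) max_r ?(ltW L0)// /mean_pow.
have -> : c.2 0 0 - z - (c.1 0 0 - z) = c.2 0 0 - c.1 0 0 by ring.
have cr0 : 0 < cross c by apply: prodr_gt0 => j _; rewrite lt_max subr_gt0 nc orbT.
move: (_ `^ _ - _) => X; field.
by rewrite !gt_eqF.
Qed.

(** Comparison with the exponents [b' = -1 + 1 / k.+1]: for u <= d one has u^b >= d^(b - b') u^b',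
    and the mean of u^b' contains the factor [k.+1]. *)
Lemma avg_coord_pow_infty c b : proper_cell c -> b <= -1 ->
  avg (obox c) (fun x => (coord_pow (c.1 0 0) b x)%:E) = +oo%E.
Proof.
move=> nc b1; set z := c.1 0 0; pose d := c.2 0 0 - z.
have d0 : 0 < d by rewrite /d /z subr_gt0.
have C0 : 0 < d `^ b by rewrite powR_gt0.
have low (k : nat) : ((d `^ b * k.+1%:R)%:E <= avg (obox c) (fun x => (coord_pow z b x)%:E))%E.
  pose b' : R := -1 + k.+1%:R^-1; have b'1 : -1 < b' by rewrite ltrDl.
  have [ib' avgE] := avg_coord_pow nc b'1 (lexx z).
  have v0 := box_volume_gt0 nc.
  rewrite avg_box// lee_pdivlMr//.
  have -> : ((d `^ b * k.+1%:R)%:E * (box_volume c.1 c.2)%:E =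
      (d `^ (b - b'))%:E * \int[mu]_(x in obox c) (coord_pow z b' x)%:E)%E.
    move: avgE; rewrite avg_box//.
    have -> : mean_pow b' (z - z) (c.2 0 0 - z) = d `^ b' * k.+1%:R.
      by rewrite subrr mean_pow0// -/d {2}/b' addrAC addNr add0r invrK.
    have fin : (\int[mu]_(x in obox c) (coord_pow z b' x)%:E)%E \is a fin_num.
      by apply: integrable_fin_num => //; exact: measurable_box.
    rewrite -(fineK fin) -!EFinM => -[h]; congr EFin.
    have -> : fine (\int[mu]_(x in obox c) (coord_pow z b' x)%:E) = d `^ b' * k.+1%:R * box_volume c.1 c.2.
      by rewrite -h divfK// gt_eqF.
    rewrite !mulrA -powRD ?subrK//; by apply/implyP => _; rewrite gt_eqF.
  rewrite -integralZl//; last exact: measurable_box.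
  apply: ge0_le_integral => //.
  - exact: measurable_box.
  - by move=> x _; rewrite -EFinM lee_fin mulr_ge0// powR_ge0.
  - apply/measurable_EFinP; apply: measurable_funM => //; apply: measurable_funTS; exact: measurable_coord_pow.
  - by apply/measurable_EFinP/measurable_funTS; exact: measurable_coord_pow.
  - move=> x /(_ 0)/andP[h1 h2]; rewrite -EFinM lee_fin /coord_pow.
    have u0 : 0 < (x : 'rV[R]_n.+1) 0 0 - z by rewrite subr_gt0.
    have -> : ((x : 'rV[R]_n.+1) 0 0 - z) `^ b =
        ((x : 'rV[R]_n.+1) 0 0 - z) `^ (b - b') * ((x : 'rV[R]_n.+1) 0 0 - z) `^ b'.
      by rewrite -powRD ?subrK//; apply/implyP => _; rewrite gt_eqF.
    rewrite ler_pM2r ?powR_gt0//; apply: powR_anti => //; last by rewrite lerD2r ltW.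
    by rewrite subr_lt0 (le_lt_trans b1).
move: low; case: (avg _ _) => [A|//|] low; last by have := low 0%N.
have := low (Num.truncn (`|A| / d `^ b)); rewrite lee_fin leNgt => /negP[].
apply: le_lt_trans (ler_norm _) _; rewrite mulrC -ltr_pdivrMr//.
exact: truncnS_gt.
Qed.

End power_averages.

(** * Extremal weights *)

Section extremal_weights.
Context {R : realType} {n : nat}.
Local Notation mu := (@lebesgue R n).
Variables (c : 'rV[R]_n.+1 * 'rV[R]_n.+1) (a : R).
Hypotheses (nc : proper_cell c) (a1 : -1 < a).
Local Notation I := (box c.1 c.2 : set (Rn R n)).
Local Notation z := (c.1 0 0).
Local Notation len := (c.2 0 0 - c.1 0 0).
Local Notation w := (@coord_pow R n z a).

Let len0 : 0 < len. Proof. by rewrite subr_gt0. Qed.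

Let a10 : 0 < a + 1. Proof. by rewrite -ltrBlDr sub0r. Qed.

Lemma coord_pow_powR (p : R) (x : Rn R n) : w x `^ p = coord_pow z (a * p) x.
Proof. by rewrite /coord_pow powRrM. Qed.

Lemma coord_pow_powRe (p : R) (x : Rn R n) : I x -> powRe (w x) p = (coord_pow z (a * p) x)%:E.
Proof.
move=> /(_ 0)/andP[zx _]; rewrite /powRe coord_pow_powR gt_eqF//.
by rewrite powR_gt0// subr_gt0.
Qed.

Lemma subrectangle_cell J : rectangles_in I J -> exists d : 'rV[R]_n.+1 * 'rV[R]_n.+1,
  [/\ proper_cell d, J = box d.1 d.2 & z <= d.1 0 0].
Proof.
move=> [/rectangle_cell[d nd ->] dI]; exists d; split => //.
rewrite leNgt; apply/negP => dz.
pose mid j := (d.1 0 j + d.2 0 j) / 2.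
have dm j : d.1 0 j < mid j by rewrite ltr_pdivlMr//; have := nd j; lra.
have md j : mid j < d.2 0 j by rewrite ltr_pdivrMr//; have := nd j; lra.
(* A point of the rectangle whose first coordinate is at most [z], hence not in [I]. *)
pose x : 'rV[R]_n.+1 := \row_j (if j == 0 then Num.min (mid 0) z else mid j).
have xd : box d.1 d.2 x.
  move=> j; rewrite mxE; case: eqP => [->|_]; last by rewrite dm md.
  by rewrite lt_min dm dz/= gt_min md.
have := dI x xd 0; rewrite mxE eqxx lt_min => /andP[/andP[_]].
by rewrite ltxx.
Qed.

Let weight_w : weight_on I w.
Proof.
split; first by apply: measurable_funTS; exact: measurable_coord_pow.
by move=> x _; exact: powR_ge0.
Qed.

Let avg_w (d : 'rV[R]_n.+1 * 'rV[R]_n.+1) : proper_cell d -> z <= d.1 0 0 ->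
  avg (box d.1 d.2 : set (Rn R n)) (EFin \o w) = (mean_pow a (d.1 0 0 - z) (d.2 0 0 - z))%:E.
Proof. by move=> nd zd; have [] := avg_coord_pow nd a1 zd. Qed.

Let mean_gt0 (b : R) (d : 'rV[R]_n.+1 * 'rV[R]_n.+1) : -1 < b -> proper_cell d -> z <= d.1 0 0 ->
  0 < mean_pow b (d.1 0 0 - z) (d.2 0 0 - z).
Proof. by move=> b1 nd zd; apply: mean_pow_gt0 => //; rewrite ?subr_ge0// ltrD2r. Qed.

Lemma coord_pow_strong_RH (p delta : R) : 1 < p -> 0 < 1 + a * p -> 0 <= delta ->
  power_ratio a p <= delta `^ p -> strong_RH p delta I w.
Proof.
move=> p1 ap d0 dp; split => // J /subrectangle_cell[d [nd -> zd]].
have p0 : 0 < p by exact: lt_trans p1.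
have m0 := mean_gt0 a1 nd zd.
rewrite avg_w//; split; first by rewrite lte_fin m0 ltry.
have ap1 : -1 < a * p by rewrite -subr_gt0 opprK addrC.
under [X in avg _ X]eq_fun do rewrite coord_pow_powR.
have [_ ->] := avg_coord_pow nd ap1 zd.
rewrite poweR_EFin -EFinM lee_fin.
apply: le_trans (_ : ((delta * mean_pow a (d.1 0 0 - z) (d.2 0 0 - z)) `^ p) `^ p^-1 <= _); last first.
  by rewrite -powRrM divff ?gt_eqF// powRr1// mulr_ge0// ltW.
apply: powR_homo; first by rewrite invr_ge0 ltW.
  by rewrite ltW// mean_gt0.
rewrite powRM ?(ltW m0)//.
apply: le_trans (mean_pow_RH p1 a1 ap _ _) _; rewrite ?subr_ge0 ?ltrD2r//.
by rewrite ler_wpM2r// powR_ge0.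
Qed.

Lemma coord_pow_strong_RH_infty (delta : R) : 0 <= a -> 1 + a <= delta -> strong_RH_infty delta I w.
Proof.
move=> a0 ad; split => // J /subrectangle_cell[d [nd -> zd]].
have m0 := mean_gt0 a1 nd zd.
rewrite avg_w//; split; first by rewrite lte_fin m0 ltry.
apply: le_trans (_ : ((d.2 0 0 - z) `^ a)%:E <= _)%E.
  apply: ereal_inf_lbound => /=; apply: nearW => x /(_ 0)/andP[h1 h2].
  rewrite lee_fin; apply: powR_homo => //; last by rewrite lerD2r ltW.
  by rewrite subr_ge0 (le_trans zd)// ltW.
rewrite -EFinM lee_fin; apply: le_trans (mean_pow_RH_infty a0 (s := d.1 0 0 - z) _ _) _.
- by rewrite subr_ge0.
- by rewrite ltrD2r.
- by rewrite ler_wpM2r// ltW.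
Qed.

Let II : rectangles_in I I. Proof. by split => //; exact: cell_rectangle. Qed.

Let avg_wI : avg I (EFin \o w) = (len `^ a / (a + 1))%:E.
Proof. by rewrite avg_w// subrr mean_pow0. Qed.

Let avg_pow (b : R) : -1 < b ->
  avg I (fun x => (coord_pow z b x)%:E) = (len `^ b / (b + 1))%:E.
Proof. by move=> b1; have [_ ->] := avg_coord_pow nc b1 (lexx z); rewrite subrr mean_pow0. Qed.

Let avg_eq (f g : Rn R n -> \bar R) : (forall x, I x -> f x = g x) -> avg I f = avg I g.
Proof. by move=> fg; rewrite /avg; congr (_ * _)%E; apply: eq_integral => x /set_mem; exact: fg. Qed.

(** The constant is attained on [J = I], where the base of the power lies on the boundary; for
    [q <= 1 + a] the average of the negative power diverges there. *)
Lemma Aq_coord_pow (q : R) : 0 <= a -> 1 < q -> (Aq_constant (1 + a) q <= Aq_characteristic q I w)%E.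
Proof.
move=> a0 q1; apply: le_trans (ereal_sup_ubound (ex_intro2 _ _ I II erefl)).
rewrite avg_wI; set r := 1 - conj_exponent q.
rewrite (avg_eq (fun x Ix => coord_pow_powRe r Ix)).
have q10 : 0 < q - 1 by rewrite subr_gt0.
have arE : a * r + 1 = (q - (1 + a)) / (q - 1) by rewrite /r /conj_exponent; field; rewrite gt_eqF.
have La : 0 < len `^ a / (a + 1) by rewrite divr_gt0// powR_gt0.
rewrite /Aq_constant; case: (leP q _) => [qa|aq].
  have -> : avg I (fun x => (coord_pow z (a * r) x)%:E) = +oo%E.
    by apply: avg_coord_pow_infty => //; rewrite -subr_le0 opprK arE pmulr_lle0 ?invr_gt0// subr_le0.
  by rewrite poweRyr ?gt_eqF// gt0_muley ?leey// lte_fin.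
have ar1 : -1 < a * r by rewrite -subr_gt0 opprK arE divr_gt0// subr_gt0.
have arV : 0 <= ((q - (1 + a)) / (q - 1))^-1 by rewrite invr_ge0 divr_ge0 ?subr_ge0 ?ltW.
rewrite avg_pow// poweR_EFin -EFinM lee_fin arE (powRM _ (powR_ge0 _ _) arV).
rewrite -powRrM (_ : a * r * (q - 1) = - a); last by rewrite /r /conj_exponent; field; rewrite gt_eqF.
rewrite powRN invf_div addrC.
have : len `^ a != 0 by rewrite gt_eqF// powR_gt0.
move: (len `^ a) (_ `^ (q - 1)) => X Y X0.
by rewrite le_eqVlt; apply/orP; left; apply/eqP; field; rewrite X0 gt_eqF.
Qed.

(** The mean of the logarithm over [I] is bounded above by means of [e]-th powers, which are already
    known; the bound becomes exact as [e] tends to 0. *)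
Lemma Ainfty_coord_pow : 0 <= a -> (Ainfty_constant (1 + a) <= Ainfty_characteristic I w)%E.
Proof.
move=> a0; apply: le_trans (ereal_sup_ubound (ex_intro2 _ _ I II erefl)).
rewrite avg_wI /Ainfty_constant.
have La : 0 < len `^ a by rewrite powR_gt0.
have lim0 : (1 + a)^-1 * expR (a + (- a) * k.+2%:R^-1) @[k --> \oo] --> (1 + a)^-1 * expR a.
  apply: cvgM; first exact: cvg_cst.
  apply: (cvg_comp (fun k => a + (- a) * k.+2%:R^-1) (@expR R)); last exact: continuous_expR.
  exact: cvg_addMV.
rewrite [1 + a - 1]addrC addrA addNr add0r.
apply: (cvg_le_EFin _ lim0) => k.
(* For this [e] one has [1 / (e + 1) = 1 - 1 / k.+2], in agreement with the exponent in [lim0]. *)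
pose e : R := k.+1%:R^-1; have e0 : 0 < e by rewrite invr_gt0.
have e1 : -1 < e by rewrite (lt_trans (ltrN10 R)).
(* [ln y <= (y `^ e - 1) / e], averaged over [y = u / len]. *)
suff L : (avg I (fun x => lne (w x)%:E) <= (a * (ln len - (e + 1)^-1))%:E)%E.
  apply: le_trans (_ : (len `^ a / (a + 1))%:E * expeR (- (a * (ln len - (e + 1)^-1))%:E) <= _)%E.
    rewrite /= -EFinM lee_fin.
    have -> : expR (- (a * (ln len - (e + 1)^-1))) = (len `^ a)^-1 * expR (a / (e + 1)).
      by rewrite mulrBr opprB addrC expRD expRN [in RHS]/powR gt_eqF// [a * ln _]mulrC.
    have -> : a + - a / k.+2%:R = a / (e + 1).
      rewrite /e -[k.+2]addn1 natrD; have : (k.+1%:R : R) != 0 by rewrite pnatr_eq0.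
      have : (0 : R) < k.+1%:R by [].
      by move: (k.+1%:R : R) => K K1 K0; field; rewrite !gt_eqF// ?addr_gt0.
    rewrite [a + 1]addrC; move: (expR _) => Y.
    rewrite le_eqVlt; apply/orP; left; apply/eqP; field.
    by rewrite (gt_eqF La) gt_eqF// addrC.
  apply: lee_wpmul2l; first by rewrite lee_fin divr_ge0 ?powR_ge0// ltW.
  by rewrite lee_expeR leeN2.
have [ie avge] := avg_coord_pow nc e1 (lexx z).
have avgE := avg_pow e1.
pose k0 := a * (ln len - e^-1); pose k1 := a / (e * len `^ e).
have Le : 0 < len `^ e by rewrite powR_gt0.
have mI : measurable I by exact: measurable_box.
have v0 := box_volume_gt0 nc.
have Ifin : (mu I < +oo)%E by rewrite [X in (X < _)%E]lebesgue_box ltry.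
have ic : mu.-integrable I (EFin \o cst k0) by exact: integrable_cst_fin.
have ik : mu.-integrable I (fun x => (k1 * coord_pow z e x)%:E).
  by have := integrableZl mI k1 ie; apply: eq_integrable => // x _ /=; rewrite EFinM.
have ig : mu.-integrable I (fun x => (k0 + k1 * coord_pow z e x)%:E).
  by have := integrableD mI ic ik; apply: eq_integrable => // x _ /=; rewrite EFinD.
apply: le_trans (_ : avg I (fun x => (k0 + k1 * coord_pow z e x)%:E) <= _)%E.
  rewrite !avg_box//; apply: lee_wpmul2r; first by rewrite lee_fin invr_ge0 ltW.
  apply: (@le_integral_measurable _ _ _ mu _ _ _ mI).
  - apply: (measurableT_comp (@measurable_lne_EFin R)).
    by apply: measurable_funTS; exact: measurable_coord_pow.
  - by case/integrableP : ig.
  - move=> x /(_ 0)/andP[h1 h2]; rewrite /coord_pow.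
    have : 0 < (x : 'rV[R]_n.+1) 0 0 - z by rewrite subr_gt0.
    move: (_ - z) => u u0; rewrite lne_EFin ?powR_gt0// lee_fin ln_powR.
    have y0 : 0 < u / len by rewrite divr_gt0.
    have : ln ((u / len) `^ e) <= (u / len) `^ e - 1.
      rewrite -[X in ln X](subrKC 1); apply: le_ln1Dx.
      by rewrite ltrBrDl subrr powR_gt0.
    rewrite ln_powR ln_div ?posrE// powRM ?invr_ge0 ?(ltW u0) ?(ltW len0)//.
    rewrite -(powR_inv1 (ltW len0)) -powRrM mulN1r powRN => h.
    have {}h : ln u - ln len <= (u `^ e / len `^ e - 1) / e by rewrite ler_pdivlMr// mulrC.
    have := ler_wpM2l a0 h.
    rewrite /k0 /k1 => h'; rewrite -subr_ge0.
    move: h'; rewrite -subr_ge0; congr (0 <= _).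
    have : len `^ e != 0 by rewrite gt_eqF.
    move: (len `^ e) (u `^ e) (ln u) (ln len) => X Y lu ll X0.
    by field; rewrite X0 gt_eqF.
have -> : avg I (fun x => (k0 + k1 * coord_pow z e x)%:E) =
    (k0 + k1 * (len `^ e / (e + 1)))%:E.
  rewrite avg_box//; under eq_integral do rewrite EFinD.
  rewrite (integralD mI ic ik) (integral_cst mu mI k0%:E).
  under [X in (_ + X)%E]eq_integral do rewrite EFinM.
  rewrite integralZl// [X in (_ * X + _)%E]lebesgue_box.
  have fin : (\int[mu]_(x in I) (coord_pow z e x)%:E)%E \is a fin_num by exact: integrable_fin_num.
  have := avgE; rewrite avg_box// -(fineK fin) -EFinM => -[<-].
  set X := fine _; transitivity (((k0 * box_volume c.1 c.2 + k1 * X) / box_volume c.1 c.2)%:E) => //.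
  by congr EFin; rewrite mulrDl mulfK ?gt_eqF// mulrA.
rewrite lee_fin /k0 /k1 le_eqVlt; apply/orP; left; apply/eqP.
move: (ln len) (len `^ e) Le => l X X0; field.
by rewrite !gt_eqF// addr_gt0.
Qed.

Lemma RH_coord_pow (t : R) : 0 < t -> 0 < 1 + a * t ->
  ((power_ratio a t `^ t^-1)%:E <= RH_characteristic t I w)%E.
Proof.
move=> t0 at0; apply: le_trans (ereal_sup_ubound (ex_intro2 _ _ I II erefl)).
under [X in avg _ X]eq_fun do rewrite coord_pow_powR.
have at1 : -1 < a * t by rewrite -subr_gt0 opprK addrC.
have La : 0 < len `^ a by rewrite powR_gt0.
rewrite avg_wI avg_pow// poweR_EFin inver gt_eqF ?divr_gt0// -EFinM lee_fin.
have aa : 0 < 1 + a by rewrite addrC.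
rewrite /power_ratio !powRM ?powR_ge0 ?invr_ge0 ?(ltW at0)//; last by rewrite addrC ltW.
rewrite -!powRrM divff ?gt_eqF// -mulrA divff ?gt_eqF// mulr1 powRr1 ?(ltW aa)//.
rewrite [a * t + 1]addrC [a + 1]addrC invf_div; move: (_ `^ t^-1) => X.
by rewrite le_eqVlt; apply/orP; left; apply/eqP; field; rewrite gt_eqF.
Qed.

Lemma RH_coord_pow_infty (t : R) : 0 < t -> 1 + a * t <= 0 -> RH_characteristic t I w = +oo%E.
Proof.
move=> t0 at0; apply/eqP; rewrite -leye_eq.
apply: le_trans (ereal_sup_ubound (ex_intro2 _ _ I II erefl)).
under [X in avg _ X]eq_fun do rewrite coord_pow_powR.
have La : 0 < len `^ a by rewrite powR_gt0.
rewrite avg_wI avg_coord_pow_infty//; last by rewrite -subr_le0 opprK addrC.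
rewrite poweRyr ?invr_neq0 ?gt_eqF// inver gt_eqF ?divr_gt0// gt0_mulye ?leey//.
by rewrite lte_fin invr_gt0 divr_gt0.
Qed.

End extremal_weights.

(** Sharpness is always witnessed by a single weight that attains the constant. *)
Lemma sharp_boundP (R : realType) (n : nat) (W : set (Rn R n -> R)) (F : (Rn R n -> R) -> \bar R)
    (C : \bar R) (w0 : Rn R n -> R) :
  W w0 -> (forall w, W w -> (F w <= C)%E) -> (C <= F w0)%E -> sharp_bound W F C.
Proof. by move=> Ww0 FC Cw; split => // k Fk; exact: le_trans Cw (Fk _ Ww0). Qed.

Lemma qstar_ratio (R : realType) (p delta : R) : 1 < p -> 1 <= delta ->
  1 <= qstar p delta /\ delta `^ p = power_ratio (qstar p delta - 1) p.
Proof.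
move=> p1; rewrite le_eqVlt => /predU1P[<-|d1].
  by rewrite /qstar eqxx subrr /power_ratio mul0r addr0 powR1 divr1.
by have [q1 qE] := qstar_spec p1 d1; rewrite (ltW q1).
Qed.

Theorem theorem5 (R : realType) (n : nat) (p delta : R) (I : set (Rn R n))
    (p_gt1 : 1 < p) (delta_ge1 : 1 <= delta) (rectI : open_rectangle I) :
  [/\ (* (i) *)
      (forall q : R, 1 < q ->
         sharp_bound (strong_RH p delta I) (Aq_characteristic q I)
                     (Aq_constant (qstar p delta) q))
      /\ sharp_bound (strong_RH p delta I) (Ainfty_characteristic I)
                     (Ainfty_constant (qstar p delta)),
      (* (ii) *)
      (forall q : R, 1 < q ->
         sharp_bound (strong_RH_infty delta I) (Aq_characteristic q I)
                     (Aq_constant delta q))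
      /\ sharp_bound (strong_RH_infty delta I) (Ainfty_characteristic I)
                     (Ainfty_constant delta)
    & (* (iii) *)
      forall t : R, p <= t ->
         sharp_bound (strong_RH p delta I) (RH_characteristic t I)
                     (RH_constant p delta t)].
Proof.
have [c nc IE] := rectangle_cell rectI.
have p0 : 0 < p by exact: lt_trans p_gt1.
have d0 : 0 <= delta by exact: le_trans delta_ge1.
have shift (s : R) : 1 <= s -> [/\ 0 <= s - 1, -1 < s - 1 & 1 + (s - 1) = s].
  by move=> s1; rewrite subr_ge0 s1 ltrBrDl addrN (lt_le_trans ltr01)// addrC subrK.
split.
- have [q1 qE] := qstar_ratio p_gt1 delta_ge1.
  have [s0 s1 sE] := shift _ q1.
  (* The exponent depends on [p] and [delta] only, so one weight is extremal for every [q] and for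
     the exponential bound. At [delta = 1] it is the constant 1. *)
  have Hw : strong_RH p delta I (coord_pow (c.1 0 0) (qstar p delta - 1)).
    rewrite IE; apply: coord_pow_strong_RH => //; last by rewrite qE.
    by rewrite ltr_wpDr// mulr_ge0// ltW.
  split=> [q qgt1|]; apply: (sharp_boundP Hw).
  + by move=> w Ww; exact: Aq_characteristic_le.
  + by rewrite IE -{1}sE; exact: Aq_coord_pow.
  + by move=> w Ww; exact: Ainfty_characteristic_le.
  + by rewrite IE -{1}sE; exact: Ainfty_coord_pow.
- have [s0 s1 sE] := shift _ delta_ge1.
  have Hw : strong_RH_infty delta I (coord_pow (c.1 0 0) (delta - 1)).
    by rewrite IE; apply: coord_pow_strong_RH_infty => //; rewrite sE.
  split=> [q qgt1|]; apply: (sharp_boundP Hw).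
  + by move=> w Ww; exact: Aq_characteristic_infty_le.
  + by rewrite IE -{1}sE; exact: Aq_coord_pow.
  + by move=> w Ww; exact: Ainfty_characteristic_infty_le.
  + by rewrite IE -{1}sE; exact: Ainfty_coord_pow.
- move=> t pt; have t0 : 0 < t by exact: lt_le_trans pt.
  have up w : strong_RH p delta I w -> (RH_characteristic t I w <= RH_constant p delta t)%E.
    by move=> Ww; exact: RH_characteristic_le.
  move: (delta_ge1); rewrite le_eqVlt => /predU1P[dE|d1].
    have N0 : (-1 : R) < 0 by rewrite oppr_lt0.
    (* The exponent 0, thus a constant weight, replaces -1 / tstar when [tstar] is infinite. *)
    apply: (@sharp_boundP _ _ _ _ _ (coord_pow (c.1 0 0) 0)) => //; rewrite IE.
      apply: coord_pow_strong_RH => //; first by rewrite mul0r addr0.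
      by rewrite -dE powR1 /power_ratio mul0r addr0 powR1 divr1.
    rewrite /RH_constant /tstar -dE eqxx.
    have t00 : (0 : R) < 1 + 0 * t by rewrite mul0r addr0.
    by have := RH_coord_pow nc N0 t0 t00; rewrite /power_ratio mul0r addr0 !powR1 divr1 powR1.
  have [ts [tsE pts dE]] := tstar_spec p_gt1 d1.
  have ts0 : 0 < ts by exact: lt_trans pts.
  have tsV : ts^-1 < 1 by rewrite invf_lt1// (lt_trans p_gt1).
  have aN : -1 < - ts^-1 by rewrite ltrN2.
  have coef u : 1 + - ts^-1 * u = (ts - u) / ts by field; rewrite gt_eqF.
  (* The t-th power of this weight has exponent -t / ts, so it is integrable up to the face exactly
     when [t < ts]. *)
  apply: (@sharp_boundP _ _ _ _ _ (coord_pow (c.1 0 0) (- ts^-1))) => //; rewrite IE.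
    apply: coord_pow_strong_RH => //; last by rewrite dE.
    by rewrite coef divr_gt0// subr_gt0.
  rewrite /RH_constant tsE; case: (ltP t ts) => tts; last first.
    by rewrite RH_coord_pow_infty//; rewrite coef pmulr_lle0 ?invr_gt0// subr_le0.
  have at0 : 0 < 1 + - ts^-1 * t by rewrite coef divr_gt0// subr_gt0.
  apply: le_trans (RH_coord_pow nc aN t0 at0).
  by rewrite power_ratio_root// (lt_trans p_gt1).
Qed.
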